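(* Let $1\le k\le d$ be integers and let $\xi_1,\dots,\xi_k$ be independent centered non-degenerate Gaussian random vectors in $\mathbb{R}^d$ with covariance matrices $\Sigma_1,\dots,\Sigma_k$ respectively. For $i=1,\dots,k$ let $$\mathcal{E}_i=\{\mathbf{x}\in\mathbb{R}^d : \mathbf{x}^\top\Sigma_i^{-1}\mathbf{x}\le 1\}$$ be the location-dispersion ellipsoid of $\xi_i$, and let $M$ be the $k\times d$ random matrix whose rows are $\xi_1,\dots,\xi_k$. Then $$\mathbb{E}\sqrt{\det(MM^\top)}=\frac{(d)_k}{(2\pi)^{k/2}\,\kappa_{d-k}}\,V_d(\mathcal{E}_1,\dots,\mathcal{E}_k,\underbrace{B,\dots,B}_{d-k\text{ times}}),$$ where $V_d(\cdot,\dots,\cdot)$ is the mixed volume of $d$ convex bodies in $\mathbb{R}^d$ and $B$ is the closed unit ball in $\mathbb{R}^d$.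
   Context: A centered Gaussian vector is non-degenerate if its covariance matrix is invertible (symmetric positive definite). $(d)_k=d(d-1)\cdots(d-k+1)$, and $\kappa_n=\pi^{n/2}/\Gamma(1+n/2)$ is the volume of the unit ball in $\mathbb{R}^n$ (so $\kappa_0=1$). Mixed volume: for convex bodies $K_1,\dots,K_d\subset\mathbb{R}^d$, the function $(\lambda_1,\dots,\lambda_d)\mapsto \mathrm{Vol}_d(\lambda_1K_1+\dots+\lambda_dK_d)$ (Minkowski sums, $\lambda_i\ge 0$) is a homogeneous polynomial of degree $d$, written $$\mathrm{Vol}_d(\lambda_1K_1+\dots+\lambda_dK_d)=\sum_{i_1=1}^d\cdots\sum_{i_d=1}^d\lambda_{i_1}\cdots\lambda_{i_d}V_d(K_{i_1},\dots,K_{i_d})$$ with coefficients symmetric under permutations of $K_{i_1},\dots,K_{i_d}$. The number $V_d(K_1,\dots,K_d)$ is the mixed volume; equivalently, $V_d(K_1,\dots,K_d)=\frac{1}{d!}\frac{\partial^d}{\partial\lambda_1\cdots\partial\lambda_d}$ of this polynomial at $\lambda_1=\dots=\lambda_d=0$. In particular $V_d(K,\dots,K)=\mathrm{Vol}_d(K)$. *)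

(* Defs.v *)
From HB Require Import structures.
From mathcomp Require Import all_boot all_order all_algebra perm.
From mathcomp Require Import all_classical all_reals all_analysis.

Set Implicit Arguments.
Unset Strict Implicit.
Unset Printing Implicit Defensive.

Import Order.TTheory GRing.Theory Num.Theory.
Import numFieldNormedType.Exports.

Local Open Scope classical_set_scope.
Local Open Scope ring_scope.

(* R^n is 'rV[R]_n, with the sigma-algebra generated by the coordinates
   (the Borel sigma-algebra of R^n). *)
Definition measure_rV_display : measure_display. Proof. exact. Qed.

Section measurable_rV.
Context {R : realType} (n : nat).

Definition rV_coord (j : 'I_n) (x : 'rV[R]_n) : measurableTypeR R := x 0 j.

HB.instance Definition _ := @isMeasurable.Build measure_rV_display 'rV[R]_n
  (g_sigma_preimage rV_coord) (@sigma_algebra0 _ _ _)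
  (@sigma_algebraC _ _) (@sigma_algebra_bigcup _ _ _).

End measurable_rV.

Section sigma_finite_copy.
Context d (T : measurableType d) (R : realType).
Variable m : {measure set T -> \bar R}.
Hypothesis sfm : sigma_finite [set: T] m.

Definition sigma_finite_copy : set T -> \bar R := m.

HB.instance Definition _ := Measure.on sigma_finite_copy.
HB.instance Definition _ :=
  Measure_isSigmaFinite.Build _ _ _ sigma_finite_copy sfm.

Lemma sigma_finite_pack : exists q : {sigma_finite_measure set T -> \bar R},
  (m : set T -> \bar R) = q.
Proof. by exists sigma_finite_copy. Qed.

End sigma_finite_copy.

Section lebesgue_rV.
Context {R : realType}.

Definition rV_cons n (p : measurableTypeR R * 'rV[R]_n) : 'rV[R]_n.+1 :=
  row_mx (p.1%:M : 'rV[R]_1) p.2.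

(* n-dimensional Lebesgue measure, as the n-fold product measure *)
Fixpoint lebesgue_rV n : set 'rV[R]_n -> \bar R :=
  match n with
  | 0 => \d_(0 : 'rV[R]_0)
  | m.+1 => pushforward (lebesgue_measure \x @lebesgue_rV m)%E (@rV_cons m)
  end.

Lemma measurable_rV_coord n (j : 'I_n) :
  measurable_fun [set: 'rV[R]_n] (rV_coord j).
Proof.
move=> _ Y mY; rewrite setTI; apply: sub_sigma_algebra => /=.
rewrite -bigcup_seq/=; exists j => /=; first by rewrite mem_index_enum.
by exists Y => //; rewrite setTI.
Qed.

Lemma measurable_fun_rVP d (T : measurableType d) n (f : T -> 'rV[R]_n) :
  (forall j, measurable_fun [set: T] (rV_coord j \o f)) ->
  measurable_fun [set: T] f.
Proof.
move=> mf _ Y; rewrite /measurable/=.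
suff : g_sigma_preimage (@rV_coord R n) `<=`
    [set Y | measurable ([set: T] `&` f @^-1` Y)] by exact.
apply: smallest_sub.
  split=> /=.
  - by rewrite preimage_set0 setI0.
  - move=> A; rewrite /= !setTI setTD preimage_setC; exact: measurableC.
  - move=> F mF; rewrite preimage_bigcup setI_bigcupr.
    exact: bigcup_measurable.
move=> A; rewrite -bigcup_seq/= => -[j _ [B mB <-]] /=.
by rewrite !setTI; have := mf j measurableT B mB; rewrite setTI.
Qed.

Lemma rV_cons0 n (p : measurableTypeR R * 'rV[R]_n) :
  rV_cons p 0 ord0 = p.1.
Proof.
have -> : ord0 = lshift n (0 : 'I_1) by exact/val_inj.
exact: etrans (@row_mxEl _ 1 1 n _ _ _ _) (mxE _ _ _ _).
Qed.

Lemma rV_consS n (p : measurableTypeR R * 'rV[R]_n) j :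
  rV_cons p 0 (lift ord0 j) = p.2 0 j.
Proof.
have -> : lift ord0 j = rshift 1 j by exact/val_inj.
exact: (@row_mxEr _ 1 1 n).
Qed.

Lemma measurable_rV_cons n : measurable_fun setT (@rV_cons n).
Proof.
apply: measurable_fun_rVP => j; case: (unliftP ord0 j) => [i ->|->].
- have -> : rV_coord (lift ord0 i) \o @rV_cons n = rV_coord i \o snd.
    by apply/funext => p; exact: rV_consS.
  by apply: measurableT_comp => //; exact: measurable_rV_coord.
- have -> : rV_coord ord0 \o @rV_cons n = fst; last exact: measurable_fst.
  by apply/funext => p; exact: rV_cons0.
Qed.

Let rV_uncons n (x : 'rV[R]_n.+1) : measurableTypeR R * 'rV[R]_n :=
  (x 0 ord0, \row_j x 0 (lift ord0 j)).

Let rV_consK n : cancel (@rV_cons n) (@rV_uncons n).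
Proof.
move=> [t x]; rewrite /rV_uncons rV_cons0; congr pair.
by apply/rowP => j; rewrite mxE rV_consS.
Qed.

Let measurable_rV_uncons n : measurable_fun setT (@rV_uncons n).
Proof.
apply/measurable_fun_pair; first exact: measurable_rV_coord.
apply: measurable_fun_rVP => j.
rewrite (_ : _ \o _ = rV_coord (lift ord0 j)).
  exact: measurable_rV_coord.
by apply/funext => x; rewrite /rV_coord/= mxE.
Qed.

Lemma lebesgue_rV_sigma_finite_measure n :
  exists m : {sigma_finite_measure set 'rV[R]_n -> \bar R},
    @lebesgue_rV n = m.
Proof.
elim: n => [|n [m IH]]; first by exists \d_(0 : 'rV[R]_0).
pose mu1 : {sigma_finite_measure set (measurableTypeR R) -> \bar R} :=
  lebesgue_measure.
pose p0 : {measure set 'rV[R]_n.+1 -> \bar R} :=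
  pushforward (mu1 \x m)%E (@rV_cons n).
pose p := p0 (@measurable_rV_cons n).
have pE : @lebesgue_rV n.+1 = p by rewrite /= IH.
have sfp : sigma_finite [set: 'rV[R]_n.+1] p.
  have /sigma_finiteP[F [TF ndF Foo]] := sigma_finiteT mu1.
  have /sigma_finiteP[G [TG ndG Goo]] := sigma_finiteT m.
  exists (fun i => @rV_uncons n @^-1` (F i `*` G i)).
    apply/seteqP; split=> // x _.
    have : [set: measurableTypeR R] (@rV_uncons n x).1 by [].
    have : [set: 'rV[R]_n] (@rV_uncons n x).2 by [].
    rewrite TF TG => -[i _ Gi] [j _ Fj]; exists (maxn i j) => //; split.
      by move: Fj; exact/subsetPset/ndF/leq_maxr.
    by move: Gi; exact/subsetPset/ndG/leq_maxl.
  move=> i; have [mF Fi] := Foo i; have [mG Gi] := Goo i; split.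
    rewrite -[X in measurable X]setTI; apply: measurable_rV_uncons => //.
    exact: measurableX.
  rewrite /p /= /pushforward /= (_ : _ @^-1` _ = F i `*` G i); last first.
    have rV_consK' : @rV_uncons n \o @rV_cons n = id.
      by apply/funext; exact: rV_consK.
    by rewrite -comp_preimage rV_consK'.
  by rewrite product_measure1E// lte_mul_pinfty// ge0_fin_numE.
by have [q pq] := sigma_finite_pack sfp; exists q; rewrite pE.
Qed.

Section lebesgue_rV_measure.
Variable n : nat.
Local Notation vol := (@lebesgue_rV n).

Let lebesgue_rV0 : vol set0 = 0%E.
Proof. by have [m ->] := lebesgue_rV_sigma_finite_measure n. Qed.

Let lebesgue_rV_ge0 A : (0 <= vol A)%E.
Proof. by have [m ->] := lebesgue_rV_sigma_finite_measure n. Qed.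

Let lebesgue_rV_sigma_additive : semi_sigma_additive vol.
Proof.
have [m ->] := lebesgue_rV_sigma_finite_measure n.
exact: measure_semi_sigma_additive.
Qed.

HB.instance Definition _ := isMeasure.Build _ _ _ vol
  lebesgue_rV0 lebesgue_rV_ge0 lebesgue_rV_sigma_additive.

Let lebesgue_rV_sigma_finite : sigma_finite setT vol.
Proof.
have [m ->] := lebesgue_rV_sigma_finite_measure n; exact: sigma_finiteT.
Qed.

HB.instance Definition _ := Measure_isSigmaFinite.Build _ _ _ vol
  lebesgue_rV_sigma_finite.

End lebesgue_rV_measure.

Lemma lebesgue_rV_box n (A : 'I_n -> set (measurableTypeR R)) :
  (forall j, measurable (A j)) ->
  lebesgue_rV [set x : 'rV[R]_n | forall j, A j (x 0 j)] =
  (\prod_(j < n) lebesgue_measure (A j))%E.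
Proof.
elim: n A => [|n IH] A mA.
  rewrite big_ord0 /= diracE (_ : _ \in _)//.
  by apply/mem_set => -[].
rewrite big_ord_recl -IH => [|j]; last exact: mA.
have consE : @rV_cons n @^-1` [set x | forall j, A j (x 0 j)] =
    A ord0 `*` [set x : 'rV[R]_n | forall j, A (lift ord0 j) (x 0 j)].
  apply/seteqP; split => -[t x]/=.
    move=> H; split=> [|j]; first by have := H ord0; rewrite rV_cons0.
    by have := H (lift ord0 j); rewrite rV_consS.
  move=> [tA xA] j; case: (unliftP ord0 j) => [i ->|->].
    by rewrite rV_consS; exact: xA.
  by rewrite rV_cons0.
rewrite /= /pushforward consE product_measure1E//.
rewrite (_ : mkset _ = \bigcap_(j in [set: 'I_n])
    (rV_coord j @^-1` A (lift ord0 j))); last first.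
  by apply/seteqP; split => x xA j; [move=> _; exact: xA|exact: (xA j I)].
apply: fin_bigcap_measurable => // j _.
by rewrite -[X in measurable X]setTI; exact: measurable_rV_coord.
Qed.

End lebesgue_rV.

Section probability.
Context d (T : measurableType d) (R : realType) (P : probability T R).

(* The library's [normal_prob m 0] is not the point mass at [m]. *)
Definition normal_law (m s : R) : set (measurableTypeR R) -> \bar R :=
  if s == 0 then \d_m else normal_prob m s.

Definition gaussian_vector n (X : {RV P >-> 'rV[R]_n}) : Prop :=
  forall u : 'rV[R]_n, exists m s : R, 0 <= s /\
    forall A : set (measurableTypeR R), measurable A ->
      P ((fun w => \sum_j u 0 j * X w 0 j) @^-1` A) = normal_law m s A.

Definition centered n (X : {RV P >-> 'rV[R]_n}) : Prop :=
  forall j, 'E_P[fun w => (X w 0 j)%R]%E = 0%E.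

Definition covariance_matrix n (X : {RV P >-> 'rV[R]_n}) (S : 'M[R]_n) : Prop :=
  forall i j, covariance P (fun w => X w 0 i) (fun w => X w 0 j) = (S i j)%:E.

Definition mutually_independent (I : finType) d' (T' : measurableType d')
    (X : I -> {RV P >-> T'}) : Prop :=
  forall (J : {set I}) (A : I -> set T'), (forall i, measurable (A i)) ->
    P (\bigcap_(i in [set` J]) (X i @^-1` A i)) =
    (\prod_(i in J) P (X i @^-1` A i))%E.

End probability.

Section convex_geometry.
Context {R : realType} {n : nat}.
Implicit Types K : 'I_n -> set 'rV[R]_n.

Definition minkowski_comb (lam : 'I_n -> R) K : set 'rV[R]_n :=
  [set x | exists2 y : 'I_n -> 'rV[R]_n,
     (forall i, K i (y i)) & x = \sum_i lam i *: y i].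

(* [V f] is the coefficient V_n(K_(f 0), ..., K_(f (n - 1))) in the expansion
   of the volume of lam_0 K_0 + ... + lam_(n-1) K_(n-1). *)
Definition mixed_volume_coefs K (V : {ffun 'I_n -> 'I_n} -> R) : Prop :=
  (forall (s : {perm 'I_n}) (f : {ffun 'I_n -> 'I_n}),
     V [ffun i => f (s i)] = V f) /\
  (forall lam : 'I_n -> R, (forall i, 0 <= lam i) ->
     lebesgue_rV (minkowski_comb lam K) =
     (\sum_(f : {ffun 'I_n -> 'I_n}) (\prod_i lam (f i)) * V f)%:E).

(* The symmetric coefficients are unique; the default 0 is only taken when
   there are none, which does not happen for convex bodies. *)
Definition mixed_volume K : R :=
  xget 0 [set v | exists2 V, mixed_volume_coefs K V & v = V [ffun i => i]].

Definition ellipsoid (S : 'M[R]_n) : set 'rV[R]_n :=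
  [set x | (x *m invmx S *m x^T) 0 0 <= 1].

Definition closed_unit_ball : set 'rV[R]_n :=
  [set x | \sum_j x 0 j ^+ 2 <= 1].

(* K_0, ..., K_(k-1), B, ..., B, with n bodies in total *)
Definition pad_with_ball k (K : 'I_k -> set 'rV[R]_n) (i : 'I_n) :
    set 'rV[R]_n :=
  if insub (val i) is Some j then K j else closed_unit_ball.

End convex_geometry.

Section ball_volume.
Context {R : realType}.

Definition Gamma (s : R) : R :=
  \int[lebesgue_measure]_(t in `]0, +oo[) (t `^ (s - 1) * expR (- t)).

Definition kappa (n : nat) : R :=
  pi `^ (n%:R / 2) / Gamma (1 + n%:R / 2).

End ball_volume.

(* Main.v *)
(* For a centered Gaussian vector [xi] with covariance [Sigma],
     E |<xi, u>| = sqrt (2 / pi) * sqrt (u Sigma u^T),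
   i.e. the zonoid with support function [u |-> E |<xi, u>|] is a multiple of the
   ellipsoid of [xi].  Rounding [xi] to finitely many values turns this zonoid into
   a zonotope, close to the ellipsoid in ratio because the mean rounding error
   tends to 0.  The volume of a zonotope is an explicit sum of determinants, hence
   so are the mixed volumes of zonotopes, and by polarization they converge to the
   mixed volume of the ellipsoids and of [d - k] copies of the ball.  The ball is
   treated as one more ellipsoid, that of a linear image of [xi_1] with identity
   covariance.

   In the sum of [|det|] over the [d] zonotopes, fix the [k] rows [x] taken from
   the ellipsoids: [|det|] is [sqrt (det (x x^T))] times the determinant of the
   other rows projected on the orthogonal complement of [x], and summing over these
   gives the volume of a zonotope close to the unit ball of dimension [d - k],
   i.e. [kappa (d - k)] up to constants.  By independence the remaining sum is the
   expectation of [sqrt (det (M M^T))] for the rounded vectors, and dominated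
   convergence concludes. *)

Require Import Defs.
From HB Require Import structures.
From mathcomp Require Import all_boot all_order all_algebra perm.
From mathcomp Require Import all_classical all_reals all_analysis.
From mathcomp Require Import measurable_realfun ring lra.

Set Implicit Arguments.
Unset Strict Implicit.
Unset Printing Implicit Defensive.

Import Order.TTheory GRing.Theory Num.Theory.
Import numFieldNormedType.Exports.

Local Open Scope classical_set_scope.
Local Open Scope ring_scope.

(** * Lebesgue measure under affine maps *)

(** [mixed_volume] falls back to a default value unless symmetric coefficients exist, so their
    existence for ellipsoids has to be proved along the way. For zonotopes they are read off the
    volume formula. Polarization writes each of them as a fixed linear combination of volumes, so
    convergence of volumes alone makes them converge, and the limits serve as coefficients for the
    ellipsoids.

    Closeness is measured as a ratio because inclusions of [(1 - e) K] in [Z] and of [Z] in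
    [(1 + e) K] pass to Minkowski combinations with the same [e], and then cost only a factor
    [(1 - e) ^ n] or [(1 + e) ^ n] in volume.

    Independence is a statement about events. Rounding to finitely many values turns it into a
    product formula for finitely many weights, so no joint distribution has to be built. Up to a
    constant, these weights are also the lengths given to the generators of the zonotopes, which is
    why the expectation and the mixed volume meet in the same finite sum. *)

Lemma scaled_pushforward d1 d2 (T1 : measurableType d1) (T2 : measurableType d2)
    (R : realType) (m : {measure set T1 -> \bar R}) (f : T1 -> T2) (c : R) :
  0 <= c -> measurable_fun setT f ->
  exists q : {measure set T2 -> \bar R},
    forall A, q A = (c%:E * m (f @^-1` A))%E.
Proof.
move=> c0 mf.
pose p0 : {measure set T2 -> \bar R} := pushforward m f; pose p := p0 mf.
by exists (mscale (NngNum c0) p).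
Qed.

Section lebesgue_affine.
Context {R : realType}.
Notation mu := (@lebesgue_measure R).

Lemma measurable_affine (a b : R) : measurable_fun setT
  (fun x : measurableTypeR R => a * x + b : measurableTypeR R).
Proof.
by apply: (@measurable_funD _ _ R setT (fun x => a * x) (cst b)) => //;
  exact: measurable_funM.
Qed.

Lemma lebesgue_measure_affine (a b : R) (S : set (measurableTypeR R)) :
  a != 0 -> measurable S ->
  (`|a|%:E * mu ((fun x => (a * x + b)%R) @^-1` S) = mu S)%E.
Proof.
move=> a0 mS.
have [q qE] := scaled_pushforward mu (normr_ge0 a) (measurable_affine a b).
rewrite -qE; apply/esym; apply: lebesgue_measure_unique => // X.
move=> /ocitvP[->|[[x y] /= xy ->]]; first by rewrite !measure0.
rewrite qE.
have [agt0|alt0|] := ltgtP 0 a; last by move/eqP; rewrite eq_sym (negbTE a0).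
- rewrite (_ : _ @^-1` _ = [set` `](x - b) / a, (y - b) / a]])%R; last first.
    apply/seteqP; split=> z /=; rewrite !in_itv/=.
      by rewrite ltr_pdivrMr// ler_pdivlMr// ltrBlDr lerBrDr mulrC.
    by rewrite ltr_pdivrMr// ler_pdivlMr// ltrBlDr lerBrDr mulrC.
  rewrite lebesgue_measure_itv [X in (_ * X)%E]lebesgue_measure_itv/= !lte_fin.
  rewrite ltr_pM2r ?invr_gt0// ltrD2r xy.
  rewrite -!EFinB -EFinM gtr0_norm//; congr EFin.
  by field.
(* A negative slope reverses the interval, which becomes open on the right; its length is the
   same. *)
- rewrite (_ : _ @^-1` _ = [set` `[(y - b) / a, (x - b) / a[])%R; last first.
    apply/seteqP; split=> z /=; rewrite !in_itv/=.
      by rewrite ltr_ndivlMr// ler_ndivrMr// ltrBlDr lerBrDr mulrC andbC.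
    by rewrite ltr_ndivlMr// ler_ndivrMr// ltrBlDr lerBrDr mulrC andbC.
  rewrite lebesgue_measure_itv [X in (_ * X)%E]lebesgue_measure_itv/= !lte_fin.
  rewrite ltr_nM2r ?invr_lt0// ltrD2r xy.
  rewrite -!EFinB -EFinM ltr0_norm//; congr EFin.
  by field.
Qed.

End lebesgue_affine.

Section lebesgue_rV_unique.
Context {R : realType} (n : nat).
Notation mu := (@lebesgue_measure R).
Implicit Types A : 'I_n -> set (measurableTypeR R).

Definition box A : set 'rV[R]_n := [set x | forall j, A j (x 0 j)].

Lemma measurable_box A : (forall j, measurable (A j)) -> measurable (box A).
Proof.
move=> mA; rewrite (_ : box A = \bigcap_(j in [set: 'I_n])
    (rV_coord j @^-1` A j)); last first.
  by apply/seteqP; split => x xA j; [move=> _; exact: xA|exact: (xA j I)].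
apply: fin_bigcap_measurable => // j _.
by rewrite -[X in measurable X]setTI; exact: measurable_rV_coord.
Qed.

(** Boxes, unlike preimages under single coordinates, are stable under intersection, as uniqueness
    of measures requires of a generating class. *)
Lemma measurable_rV_box : (@measurable _ 'rV[R]_n) =
  <<s [set B | exists2 A, (forall j, measurable (A j)) & B = box A] >>.
Proof.
apply/seteqP; split.
  apply: smallest_sub; first exact: smallest_sigma_algebra.
  move=> B; rewrite -bigcup_seq/= => -[j _ [Y mY <-]].
  apply: sub_sigma_algebra => /=.
  exists (fun i => if i == j then Y else setT) => [i|]; first by case: ifP.
  rewrite setTI; apply/seteqP; split=> x /=; rewrite /box/=.
    by move=> Yx i; case: eqVneq => // ->.
  by move/(_ j); rewrite eqxx.
apply: smallest_sub; first exact: sigma_algebra_measurable.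
by move=> _ [A mA ->]; exact: measurable_box.
Qed.

Lemma lebesgue_rV_unique (nu : {measure set 'rV[R]_n -> \bar R}) :
  (forall A, (forall j, measurable (A j)) ->
    nu (box A) = (\prod_(j < n) mu (A j))%E) ->
  forall S, measurable S -> nu S = lebesgue_rV S.
Proof.
move=> nuE S mS; apply/esym.
pose g (k : nat) := box (fun=> `[- k%:R, k%:R]%classic).
apply: (measure_unique _ g measurable_rV_box) => //.
- move=> _ _ [A mA ->] [B mB ->]; exists (fun j => A j `&` B j) => [j|].
    exact: measurableI.
  apply/seteqP; split=> x /=; first by move=> [Ax Bx] j; split.
  by move=> ABx; split=> j; have [] := ABx j.
- by move=> k; exists (fun=> `[- k%:R, k%:R]%classic).
- apply/seteqP; split=> // x _; rewrite -[x]/(x : 'rV[R]_n).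
  have [N xN] : exists N : nat, forall j, `|(x : 'rV[R]_n) 0 j| <= N%:R.
    exists (\sum_j (Num.truncn `|(x : 'rV[R]_n) 0%R j|).+1)%N => j; rewrite (bigD1 j)//= natrD.
    rewrite -[leLHS]addr0 lerD//; apply/ltW.
    by rewrite truncnS_gt.
  by exists N => // j; rewrite /= in_itv/= -ler_norml.
- by move=> _ [A mA ->]; rewrite nuE//; exact: lebesgue_rV_box.
- move=> k; rewrite [ltLHS](_ : _ = (\prod_(j < n) (k%:R *+ 2 : R)%:E)%E); last first.
    rewrite [LHS]lebesgue_rV_box//; apply: eq_bigr => j _.
    rewrite lebesgue_measure_itv/= lte_fin.
    case: ifPn => [_|]; first by rewrite -EFinB opprK mulr2n.
    rewrite -leNgt => kk; suff -> : k%:R = 0 :> R by rewrite mul0rn.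
    have k0 : 0 <= k%:R :> R by [].
    lra.
  by rewrite prodEFin ltry.
Qed.

End lebesgue_rV_unique.

Section lebesgue_rV_linear.
Context {R : realType}.
Notation mu := (@lebesgue_measure R).
Notation vol := (@lebesgue_rV R _).

Lemma measurable_mulmx n p (A : 'M[R]_(n, p)) :
  measurable_fun setT (fun x : 'rV[R]_n => x *m A : 'rV[R]_p).
Proof.
apply: measurable_fun_rVP => j.
rewrite (_ : _ \o _ = fun x : 'rV[R]_n => \sum_i x 0 i * A i j); last first.
  by apply/funext => x; rewrite /rV_coord/= mxE.
apply: measurable_sum => i.
by apply: measurable_funM => //; exact: measurable_rV_coord.
Qed.

Lemma measurable_addmx n (b : 'rV[R]_n) :
  measurable_fun setT (fun x : 'rV[R]_n => x + b : 'rV[R]_n).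
Proof.
apply: measurable_fun_rVP => j.
rewrite (_ : _ \o _ = fun x : 'rV[R]_n => x 0 j + b 0 j); last first.
  by apply/funext => x; rewrite /rV_coord/= mxE.
by apply: (@measurable_funD _ _ R setT (fun x : 'rV[R]_n => x 0 j) (cst _)) => //;
  exact: measurable_rV_coord.
Qed.

Lemma lebesgue_rV_translation n (b : 'rV[R]_n) (S : set 'rV[R]_n) :
  measurable S -> vol ((fun x => x + b) @^-1` S) = vol S.
Proof.
move=> mS; have [q qE] := scaled_pushforward vol ler01 (measurable_addmx b).
rewrite -[RHS](@lebesgue_rV_unique _ _ q)//; first by rewrite qE mul1e.
move=> A mA.
rewrite qE mul1e.
rewrite (_ : _ @^-1` _ =
    box (fun j => (fun t => 1 * t + b 0 j) @^-1` A j)); last first.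
  by apply/seteqP; split=> x Ax j; move: (Ax j); rewrite /= mxE mul1r.
rewrite [LHS]lebesgue_rV_box => [|j].
  apply: eq_bigr => j _; rewrite -[RHS](@lebesgue_measure_affine _ 1 (b 0 j)) ?oner_neq0//.
  by rewrite normr1 mul1e.
rewrite -[X in measurable X]setTI.
exact: (measurable_affine 1 (b 0 j)).
Qed.

Lemma lebesgue_rV_perm n (s : {perm 'I_n}) (S : set 'rV[R]_n) :
  measurable S -> vol ((fun x => x *m perm_mx s) @^-1` S) = vol S.
Proof.
move=> mS; have [q qE] := scaled_pushforward vol ler01 (measurable_mulmx (perm_mx s)).
rewrite -[RHS](@lebesgue_rV_unique _ _ q)//; first by rewrite qE mul1e.
move=> A mA.
rewrite qE mul1e.
rewrite (_ : _ @^-1` _ = box (fun j => A (s j))); last first.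
  have xE (x : 'rV[R]_n) j : (x *m perm_mx s) 0 j = x 0 (s^-1%g j).
    by rewrite -{1}[s]invgK -col_permE mxE.
  apply/seteqP; split=> x Ax j.
    by have := Ax (s j); rewrite xE permK.
  by rewrite xE; have := Ax (s^-1%g j); rewrite permKV.
rewrite [LHS]lebesgue_rV_box//; apply/esym.
by rewrite (reindex_inj (@perm_inj _ s)).
Qed.

Lemma lebesgue_rVS n (S : set 'rV[R]_n.+1) :
  vol S = (\int[mu]_t vol [set y : 'rV[R]_n | S (rV_cons (t, y))])%E.
Proof.
rewrite /= /pushforward /product_measure1; apply: eq_integral => t _ /=.
congr lebesgue_rV; apply/seteqP; split=> y; rewrite /xsection/= inE//.
Qed.

Lemma measurable_rV_section n (S : set 'rV[R]_n.+1) (t : R) :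
  measurable S -> measurable [set y : 'rV[R]_n | S (rV_cons (t, y))].
Proof.
move=> mS; have mcons : measurable ((@rV_cons R n) @^-1` S).
  by rewrite -[X in measurable X]setTI; exact: measurable_rV_cons.
have := measurable_xsection t mcons.
by congr measurable; apply/seteqP; split=> y; rewrite /xsection/= inE.
Qed.

Lemma measurable_fun_rV_section n (S : set 'rV[R]_n.+1) : measurable S ->
  measurable_fun setT (fun t : measurableTypeR R =>
    vol [set y : 'rV[R]_n | S (rV_cons (t, y))]).
Proof.
move=> mS; have mcons : measurable ((@rV_cons R n) @^-1` S).
  by rewrite -[X in measurable X]setTI; exact: measurable_rV_cons.
have := measurable_fun_xsection (@lebesgue_rV R n) mcons.
congr measurable_fun; apply/funext => t /=; congr lebesgue_rV.
by apply/seteqP; split=> y; rewrite /xsection/= inE.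
Qed.

Lemma ge0_integral_affine (a b : R) (g : measurableTypeR R -> \bar R) : a != 0 ->
  measurable_fun setT g -> (forall t, 0 <= g t)%E ->
  (`|a|%:E * \int[mu]_t g (a * t + b)%R = \int[mu]_t g t)%E.
Proof.
move=> a0 mg g0.
pose p0 : {measure set (measurableTypeR R) -> \bar R} :=
  pushforward mu (fun t : measurableTypeR R => a * t + b : measurableTypeR R).
pose p := p0 (measurable_affine a b).
rewrite [RHS](eq_measure_integral (mscale (NngNum (normr_ge0 a)) p)); last first.
  by move=> A mA _; rewrite -[LHS](@lebesgue_measure_affine _ a b).
rewrite ge0_integral_mscale//; congr (_ * _)%E.
rewrite /p [RHS]ge0_integral_pushforward//= ?preimage_setT//.
exact: measurable_affine.
Qed.

(** Induction on the dimension: the first coordinate [t] becomes [a * t], and the others undergo the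
    smaller triangular map followed by a translation by [t *: u]. Slicing along [t] leaves a
    one-dimensional change of variable. *)
Lemma lebesgue_rV_upper n (U : 'M[R]_n) (S : set 'rV[R]_n) :
  (forall i j : 'I_n, (j < i)%N -> U i j = 0) -> (forall i, U i i != 0) ->
  measurable S ->
  ((\prod_i `|U i i|)%:E * vol ((fun x => x *m U) @^-1` S) = vol S)%E.
Proof.
elim: n U S => [|n IH] U S Uup U0 mS.
  rewrite big_ord0 mul1e; congr (vol _); apply/seteqP.
  by split=> x /=; rewrite (_ : x *m U = x)//; apply/rowP => -[].
pose U' := \matrix_(i, j) U (lift ord0 i) (lift ord0 j).
pose u : 'rV[R]_n := \row_j U ord0 (lift ord0 j).
pose a := U ord0 ord0.
have consU t y : rV_cons (t, y) *m U = rV_cons (a * t, y *m U' + t *: u).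
  apply/rowP => j; rewrite mxE big_ord_recl rV_cons0/=.
  case: (unliftP ord0 j) => [i ->|->].
    rewrite rV_consS/= !mxE addrC; congr +%R.
    by apply: eq_bigr => k _; rewrite rV_consS !mxE.
  rewrite rV_cons0/= big1 ?addr0 1?mulrC// => k _.
  by rewrite Uup ?mulr0.
have mpre : measurable ((fun x : 'rV[R]_n.+1 => x *m U) @^-1` S).
  by rewrite -[X in measurable X]setTI; exact: measurable_mulmx.
have mS' := measurable_rV_section _ mS.
rewrite !lebesgue_rVS big_ord_recl -/a EFinM -muleA.
rewrite -ge0_integralZl//; [|exact: measurable_fun_rV_section mpre|].
  2: by rewrite lee_fin prodr_ge0.
rewrite -[RHS](@ge0_integral_affine a 0) ?U0//; last exact: measurable_fun_rV_section.
under [in RHS]eq_integral do rewrite addr0.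
congr (_ * _)%E; apply: eq_integral => t _.
rewrite -[RHS](lebesgue_rV_translation (t *: u)); last exact: mS'.
rewrite -[RHS](IH U')//; last 3 first.
- by move=> i j ji; rewrite mxE Uup.
- by move=> i; rewrite mxE.
- rewrite -[X in measurable X]setTI.
  exact: (measurable_addmx (t *: u) measurableT (mS' (a * t))).
congr (_ * _)%E; first by congr EFin; apply: eq_bigr => i _; rewrite mxE.
by congr lebesgue_rV; apply/seteqP; split=> y /=; rewrite consU.
Qed.

(** The property is stable under products, so the LUP decomposition reduces it to permutation
    matrices and triangular matrices. *)
Lemma lebesgue_rV_linear n (A : 'M[R]_n) (S : set 'rV[R]_n) :
  A \in unitmx -> measurable S ->
  (`|\det A|%:E * vol ((fun x => x *m A) @^-1` S) = vol S)%E.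
Proof.
pose good (A : 'M[R]_n) := forall S, measurable S ->
  (`|\det A|%:E * vol ((fun x => x *m A) @^-1` S) = vol S)%E.
have mpre (C : 'M[R]_n) T : measurable T ->
    measurable ((fun x : 'rV[R]_n => x *m C) @^-1` T).
  by move=> mT; rewrite -[X in measurable X]setTI; exact: measurable_mulmx.
have goodM C D : good C -> good D -> good (C *m D).
  move=> gC gD T mT; rewrite det_mulmx normrM mulrC EFinM -muleA.
  rewrite -[RHS](gD _ mT) -[in RHS](gC _ (mpre D _ mT)).
  congr (_ * (_ * lebesgue_rV _))%E.
  by apply/seteqP; split=> x /=; rewrite mulmxA.
have goodP s : good (perm_mx s).
  move=> T mT; rewrite det_perm normrX normrN1 expr1n mul1e.
  exact: lebesgue_rV_perm.
have goodU (U : 'M[R]_n) : (forall i j : 'I_n, (j < i)%N -> U i j = 0) -> \det U != 0 -> good U.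
  move=> Uup; rewrite -det_tr det_trig => [|]; last first.
    by apply/is_trig_mxP => i j ij; rewrite mxE Uup.
  move=> /prodf_neq0 U0 T mT.
  rewrite -det_tr det_trig => [|]; last first.
    by apply/is_trig_mxP => i j ij; rewrite mxE Uup.
  rewrite normr_prod -(lebesgue_rV_upper Uup _ mT).
    by congr (_%:E * _)%E; apply: eq_bigr => i _; rewrite mxE.
  by move=> i; have := U0 i isT; rewrite mxE.
pose w : {perm 'I_n} := perm (@rev_ord_inj n).
have w2 : (w * w)%g = 1%g.
  by apply/permP => i; rewrite permM !permE rev_ordK.
have ww : perm_mx w *m perm_mx w = 1%:M :> 'M[R]_n.
  by rewrite -perm_mxM w2 perm_mx1.
(* Conjugation by the reversal permutation exchanges lower and upper
   triangular matrices. *)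
have goodL (L : 'M[R]_n) : (forall i j : 'I_n, (i < j)%N -> L i j = 0) -> \det L != 0 -> good L.
  move=> Llo L0.
  have -> : L = perm_mx w *m (perm_mx w *m L *m perm_mx w) *m perm_mx w.
    by rewrite !mulmxA ww mul1mx -mulmxA ww mulmx1.
  apply: (goodM _ _ _ (goodP w)); apply: (goodM _ _ (goodP w)).
  apply: goodU => [i j ji|].
    have wV : (w^-1 = w)%g.
      by rewrite -[LHS]mulg1 -w2 mulKg.
    rewrite -{2}wV -col_permE -row_permE !mxE Llo// !permE /=.
    by apply: ltn_sub2l => //; exact: leq_ltn_trans ji (ltn_ord i).
  rewrite !det_mulmx !det_perm !mulf_neq0// expf_neq0//; lra.
move=> uA; apply: (_ : good A).
(* [cormen_lup] takes matrices of size [n.+1]; in dimension 0 every matrix is upper triangular. *)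
case: n A uA good mpre goodM goodP goodU w w2 ww goodL S =>
  [|n] A uA good mpre goodM goodP goodU w w2 ww goodL _.
  by apply: goodU => [[]//|]; rewrite -unitfE -unitmxE.
have := cormen_lup_correct A; have := cormen_lup_perm A.
have := cormen_lup_detL A; have := @cormen_lup_lower _ _ A.
have := @cormen_lup_upper _ _ A.
case: cormen_lup => -[P L] U /= Uup Llo detL /is_perm_mxP[s Ps] PA.
have AE : A = perm_mx s^-1 *m (L *m U).
  by rewrite mulmxE -PA Ps -mulmxE mulmxA -perm_mxM mulVg perm_mx1 mul1mx.
rewrite AE; apply: (goodM _ _ (goodP _)); apply: goodM.
  apply: goodL => [i j ij|]; last by rewrite detL oner_neq0.
  by rewrite Llo 1?ltnW// -val_eqE ltn_eqF.
apply: goodU => //.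
move: uA; rewrite unitmxE AE !det_mulmx detL mul1r unitrM unitfE => /andP[_].
by rewrite unitfE.
Qed.

End lebesgue_rV_linear.

(** * Compact sets: measurability and finite volume *)

Section compact_rV.
Context {R : realType}.

(** The topology comes from the norm and the sigma-algebra from the coordinates; the countably many
    boxes with rational corners link the two. *)
Lemma open_measurable_rV n (U : set 'rV[R]_n) : open U -> measurable U.
Proof.
move=> oU.
pose B (p : 'rV[rat]_n * 'rV[rat]_n) : set 'rV[R]_n :=
  box (fun j => `]ratr (p.1 0 j), ratr (p.2 0 j)[%classic).
pose F p := if `[< B p `<=` U >] then B p else set0.
have -> : U = \bigcup_p F p.
  apply/seteqP; split=> x; last first.
    by move=> [p _]; rewrite /F; case: asboolP => // + Bx; exact.
  move=> Ux; move: (oU); rewrite openE => /(_ _ Ux) /nbhs_ballP[e /= e0 xeU].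
  have /choice[a aP] (j : 'I_n) : exists q : rat, x 0 j - e < ratr q < x 0 j.
    have [|q] := @rat_in_itvoo R (x 0 j - e) (x 0 j); first by rewrite ltrBlDr ltrDl.
    by rewrite in_itv/= => ?; exists q.
  have /choice[b bP] (j : 'I_n) : exists q : rat, x 0 j < ratr q < x 0 j + e.
    have [|q] := @rat_in_itvoo R (x 0 j) (x 0 j + e); first by rewrite ltrDl.
    by rewrite in_itv/= => ?; exists q.
  exists (\row_j a j, \row_j b j) => //; rewrite /F asboolT.
    move=> j; rewrite /= in_itv/= !mxE.
    by have /andP[_ ->] := aP j; have /andP[-> _] := bP j.
  move=> y yB; apply: xeU; split=> // i j; rewrite ord1.
  have := yB j; rewrite /= in_itv/= !mxE => /andP[ay yb].
  have /andP[a1 a2] := aP j; have /andP[b1 b2] := bP j.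
  rewrite /ball/= ltr_norml; apply/andP; split; lra.
apply: countable_bigcupT_measurable => // p; rewrite /F; case: ifP => // _.
by apply: measurable_box => j; exact: measurable_itv.
Qed.

Lemma compact_measurable_rV n (C : set 'rV[R]_n) : compact C -> measurable C.
Proof.
move=> cC; rewrite -[C]setCK; apply: measurableC; apply: open_measurable_rV.
by apply: closed_openC; apply: compact_closed => //; exact: norm_hausdorff.
Qed.

Lemma compact_lebesgue_rV_lty n (C : set 'rV[R]_n) : compact C ->
  (lebesgue_rV C < +oo)%E.
Proof.
move=> cC; have [M [Mreal CM]] := compact_bounded cC.
have {}CM : C `<=` box (fun=> `[- (`|M| + 1), `|M| + 1]%classic).
  move=> x /(CM (`|M| + 1)) xM j; rewrite /= in_itv/= -ler_norml.
  apply: le_trans (xM _); last by rewrite (le_lt_trans (ler_norm _))// ltrDl.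
  by rewrite [leRHS]/Num.norm/= mx_normrE; apply/bigmax_geP; right => /=; exists (0, j).
apply: (@le_lt_trans _ _ (lebesgue_rV (box (fun=> `[- (`|M| + 1), `|M| + 1]%classic)))).
  apply: le_measure => //; rewrite inE; first exact: compact_measurable_rV.
  by apply: measurable_box => j; exact: measurable_itv.
rewrite [ltLHS]lebesgue_rV_box => [|j]; last exact: measurable_itv.
have [->|] := eqVneq n 0%N; first by rewrite big_ord0 ltry.
rewrite (eq_bigr (fun=> ((`|M| + 1) *+ 2)%:E)) => [_|j _].
  by rewrite prodEFin ltry.
rewrite lebesgue_measure_itv/= lte_fin ifT; first by rewrite -EFinB opprK mulr2n.
by have := normr_ge0 M; lra.
Qed.

(** Tychonoff, then a continuous image. It serves both for zonotopes, where the [A i] are segments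
    of coefficients, and for Minkowski combinations, where they are the bodies. *)
Lemma compact_sum_image (I : finType) (T : topologicalType) n (A : I -> set T)
    (f : I -> T -> 'rV[R]_n) :
  (forall i, compact (A i)) -> (forall i, continuous (f i)) ->
  compact [set x | exists2 y : I -> T,
    (forall i, A i (y i)) & x = \sum_i f i (y i)].
Proof.
move=> cA cf.
have cP := @tychonoff I (fun=> T) A cA.
rewrite (_ : mkset _ =
    (fun y : prod_topology (fun _ : I => T) => \sum_i f i (y i)) @`
      [set y : prod_topology (fun _ : I => T) | forall i, A i (y i)]); last first.
  apply/seteqP; split=> x [y Ay]; first by move=> ->; exists y.
  by move=> <-; exists y.
apply: continuous_compact cP; apply: continuous_subspaceT.
apply: continuous_big => [|i _]; first exact: add_continuous.
move=> y.
apply: (@continuous_comp (prod_topology (fun _ : I => T)) T _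
  (@proj I (fun=> T) i) (f i)); first exact: proj_continuous.
exact: cf.
Qed.

End compact_rV.

(** * Volume of zonotopes *)

Section multiaffine.
Context {R : realType} {J : finType}.
Implicit Types (f : (J -> nat) -> R) (c : J -> nat).

Definition upd (T : Type) (c : J -> T) (j : J) (a : T) : J -> T :=
  fun i => if i == j then a else c i.

(** Affine in each variable separately, written without subtraction for natural variables.
    Inclusion-exclusion for a lengthened edge of a zonotope produces exactly this identity. *)
Definition multiaffine f := forall c j a b,
  f (upd c j (a + b)%N) + f (upd c j 0%N) = f (upd c j a) + f (upd c j b).

Lemma upd_id (T : Type) (c : J -> T) j : upd c j (c j) = c.
Proof. by apply/funext => i; rewrite /upd; case: eqP => [->|]. Qed.

Lemma upd_upd (T : Type) (c : J -> T) j a b : upd (upd c j a) j b = upd c j b.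
Proof. by apply/funext => i; rewrite /upd; case: eqP. Qed.

Lemma updC (T : Type) (c : J -> T) i j a b : i != j ->
  upd (upd c i a) j b = upd (upd c j b) i a.
Proof.
move=> ij; apply/funext => l; rewrite /upd.
by case: (eqVneq l j) => [->|//]; rewrite eq_sym (negbTE ij).
Qed.

Lemma multiaffine_slope f c j a : multiaffine f ->
  f (upd c j a) = f (upd c j 0%N) + a%:R * (f (upd c j 1%N) - f (upd c j 0%N)).
Proof.
move=> mf; elim: a => [|a IH]; first by rewrite mul0r addr0.
have := mf c j a 1%N; rewrite addn1 IH -natr1 => /(canRL (addrK _)) ->; ring.
Qed.

Lemma multiaffine_upd f j a : multiaffine f -> multiaffine (fun c => f (upd c j a)).
Proof.
move=> mf c i x y; have [->|ij] := eqVneq i j; first by rewrite !upd_upd.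
by rewrite !(updC _ _ _ ij).
Qed.

(** Induction on the variables allowed to be nonzero: subsets containing the new variable [a]
    receive the coefficients of the slope in [a], the others those of [f] restricted to the value 0
    of that variable. *)
Lemma multiaffine_expansion f : multiaffine f ->
  exists q : {set J} -> R,
    forall c, f c = \sum_(I : {set J}) (\prod_(i in I) (c i)%:R) * q I.
Proof.
move=> mf.
suff H (s : seq J) : uniq s -> forall f, multiaffine f ->
    exists q : {set J} -> R, forall c, (forall i, i \notin s -> c i = 0%N) ->
    f c = \sum_(I : {set J}) (\prod_(i in I) (c i)%:R) * q I.
  have [q qE] := H (enum J) (enum_uniq _) f mf; exists q => c; apply: qE => i.
  by rewrite mem_enum.
elim: s {f mf} => [_ f mf|a s IH /= /andP[as_ us] f mf].
  exists (fun I => if I == finset.set0 then f (fun=> 0%N) else 0) => c c0.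
  have -> : c = fun=> 0%N by apply/funext => i; exact: c0.
  rewrite (bigD1 finset.set0)//= eqxx big_set0 mul1r big1 ?addr0// => I /negbTE ->.
  by rewrite mulr0.
have [q0 q0E] := IH us _ (multiaffine_upd a 0 mf).
have mg : multiaffine (fun c => f (upd c a 1%N) - f (upd c a 0%N)).
  move=> c j x y.
  have := multiaffine_upd a 1%N mf c j x y; have := multiaffine_upd a 0%N mf c j x y.
  lra.
have [q1 q1E] := IH us _ mg.
exists (fun I : {set J} => if a \in I then q1 (I :\ a) else q0 I) => c c0.
rewrite -{1}(upd_id c a) multiaffine_slope//.
have supp i : i \notin s -> upd c a 0%N i = 0%N.
  move=> iNs; rewrite /upd; case: eqVneq => // ia; apply: c0.
  by rewrite in_cons negb_or ia.
have := q0E _ supp; have := q1E _ supp; rewrite /= !upd_upd => -> ->.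
have vanish (q : {set J} -> R) :
    \sum_(I : {set J}) (\prod_(i in I) (upd c a 0%N i)%:R) * q I =
    \sum_(I : {set J} | a \notin I) (\prod_(i in I) (c i)%:R) * q I.
  rewrite (bigID (fun I : {set J} => a \in I))/= big1 ?add0r => [|I aI].
    apply: eq_bigr => I aI; congr (_ * _); apply: eq_bigr => i iI.
    by rewrite /upd; case: eqVneq => // ia; rewrite -ia iI in aI.
  by rewrite (bigD1 a)//= /upd eqxx !mul0r.
rewrite !vanish [RHS](bigID (fun I : {set J} => a \in I))/= addrC; congr (_ + _).
  by apply: eq_bigr => I /negbTE ->.
rewrite mulr_sumr.
  rewrite [RHS](reindex_onto (fun I : {set J} => a |: I) (fun I : {set J} => I :\ a))/=; last first.
    by move=> I aI; rewrite finset.setD1K.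
  apply: eq_big => [I|I aI].
    rewrite finset.setU11/=; apply/idP/eqP => [aI|<-]; first by rewrite finset.setU1K.
    by rewrite !inE eqxx.
  by rewrite finset.setU11 finset.setU1K// big_setU1//= mulrA.
Qed.

Lemma poly_natr_eq0 (p : {poly R}) : (forall n, p.[n.+1%:R] = 0) -> p = 0.
Proof.
move=> p0; pose rs := [seq n.+1%:R : R | n <- iota 0 (size p)].
apply: (@roots_geq_poly_eq0 _ p rs).
- by apply/allP => _ /mapP[n _ ->]; rewrite /root p0.
- by rewrite map_inj_uniq ?iota_uniq// => m n /eqP; rewrite eqr_nat eqSS => /eqP.
- by rewrite size_map size_iota.
Qed.

(* Comparing the coefficients of [n ^ d] in [f (n c) = n ^ d f c] leaves only
   the subsets of size [d] in the expansion of [f]. *)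
Lemma multiaffine_homogeneous f d : multiaffine f ->
  (forall n c, f (fun i => n.+1 * c i)%N = n.+1%:R ^+ d * f c) ->
  f (fun=> 1%N) = \sum_(I : {set J} | #|I| == d) f (fun i => (i \in I) : nat).
Proof.
move=> mf hf; have [q qE] := multiaffine_expansion mf.
have fE c : f c = \sum_(I : {set J} | #|I| == d) (\prod_(i in I) (c i)%:R) * q I.
  pose p : {poly R} := \sum_(I : {set J}) ((\prod_(i in I) (c i)%:R) * q I) *: 'X^#|I|
     - f c *: 'X^d.
  have /(congr1 (fun r : {poly R} => r`_d)) : p = 0.
    apply: poly_natr_eq0 => n; rewrite /p !hornerE horner_sum.
    rewrite mulrC -hf qE; apply/eqP; rewrite subr_eq0; apply/eqP.
    apply: eq_bigr => I _; rewrite !hornerE.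
    have -> : \prod_(i in I) (n.+1 * c i)%:R =
        n.+1%:R ^+ #|I| * \prod_(i in I) (c i)%:R :> R.
      by rewrite -prodr_const -big_split/=; apply: eq_bigr => i _; rewrite natrM.
    ring.
  rewrite coef0 coefB coefZ coefXn eqxx mulr1 => /eqP; rewrite subr_eq0 => /eqP <-.
  rewrite coef_sum [RHS]big_mkcond/=; apply: eq_bigr => I _.
  by rewrite coefZ coefXn eq_sym; case: eqP; rewrite ?mulr1 ?mulr0.
(* The coefficient [q I] is the value of [f] at the indicator of [I]: any other subset of the same
   cardinal has an element outside [I], whose factor vanishes. *)
rewrite fE; apply: eq_bigr => I /eqP Id.
rewrite big1 ?mul1r// fE (bigD1 I) ?Id//= big1 => [|i ->//].
rewrite mul1r big1 ?addr0// => K /andP[/eqP Kd KI].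
suff [i iK iI] : exists2 i, i \in K & i \notin I.
  by rewrite (bigD1 i)//= (negbTE iI) !mul0r.
apply/exists_inP; rewrite -negb_forall_in; apply: contra KI => /forall_inP KI.
by rewrite eqEcard Kd Id leqnn andbT; apply/fintype.subsetP.
Qed.

End multiaffine.

Section zonotope.
Context {R : realType}.
Notation vol := (@lebesgue_rV R _).

Lemma measure_setUI d (T : measurableType d) (m : {measure set T -> \bar R})
    (A B : set T) : measurable A -> measurable B ->
  (m (A `|` B) + m (A `&` B) = m A + m B)%E.
Proof.
move=> mA mB; have -> : A `|` B = A `|` (B `\` A).
  apply/seteqP; split=> x [Ax|]; [by left| |by left|by case; right].
  by have [Ax|nAx] := pselect (A x); [left|right].
rewrite measureU//; last 2 first.
- exact: measurableD.
- by apply/seteqP; split=> // x [Ax []].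
by rewrite -addeA; congr (_ + _)%E; rewrite [RHS](measureDI m mB mA) classical_sets.setIC.
Qed.

Lemma lebesgue_rV_scale n (a : R) (S : set 'rV[R]_n) : 0 < a -> measurable S ->
  vol [set x | S (a^-1 *: x)] = ((a ^+ n)%:E * vol S)%E.
Proof.
move=> a0 mS; have uA : (a^-1)%:M \in (@unitmx R n).
  by rewrite unitmxE det_scalar unitfE expf_neq0// invr_neq0// gt_eqF.
rewrite -(lebesgue_rV_linear uA mS) det_scalar muleA -EFinM.
rewrite exprVn ger0_norm ?invr_ge0 ?exprn_ge0 ?ltW//.
rewrite mulfV ?mul1e ?expf_neq0 ?gt_eqF//; congr lebesgue_rV.
by apply/seteqP; split=> x /=; rewrite mul_mx_scalar.
Qed.

Definition zono (J : finType) n (c : J -> R) (w : J -> 'rV[R]_n) : set 'rV[R]_n :=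
  [set x | exists2 t : J -> R,
     (forall j, 0 <= t j <= c j) & x = \sum_j t j *: w j].

Lemma compact_zono (J : finType) n (c : J -> R) (w : J -> 'rV[R]_n) :
  compact (zono c w).
Proof.
rewrite (_ : zono c w = [set x | exists2 t : J -> R,
    (forall j, `[0, c j]%classic (t j)) & x = \sum_j t j *: w j]).
  apply: (@compact_sum_image R J R n (fun j => `[0, c j]%classic)
    (fun j t => t *: w j)) => j.
    exact: segment_compact.
  exact: scalel_continuous.
by apply/seteqP; split=> x [t tc ->]; exists t => // j; have := tc j; rewrite /= in_itv.
Qed.

Lemma measurable_zono (J : finType) n (c : J -> R) (w : J -> 'rV[R]_n) :
  measurable (zono c w).
Proof. by apply: compact_measurable_rV; exact: compact_zono. Qed.

Lemma zono_updP (J : finType) n (c : J -> R) (w : J -> 'rV[R]_n) j (a : R) x :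
  zono (upd c j a) w x <->
  exists2 r, 0 <= r <= a & zono (upd c j 0) w (x - r *: w j).
Proof.
split=> [[t tc ->]|[r ra [t tc xE]]].
  exists (t j); first by have := tc j; rewrite /upd eqxx.
  exists (upd t j 0) => [i|].
    by have := tc i; rewrite /upd; case: eqP => // _ _; rewrite lexx.
  rewrite (bigD1 j)//= addrAC subrr add0r [RHS](bigD1 j)//= /upd eqxx scale0r add0r.
  by apply: eq_bigr => i /negbTE ->.
exists (upd t j r) => [i|].
  by have := tc i; rewrite /upd; case: eqP.
rewrite -[x](subrK (r *: w j)) {}xE [RHS](bigD1 j)//= (bigD1 j)//=.
rewrite (_ : upd t j r j = r); last by rewrite /upd eqxx.
have -> : t j = 0.
  by have := tc j; rewrite /upd eqxx andbC -eq_le => /eqP.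
rewrite scale0r add0r addrC; congr (_ + _).
by apply: eq_bigr => i /negbTE ij; rewrite /upd ij.
Qed.

Lemma zono_convex (J : finType) n (c : J -> R) (w : J -> 'rV[R]_n) x y (l : R) :
  0 <= l <= 1 -> zono c w x -> zono c w y -> zono c w (l *: x + (1 - l) *: y).
Proof.
move=> /andP[l0 l1] [t tc ->] [s sc ->]; exists (fun j => l * t j + (1 - l) * s j).
  move=> j; have /andP[t0 t1] := tc j; have /andP[s0 s1] := sc j.
  have l1' : 0 <= 1 - l by lra.
  rewrite addr_ge0 ?mulr_ge0//=.
  by apply: le_trans (lerD (ler_wpM2l l0 t1) (ler_wpM2l l1' s1)) _; lra.
rewrite !scaler_sumr -big_split/=; apply: eq_bigr => j _.
by rewrite !scalerA -scalerDl.
Qed.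

(* Lengthening the [j]-th edge from [a] to [a + b] adds a translate of the zonotope
   with edge [b], which meets the original one in a translate of that with edge [0]. *)
Lemma vol_zono_upd (J : finType) n (c : J -> R) (w : J -> 'rV[R]_n) j (a b : R) :
  0 <= a -> 0 <= b ->
  (vol (zono (upd c j (a + b)%R) w) + vol (zono (upd c j 0%R) w) =
   vol (zono (upd c j a) w) + vol (zono (upd c j b) w))%E.
Proof.
move=> a0 b0; pose K r := zono (upd c j r) w.
have mK r : measurable (K r) by exact: measurable_zono.
have KP r x : K r x <-> exists2 s, 0 <= s <= r & K 0 (x - s *: w j).
  exact: zono_updP.
pose tr := (fun x : 'rV[R]_n => x + - (a *: w j)).
have trE r : vol (tr @^-1` K r) = vol (K r) by rewrite lebesgue_rV_translation.
have mtr r : measurable (tr @^-1` K r).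
  by rewrite -[X in measurable X]setTI; exact: (measurable_addmx _ measurableT).
rewrite -/(K _) -/(K 0) -/(K a) -/(K b) -(trE 0) -(trE b).
rewrite -[RHS]measure_setUI//.
suff [-> ->] : K (a + b) = K a `|` tr @^-1` K b /\
    tr @^-1` K 0 = K a `&` tr @^-1` K b by [].
split; apply/seteqP; split=> x.
- move=> /KP[s sab Kx]; have [sa|sa] := leP s a.
    by left; apply/KP; exists s => //; have /andP[-> _] := sab.
  right; apply/KP; exists (s - a); first by apply/andP; split; lra.
  suff -> : tr x - (s - a) *: w j = x - s *: w j by [].
  by apply/rowP => i; rewrite /tr !mxE; ring.
- case=> /KP[s sa Kx]; apply/KP.
    by exists s => //; apply/andP; split; lra.
  exists (a + s); first by apply/andP; split; lra.
  suff -> : x - (a + s) *: w j = tr x - s *: w j by [].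
  by apply/rowP => i; rewrite /tr !mxE; ring.
- move=> Kx; split.
    by apply/KP; exists a => //; rewrite a0 lexx.
  by apply/KP; exists 0; rewrite ?scale0r ?subr0 ?lexx.
- case=> /KP[s /andP[s0 sa] Ks] /KP[r /andP[r0 rb] Kr].
  have [sr|sr] := eqVneq (a - s + r) 0.
    have rE : r = 0 by lra.
    by move: Kr; rewrite rE scale0r subr0.
  have sr0 : 0 < a - s + r by rewrite lt_def sr/=; lra.
  rewrite /=.
  (* Relative to [tr x], the two points of [K 0] lie at [a - s] and at [- r] along [w j]; the weight
     [r / (a - s + r)] balances them. *)
  have -> : tr x = (r / (a - s + r)) *: (x - s *: w j) +
      (1 - r / (a - s + r)) *: (tr x - r *: w j).
    apply/rowP => i; rewrite /tr !mxE; field; lra.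
  apply: zono_convex => //; apply/andP; split; first by apply: divr_ge0; lra.
  by rewrite ler_pdivrMr//; lra.
Qed.

(** An invertible matrix makes it a linear image of the unit cube; for a singular one it lies in a
    hyperplane, which has to be shown null. *)
Lemma vol_parallelepiped n (v : 'I_n -> 'rV[R]_n) :
  vol (zono (fun=> 1) v) = `|\det (\matrix_i v i)|%:E.
Proof.
set V := \matrix_i v i.
have zV : zono (fun=> 1) v = [set x *m V | x in box (fun=> `[0, 1]%classic)].
  apply/seteqP; split=> [x [t t01 ->]|_ [x xb <-]].
    exists (\row_j t j) => [j|]; first by rewrite mxE /= in_itv/=.
    by rewrite mulmx_sum_row; apply: eq_bigr => i _; rewrite mxE rowK.
  exists (x 0) => [j|]; first by have := xb j; rewrite /= in_itv.
  by rewrite mulmx_sum_row; apply: eq_bigr => i _; rewrite rowK.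
have mb : measurable (box (fun=> `[0, 1]%classic) : set 'rV[R]_n).
  by apply: measurable_box => j; exact: measurable_itv.
have volb : vol (box (fun=> `[0, 1]%classic) : set 'rV[R]_n) = 1%E.
  rewrite [LHS]lebesgue_rV_box => [|j]; last exact: measurable_itv.
  by rewrite big1// => i _; rewrite lebesgue_measure_itv/= lte_fin ltr01 oppr0 adde0.
have [/eqP/det0P[u u0 uV]|V0] := eqVneq (\det V^T) 0; last first.
  have uV : V \in unitmx by rewrite unitmxE unitfE -det_tr.
  rewrite zV (_ : [set _ | _ in _] = (fun x => x *m invmx V) @^-1`
    (box (fun=> `[0, 1]%classic))); last first.
    apply/seteqP; split=> [_ [x xb <-]|x xb]; first by rewrite /= mulmxK.
    by exists (x *m invmx V) => //; rewrite mulmxKV.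
  have uV' : invmx V \in unitmx by rewrite unitmx_inv.
  have := lebesgue_rV_linear uV' mb; rewrite volb => vE.
  rewrite -[RHS]mule1 -vE muleA -EFinM det_inv normfV mulfV ?mul1e//.
  by rewrite normr_eq0 -det_tr.
have [j uj] : exists j, u 0 j != 0 by exact/rV0Pn.
(* [A] maps the parallelepiped into the hyperplane of vanishing [j]-th
   coordinate. *)
pose A : 'M[R]_n := \matrix_(i, l) if l == j then u 0 i else (i == l)%:R.
have xA (x : 'rV[R]_n) l : (x *m A) 0 l = if l == j then (x *m u^T) 0 0 else x 0 l.
  rewrite !mxE; case: eqP => [->|lj].
    by apply: eq_bigr => i _; rewrite !mxE eqxx.
  rewrite (bigD1 l)//= mxE (introF eqP lj) eqxx mulr1 big1 ?addr0// => i il.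
  by rewrite mxE (introF eqP lj) (negbTE il) mulr0.
have uA : A \in unitmx.
  rewrite unitmxE unitfE; apply/det0P => -[x /rV0Pn[l xl] xA0].
  have x0 i : i != j -> x 0 i = 0.
    by move=> ij; have := xA x i; rewrite xA0 (negbTE ij) mxE.
  have := xA x j; rewrite xA0 eqxx !mxE (bigD1 j)//= big1 ?addr0; last first.
    by move=> i ij; rewrite x0// mul0r.
  rewrite mxE => /esym/eqP; rewrite mulf_eq0 (negbTE uj) orbF => /eqP xj.
  by have [lj|lj] := eqVneq l j; [move: xl; rewrite lj xj eqxx|
    move: xl; rewrite x0// eqxx].
pose H : set 'rV[R]_n := box (fun l => if l == j then [set 0] else setT).
have mH : measurable H by apply: measurable_box => l; case: ifP.
have H0 : vol H = 0%E.
  rewrite [LHS]lebesgue_rV_box => [|l]; last by case: ifP.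
  by rewrite (bigD1 j)//= eqxx lebesgue_measure_set1 mul0e.
have vH : vol ((fun x => x *m A) @^-1` H) = 0%E.
  have := lebesgue_rV_linear uA mH; rewrite H0 => /eqP.
  rewrite mule_eq0 eqe normr_eq0 => /orP[|/eqP//].
  by move: uA; rewrite unitmxE unitfE => /negbTE ->.
rewrite (_ : `|_| = 0); last first.
  apply/eqP; rewrite normr_eq0 -det_tr; apply/det0P; by exists u.
apply/eqP; rewrite eq_le measure_ge0 andbT.
apply: (@le_trans _ _ (vol ((fun x => x *m A) @^-1` H))); last by rewrite vH.
apply: le_measure; rewrite ?inE.
- exact: measurable_zono.
- by rewrite -[X in measurable X]setTI; exact: measurable_mulmx.
rewrite zV => _ [x _ <-] l; rewrite xA; case: eqP => // _ /=.
by rewrite -mulmxA -[V]trmxK -trmx_mul uV trmx0 mulmx0 mxE.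
Qed.

(** The volume is multiaffine and homogeneous of degree [n] in the edge lengths, so it is the sum of
    the volumes of the parallelepipeds on [n] of the generators. Each such choice is enumerated by
    [n]! injective maps [g], and a map that is not injective has determinant 0. *)
Theorem vol_zonotope (J : finType) n (w : J -> 'rV[R]_n) :
  vol (zono (fun=> 1) w) =
  ((n`!%:R)^-1 * \sum_(g : {ffun 'I_n -> J}) `|\det (\matrix_i w (g i))|)%:E.
Proof.
have fin (c : J -> R) : (vol (zono c w)) \is a fin_num.
  by rewrite ge0_fin_numE ?measure_ge0//; apply: compact_lebesgue_rV_lty; exact: compact_zono.
pose f (c : J -> nat) := fine (vol (zono (fun j => (c j)%:R) w)).
have mf : multiaffine f.
  move=> c j a b; apply: EFin_inj; rewrite !EFinD !fineK//.
  have updE x : (fun i => (upd c j x i)%:R) = upd (fun i => (c i)%:R : R) j x%:R.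
    by apply/funext => i; rewrite /upd; case: eqP.
  by rewrite !updE natrD vol_zono_upd.
have hf m c : f (fun i => m.+1 * c i)%N = m.+1%:R ^+ n * f c.
  apply: EFin_inj; rewrite EFinM !fineK// -lebesgue_rV_scale//; last exact: measurable_zono.
  congr lebesgue_rV; apply/seteqP; split=> x [t tc].
    move=> ->; exists (fun j => m.+1%:R^-1 * t j) => [j|].
      have /andP[t0 t1] := tc j; rewrite mulr_ge0//= mulrC ler_pdivrMr//.
      by rewrite mulrC -natrM.
    by rewrite scaler_sumr; apply: eq_bigr => j _; rewrite scalerA.
  move/(canRL (scalerK _)) => ->; last by rewrite invr_eq0.
  exists (fun j => m.+1%:R * t j) => [j|].
    have /andP[t0 t1] := tc j; rewrite mulr_ge0//= natrM ler_pM2l//.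
  by rewrite invrK scaler_sumr; apply: eq_bigr => j _; rewrite scalerA.
rewrite -[LHS]fineK//; congr EFin.
rewrite -/(f (fun=> 1%N)) (multiaffine_homogeneous mf hf).
have fact0 : n`!%:R != 0 :> R by rewrite pnatr_eq0 -lt0n fact_gt0.
apply: (mulfI fact0); rewrite mulVKf//.
rewrite [RHS](bigID (fun g : {ffun 'I_n -> J} => injectiveb g))/=.
rewrite [X in _ = _ + X]big1 ?addr0; last first.
  move=> g /injectivePn[i [j ij gij]]; apply/eqP; rewrite normr_eq0.
  by apply/eqP; apply: (determinant_alternate ij) => l; rewrite !mxE gij.
rewrite (partition_big (fun g : {ffun 'I_n -> J} => [set g i | i in 'I_n]%SET)
   (fun I : {set J} => #|I| == n))/=; last first.
  by move=> g /injectiveP gi; rewrite card_imset// card_ord.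
rewrite mulr_sumr; apply: eq_bigr => I /eqP In.
rewrite (eq_bigr (fun=> f (fun i => (i \in I) : nat))) => [|g /andP[/injectiveP gi /eqP gI]].
  rewrite sumr_const mulr_natl; congr (_ *+ _).
  have := card_inj_ffuns_on 'I_n (mem I).
  rewrite card_ord In ffactnn => <-; apply: eq_card => g; rewrite !inE.
  rewrite [RHS]andbC; apply/andP/andP => -[gi gI]; split => //.
    rewrite eqEcard card_imset ?card_ord ?In ?leqnn ?andbT; last exact/injectiveP.
    apply/fintype.subsetP => _ /imsetP[i _ ->]; exact: (forallP gi).
  by apply/forallP => i; rewrite -(eqP gi); exact: imset_f.
apply: EFin_inj; rewrite fineK// -vol_parallelepiped; congr lebesgue_rV.
apply/seteqP; split=> [x [t tc ->]|x [t tc ->]].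
  exists (fun j => if [pick i | g i == j] is Some i then t i else 0) => [j|].
    case: pickP => [i /eqP <-|]; first by rewrite -gI imset_f.
    by rewrite lexx ler0n.
  rewrite [RHS](bigID (fun j => j \in I))/= [X in _ = _ + X]big1 ?addr0 => [|j jI].
    rewrite -gI big_imset => [|i j _ _ /gi//]; apply: eq_bigr => i _.
    case: pickP => [k /eqP/gi ->//|/(_ i)]; by rewrite eqxx.
  case: pickP => [i /eqP ij|]; last by rewrite scale0r.
  by move: jI; rewrite -gI -ij imset_f.
exists (fun i => t (g i)) => [i|].
  by have := tc (g i); rewrite -gI imset_f.
rewrite (bigID (fun j => j \in I))/= [X in _ + X = _]big1 ?addr0 => [|j jI].
  by rewrite -gI big_imset => [|i j _ _ /gi].
by have := tc j; rewrite (negbTE jI) -eq_le => /eqP <-; rewrite scale0r.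
Qed.

End zonotope.

(** * Mixed volumes by polarization *)

Section polarization.
Context {R : realType} {n : nat}.
Implicit Types (V : {ffun 'I_n -> 'I_n} -> R) (f g h : {ffun 'I_n -> 'I_n}).

Definition polar V (lam : 'I_n -> R) : R :=
  \sum_(f : {ffun 'I_n -> 'I_n}) (\prod_i lam (f i)) * V f.

(** A multiplicity: the body [K i] is taken once for every [l] in [S] with [g l = i]. Repetitions in
    [g] are thus allowed, and every coefficient can be recovered. *)
Definition sub_fiber g (S : {set 'I_n}) (i : 'I_n) : R :=
  \sum_(l in S) (g l == i)%:R.

Lemma sub_fiber_ge0 g S i : 0 <= sub_fiber g S i.
Proof. by apply: sumr_ge0. Qed.

(** Expanding the powers of the sums over [S] gives terms indexed by maps [h] into [S]. The
    alternating sum over [S] keeps the surjective ones, which are the permutations, and symmetry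
    makes these [n]! terms equal. *)
Lemma polarization V g :
  (forall (s : {perm 'I_n}) f, V [ffun i => f (s i)] = V f) ->
  \sum_(S : {set 'I_n}) (-1) ^+ #|~: S| * polar V (sub_fiber g S) = n`!%:R * V g.
Proof.
move=> symV.
have polarE S : polar V (sub_fiber g S) =
    \sum_(h : {ffun 'I_n -> 'I_n}) (\prod_i (h i \in S)%:R) * V [ffun i => g (h i)].
  transitivity (\sum_(f : {ffun 'I_n -> 'I_n}) \sum_(h : {ffun 'I_n -> 'I_n})
      (\prod_i ((h i \in S)%:R * (g (h i) == f i)%:R)) * V f).
    apply: eq_bigr => f _; rewrite -mulr_suml; congr (_ * _).
    rewrite -(bigA_distr_bigA (fun i l => (l \in S)%:R * (g l == f i)%:R : R))/=.
    apply: eq_bigr => i _; rewrite /sub_fiber big_mkcond; apply: eq_bigr => l _.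
    by case: ifP; rewrite ?mul1r ?mul0r.
  rewrite exchange_big; apply: eq_bigr => h _ /=.
  rewrite (bigD1 [ffun i => g (h i)])//= [X in _ + X = _]big1 ?addr0 => [|f fgh].
    congr (_ * _); apply: eq_bigr => i _.
    by rewrite ffunE eqxx mulr1.
  have [i /negbTE fi] : exists i, g (h i) != f i.
    apply/existsP; apply: contraR fgh => /existsPn gf.
    by apply/eqP/ffunP => i; rewrite ffunE; have := gf i; rewrite negbK => /eqP.
  by rewrite (bigD1 i)//= fi mulr0 !mul0r.
transitivity (\sum_(h : {ffun 'I_n -> 'I_n})
    (\sum_(S : {set 'I_n}) (-1) ^+ #|~: S| * \prod_i (h i \in S)%:R) *
    V [ffun i => g (h i)]).
  under [RHS]eq_bigr do rewrite mulr_suml.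
  rewrite exchange_big; apply: eq_bigr => S _ /=.
  by rewrite polarE mulr_sumr; apply: eq_bigr => h _; rewrite mulrA.
(* The sum is the expansion of [\prod_l (1 - (l \notin codom h))]. *)
have signE h : \sum_(S : {set 'I_n}) (-1) ^+ #|~: S| * \prod_i (h i \in S)%:R =
    (injectiveb h)%:R :> R.
  pose F (l : 'I_n) : R := 1.
  pose G (l : 'I_n) : R := if l \in codom h then 0 else -1.
  transitivity (\prod_l (F l + G l)).
    rewrite bigA_distr; apply: eq_bigr => S _.
    rewrite [RHS](bigID (fun l => l \in S))/= [X in _ = X * _]big1 ?mul1r => [|l ->//].
    have [/fintype.subsetP hS|/fintype.subsetPn[l lh lS]] := boolP (codom h \subset S).
      rewrite [X in _ * X]big1 ?mulr1 => [|i _]; last by rewrite hS ?codom_f.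
      rewrite [RHS](eq_bigr (fun=> -1)) => [|l lS]; last first.
        by rewrite (negbTE lS) /G ifN//; apply: contra lS; exact: hS.
      by rewrite prodr_const; congr (_ ^+ _); apply: eq_card => l; rewrite !inE.
    rewrite [X in _ = X](bigD1 l)//= (negbTE lS) /G lh mul0r.
    have /codomP[i li] := lh.
    by rewrite [X in _ * X](bigD1 i)//= -li (negbTE lS) mul0r mulr0.
  have [hi|/injectivePn hn] := boolP (injectiveb h).
    rewrite big1// => l _; rewrite /F /G ifT ?addr0//.
    have hi' := injectiveP _ hi.
    by rewrite codomE -(f_invF hi' l) map_f// mem_enum.
  have [l lh] : exists l, l \notin codom h.
    apply/existsP; rewrite -negb_forall; apply/negP => /forallP hs.
    have [i [j ij hij]] := hn.
    have : (#|codom h| < #|'I_n|)%N.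
      rewrite ltn_neqAle leq_image_card andbT; apply/negP => /image_injP hinj.
      by move/eqP: ij; apply; apply: hinj.
    rewrite ltnNge => /negP; apply; apply: subset_leq_card.
    by apply/fintype.subsetP => l _.
  by rewrite (bigD1 l)//= /F /G (negbTE lh) subrr mul0r.
under eq_bigr do rewrite signE.
rewrite (bigID (fun h : {ffun 'I_n -> 'I_n} => injectiveb h))/= addrC.
rewrite big1 ?add0r => [|h /negbTE ->]; last by rewrite mul0r.
rewrite (reindex (@pval _)) /=; last first.
  pose in_Sn := insubd (1%g : 'S_n).
  by exists in_Sn => /= f Uf; first apply: val_inj; apply: insubdK.
rewrite (eq_bigl xpredT) => [|s]; last by rewrite (valP s).
rewrite (eq_bigr (fun=> V g)) => [|s _].
  by rewrite sumr_const mulr_natl -card_Sn.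
rewrite (valP s) mul1r -[RHS](symV s); congr V; apply/ffunP => i.
by rewrite !ffunE pvalE.
Qed.

Lemma polar_inj V V' :
  (forall (s : {perm 'I_n}) f, V [ffun i => f (s i)] = V f) ->
  (forall (s : {perm 'I_n}) f, V' [ffun i => f (s i)] = V' f) ->
  (forall lam, (forall i, 0 <= lam i) -> polar V lam = polar V' lam) ->
  V =1 V'.
Proof.
move=> sV sV' VV' g; have fact0 : n`!%:R != 0 :> R.
  by rewrite pnatr_eq0 -lt0n fact_gt0.
apply: (mulfI fact0); rewrite -!polarization//.
by apply: eq_bigr => S _; rewrite VV'// => i; exact: sub_fiber_ge0.
Qed.

(** Uniqueness of symmetric coefficients makes the choice in [mixed_volume] harmless. *)
Lemma mixed_volumeE (K : 'I_n -> set 'rV[R]_n) V :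
  mixed_volume_coefs K V -> mixed_volume K = V [ffun i => i].
Proof.
move=> KV; rewrite /mixed_volume; case: xgetP => [_ -> [V' KV' ->]|/(_ (V [ffun i => i]))].
  apply: polar_inj => [||lam lam0]; [exact: KV'.1|exact: KV.1|].
  by apply: EFin_inj; rewrite -(KV'.2 _ lam0) -(KV.2 _ lam0).
by case; exists V.
Qed.

(* Polarization writes each symmetric coefficient as a fixed combination of
   values of the polynomial, so pointwise convergence of the polynomials forces
   convergence of the coefficients. *)
Lemma polar_limit (Vm : nat -> {ffun 'I_n -> 'I_n} -> R) (F : ('I_n -> R) -> R) :
  (forall m (s : {perm 'I_n}) f, Vm m [ffun i => f (s i)] = Vm m f) ->
  (forall lam, (forall i, 0 <= lam i) ->
     polar (Vm m) lam @[m --> \oo] --> F lam) ->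
  exists V, [/\ forall (s : {perm 'I_n}) f, V [ffun i => f (s i)] = V f,
    forall lam, (forall i, 0 <= lam i) -> F lam = polar V lam &
    forall f, Vm m f @[m --> \oo] --> V f].
Proof.
move=> sV cV; have fact0 : n`!%:R != 0 :> R.
  by rewrite pnatr_eq0 -lt0n fact_gt0.
pose V g := (n`!%:R)^-1 *
  \sum_(S : {set 'I_n}) (-1) ^+ #|~: S| * F (sub_fiber g S).
have cVm g : Vm m g @[m --> \oo] --> V g.
  rewrite [X in X @ _ --> _](_ : _ = fun m => (n`!%:R)^-1 *
      \sum_(S : {set 'I_n}) (-1) ^+ #|~: S| * polar (Vm m) (sub_fiber g S)).
    apply: cvgMr; apply: cvg_big => [|S _]; first exact: add_continuous.
    by apply: cvgMr; apply: cV => i; exact: sub_fiber_ge0.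
  by apply/funext => m; rewrite polarization// mulKf.
exists V; split => // [s f|lam lam0].
  have := cVm [ffun i => f (s i)].
  rewrite [X in X @ _ --> _](_ : _ = Vm^~ f); last by apply/funext => m; exact: sV.
  by move=> cVf; apply: (cvg_unique _ cVf (cVm f)).
apply: (cvg_unique _ (cV _ lam0)) => //.
apply: cvg_big => [|f _]; first exact: add_continuous.
by apply: cvgMr; exact: cVm.
Qed.

End polarization.

(** * Ellipsoids between zonotopes *)

Section quadratic_forms.
Context {R : realType} {n : nat}.
Implicit Types (S : 'M[R]_n) (u v x : 'rV[R]_n).

Definition quad S u v : R := (u *m S *m v^T) 0 0.

Definition posdef S : Prop := S^T = S /\ forall u, u != 0 -> 0 < quad S u u.

Lemma quadDl S u v x : quad S (u + v) x = quad S u x + quad S v x.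
Proof. by rewrite /quad !mulmxDl mxE. Qed.

Lemma quadDr S u v x : quad S x (u + v) = quad S x u + quad S x v.
Proof. by rewrite /quad linearD/= mulmxDr mxE. Qed.

Lemma quadZl S a u v : quad S (a *: u) v = a * quad S u v.
Proof. by rewrite /quad -!scalemxAl mxE. Qed.

Lemma quadZr S a u v : quad S u (a *: v) = a * quad S u v.
Proof. by rewrite /quad linearZ/= -scalemxAr mxE. Qed.

Lemma quad0l S u : quad S 0 u = 0.
Proof. by rewrite /quad !mul0mx mxE. Qed.

Lemma quad_suml S (I : finType) (w : I -> 'rV[R]_n) u :
  quad S (\sum_i w i) u = \sum_i quad S (w i) u.
Proof. by rewrite /quad !mulmx_suml summxE. Qed.

Lemma quadC S u v : S^T = S -> quad S u v = quad S v u.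
Proof.
move=> SS; rewrite /quad; have -> : v *m S *m u^T = (u *m S *m v^T)^T.
  by rewrite !trmx_mul trmxK SS mulmxA.
by rewrite [RHS]mxE.
Qed.

Lemma quad_posdef_ge0 S u : posdef S -> 0 <= quad S u u.
Proof.
by move=> [_ pS]; have [->|/pS/ltW//] := eqVneq u 0; rewrite quad0l.
Qed.

Lemma posdef1 : posdef 1%:M.
Proof.
split; first exact: trmx1.
move=> u /rV0Pn[j uj]; rewrite /quad mulmx1 mxE (bigD1 j)//=.
rewrite mxE -expr2 ltr_pwDl ?exprn_even_gt0// sumr_ge0// => i _.
by rewrite mxE -expr2 sqr_ge0.
Qed.

Lemma quad1E u v : quad 1%:M u v = \sum_j u 0 j * v 0 j.
Proof. by rewrite /quad mulmx1 mxE; apply: eq_bigr => j _; rewrite mxE. Qed.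

Lemma quad_delta S u (j : 'I_n) : quad S u (delta_mx 0 j) = (u *m S) 0 j.
Proof. by rewrite /quad trmx_delta -colE mxE. Qed.

Lemma posdef_unitmx S : posdef S -> S \in unitmx.
Proof.
move=> [_ pS]; rewrite unitmxE unitfE; apply/det0P => -[v v0 vS].
by have := pS v v0; rewrite /quad vS mul0mx mxE ltxx.
Qed.

Lemma quad_invmx S u v : posdef S ->
  quad S (u *m invmx S) (v *m invmx S) = quad (invmx S) u v.
Proof.
move=> pS; rewrite /quad mulmxKV ?posdef_unitmx// trmx_mul trmx_inv (proj1 pS).
by rewrite mulmxA.
Qed.

Lemma posdef_invmx S : posdef S -> posdef (invmx S).
Proof.
move=> pS; split; first by rewrite trmx_inv (proj1 pS).
move=> u u0; rewrite -quad_invmx//; apply: (proj2 pS).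
apply: contra u0 => /eqP uS; rewrite -[u](mulmxKV (posdef_unitmx pS)) uS.
by rewrite mul0mx.
Qed.

Lemma quad_CauchySchwarz S u v : posdef S ->
  quad S u v ^+ 2 <= quad S u u * quad S v v.
Proof.
move=> pS; have [->|v0] := eqVneq v 0.
  by rewrite ![quad S _ 0]quadC ?(proj1 pS)// !quad0l mulr0 expr0n.
have q0 := proj2 pS v v0.
have := quad_posdef_ge0 (u + (- (quad S u v / quad S v v)) *: v) pS.
rewrite !(quadDl, quadDr, quadZl, quadZr) (quadC v u (proj1 pS)).
set b := quad S u v; set c := quad S v v; set a := quad S u u => h.
have {}h : 0 <= a - b ^+ 2 / c.
  by apply: le_trans h _; rewrite le_eqVlt; apply/orP; left; apply/eqP; field;
    rewrite gt_eqF.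
by rewrite -subr_ge0 in h *; move: h; rewrite !subr_ge0 ler_pdivrMr.
Qed.

(** Gram-Schmidt, one row at a time: the vectors [S]-orthogonal to the rows present so far form a
    nonzero space as long as there are fewer rows than [n]. Only the number of rows of [x] counts,
    not its rank. With [k = 0] it yields an orthonormal basis for [S]. *)
Lemma orthonormal_complement S k (x : 'M[R]_(k, n)) m : posdef S -> (k + m <= n)%N ->
  exists y : 'M[R]_(m, n), x *m S *m y^T = 0 /\ y *m S *m y^T = 1%:M.
Proof.
move=> pS; elim: m => [|m IH] kmn.
  by exists 0; rewrite trmx0 mulmx0; split=> //; apply/matrixP => -[].
have [|y [xy yy]] := IH; first by rewrite (leq_trans _ kmn)// leq_add2l.
pose A := (col_mx x y *m S)^T.
have : kermx A != 0.
  rewrite kermx_eq0 /row_free; apply/negP => /eqP rA.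
  by have := rank_leq_col A; rewrite rA leqNgt -addnS kmn.
move=> /rowV0Pn[v /sub_kermxP vA v0].
have [Sxv Syv] : x *m S *m v^T = 0 /\ y *m S *m v^T = 0.
  have : A^T *m v^T = 0 by rewrite -trmx_mul vA trmx0.
  by rewrite trmxK !mul_col_mx -[0]col_mx0 => /eq_col_mx[].
pose c := (Num.sqrt (quad S v v))^-1.
have qv := proj2 pS v v0.
pose y' : 'M[R]_(1 + m, n) := col_mx (c *: v) y.
suff [? ?] : x *m S *m y'^T = 0 /\ y' *m S *m y'^T = 1%:M by exists y'.
rewrite /y'; split.
  rewrite tr_col_mx mul_mx_row xy linearZ/= -scalemxAr Sxv scaler0.
  by rewrite row_mx0.
rewrite mul_col_mx tr_col_mx mul_col_row yy.
rewrite linearZ/= -!scalemxAl -!scalemxAr Syv scaler0.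
have -> : v *m S *m y^T = 0.
  have -> : v *m S *m y^T = (y *m S *m v^T)^T.
    by rewrite !trmx_mul trmxK (proj1 pS) mulmxA.
  by rewrite Syv trmx0.
rewrite scaler0 (_ : c *: (c *: (v *m S *m v^T)) = 1%:M).
  by rewrite -scalar_mx_block.
rewrite [v *m S *m v^T]mx11_scalar -/(quad S v v) !scale_scalar_mx; congr _%:M.
by rewrite mulrA -expr2 /c exprVn sqr_sqrtr ?ltW// mulVf ?gt_eqF.
Qed.

End quadratic_forms.

Section ellipsoid_zonotope.
Context {R : realType}.
Notation dot := (quad 1%:M).
Notation vol := (@lebesgue_rV R _).

(* The zonotope centred at the origin, whose support function is
   [u |-> \sum_j |dot (w j) u|]. *)
Definition szono (J : finType) n (w : J -> 'rV[R]_n) : set 'rV[R]_n :=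
  [set x | exists2 t : J -> R, (forall j, `|t j| <= 1) & x = \sum_j t j *: w j].

(** Coefficients in [[-1, 1]] become coefficients in [[0, 1]] of doubled generators, the origin of
    the factor [2 ^+ n] in [vol_szono]. *)
Lemma szono_zono (J : finType) n (w : J -> 'rV[R]_n) :
  szono w = (fun x => x + \sum_j w j) @^-1` zono (fun=> 1) (fun j => 2 *: w j).
Proof.
apply/seteqP; split=> [x [t t1 ->]|x [t t1 xE]].
  exists (fun j => (t j + 1) / 2) => [j|].
    by have := t1 j; rewrite ler_norml => /andP[? ?]; apply/andP; split; lra.
  rewrite -big_split/=; apply: eq_bigr => j _.
  by rewrite scalerA divfK// scalerDl scale1r.
exists (fun j => 2 * t j - 1) => [j|].
  by have /andP[? ?] := t1 j; rewrite ler_norml; apply/andP; split; lra.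
move: xE => /(canRL (addrK _)) ->; rewrite -sumrB; apply: eq_bigr => j _.
by rewrite scalerBl scale1r scalerA mulrC.
Qed.

Lemma compact_szono (J : finType) n (w : J -> 'rV[R]_n) : compact (szono w).
Proof.
rewrite (_ : szono w = [set x | exists2 t : J -> R,
    (forall j, `[-1, 1]%classic (t j)) & x = \sum_j t j *: w j]).
  apply: (@compact_sum_image R J R n (fun j => `[-1, 1]%classic)
    (fun j t => t *: w j)) => j.
    exact: segment_compact.
  exact: scalel_continuous.
by apply/seteqP; split=> x [t tc ->]; exists t => // j; have := tc j;
  rewrite /= in_itv/= -ler_norml.
Qed.

Lemma vol_szono (J : finType) n (w : J -> 'rV[R]_n) :
  vol (szono w) =
  (2 ^+ n / n`!%:R * \sum_(g : {ffun 'I_n -> J}) `|\det (\matrix_i w (g i))|)%:E.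
Proof.
rewrite szono_zono lebesgue_rV_translation; last exact: measurable_zono.
rewrite vol_zonotope; congr EFin; rewrite [2 ^+ n / _]mulrC -mulrA; congr (_ * _).
rewrite mulr_sumr; apply: eq_bigr => g _.
rewrite (_ : \matrix_i _ = 2 *: \matrix_i w (g i)); last first.
  by apply/matrixP => i j; rewrite !mxE.
by rewrite detZ normrM ger0_norm// exprn_ge0.
Qed.

Lemma quad_continuous n (S : 'M[R]_n) : continuous (fun z : 'rV[R]_n => quad S z z).
Proof.
rewrite (_ : (fun z => _) =
    fun z : 'rV[R]_n => \sum_j (\sum_i z 0 i * S i j) * z 0 j); last first.
  apply/funext => z; rewrite /quad mxE; apply: eq_bigr => j _.
  by rewrite !mxE.
apply: continuous_big => [|j _]; first exact: add_continuous.
move=> z; apply: (@continuousM R 'rV[R]_n (fun z : 'rV[R]_n => \sum_i z 0 i * S i j)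
  (fun z : 'rV[R]_n => z 0 j)); last exact: coord_continuous.
apply: continuous_big => [|i _]; first exact: add_continuous.
move=> y; apply: (@continuousM R 'rV[R]_n (fun z : 'rV[R]_n => z 0 i) (cst (S i j))).
  exact: coord_continuous.
exact: cst_continuous.
Qed.

Lemma dot_continuous n (u : 'rV[R]_n) :
  continuous (fun z : 'rV[R]_n => dot (u - z) (u - z)).
Proof.
move=> z; apply: (@continuous_comp _ _ _ (fun z : 'rV[R]_n => u - z)
    (fun y : 'rV[R]_n => dot y y)); last exact: quad_continuous.
by apply: (@continuousB R 'rV[R]_n _ (cst u) id); [exact: cst_continuous|exact: cvg_id].
Qed.

(* Project [x] onto the zonotope: if the residual [u] were nonzero, the vertex
   maximising the scalar product with [u] would be closer to [x]. *)
Lemma szono_support (J : finType) n (w : J -> 'rV[R]_n) x :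
  (forall u, dot x u <= \sum_j `|dot (w j) u|) -> szono w x.
Proof.
move=> xw; have p1 : @posdef R n 1%:M := posdef1.
have z0 : szono w !=set0.
  by exists 0; exists (fun=> 0) => [j|]; rewrite ?normr0// big1// => j _; rewrite scale0r.
have [|z] := compact_EVT_min z0 (@compact_szono J n w)
    (f := fun z : 'rV[R]_n => dot (x - z) (x - z)).
  by apply: continuous_subspaceT; exact: (@dot_continuous n x).
rewrite inE => -[t t1 zE] zmin; have [u uE] : exists u, u = x - z by exists (x - z).
pose y := \sum_j Num.sg (dot (w j) u) *: w j.
have yu : dot y u = \sum_j `|dot (w j) u|.
  by rewrite quad_suml; apply: eq_bigr => j _; rewrite quadZl -normrEsg.
have uy : dot u u <= dot u (y - z).
  rewrite quadDr [dot u y]quadC ?(proj1 p1)// yu -[- z]scaleN1r quadZr mulN1r.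
  have -> : dot u u = dot x u - dot u z.
    by rewrite {1}uE quadDl -[- z]scaleN1r quadZl mulN1r [dot u z]quadC ?(proj1 p1).
  by rewrite lerD2r.
suff u0 : u = 0 by exists t => //; rewrite -zE; apply/subr0_eq; rewrite -uE.
apply: contrapT => /eqP u0; have uu := proj2 p1 u u0.
set s := dot u (y - z) in uy; set D := dot (y - z) (y - z).
have D0 : 0 <= D by exact: quad_posdef_ge0.
have s0 : 0 < s by exact: lt_le_trans uy.
(* The best point on the segment from [z] to [y] would be at [s / D]. The smaller [s / (s + D)]
   stays in [[0, 1]], avoids dividing by [D], and still decreases the distance because
   [e * D < s]. *)
have [e eE] : exists e, e = s / (s + D) by exists (s / (s + D)).
have e01 : 0 <= e <= 1.
  by rewrite eE; apply/andP; split; [rewrite divr_ge0//; lra|rewrite ler_pdivrMr; lra].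
have [e0 e1] := andP e01.
have yz : szono w (z + e *: (y - z)).
  exists (fun j => (1 - e) * t j + e * Num.sg (dot (w j) u)) => [j|].
    apply: le_trans (ler_normD _ _) _; rewrite !normrM (ger0_norm e0).
    rewrite (ger0_norm (_ : 0 <= 1 - e)) ?subr_ge0//.
    have sg1 : `|Num.sg (dot (w j) u)| <= 1 by rewrite normr_sg; case: (_ != _).
    have := ler_wpM2l e0 sg1.
    have e1' : 0 <= 1 - e by lra.
    by have := ler_wpM2l e1' (t1 j); lra.
  rewrite zE /y -sumrB scaler_sumr -big_split/=; apply: eq_bigr => j _.
  by rewrite -scalerBl scalerA -scalerDl; congr (_ *: _); ring.
have := zmin _ (mem_set yz).
have -> : x - (z + e *: (y - z)) = u + (- e) *: (y - z).
  by rewrite uE scaleNr opprD addrA.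
rewrite -uE [leRHS]quadDl !(quadDr _ _ ((- e) *: _)) !quadZl !quadZr -/s -/D.
rewrite [dot (y - z) u]quadC ?(proj1 p1)// -/s.
have eDs : e * D < s.
  rewrite eE mulrAC ltr_pdivrMr; last lra.
  by rewrite mulrDr ltrDr mulr_gt0.
have egt0 : 0 < e by rewrite eE divr_gt0//; lra.
have := mulr_gt0 egt0 s0.
have : e * (e * D) < e * s by rewrite ltr_pM2l.
lra.
Qed.

(** Test the support inequality in the direction [v = x *m invmx S], normal to the ellipsoid through
    [x]: there [dot x v] and [quad S v v] both equal [q], so [q] is at most [b] times its square
    root. *)
Lemma szono_sub_ellipsoid (J : finType) n (w : J -> 'rV[R]_n) S b x :
  posdef S -> 0 <= b ->
  (forall u, \sum_j `|dot (w j) u| <= b * Num.sqrt (quad S u u)) ->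
  szono w x -> quad (invmx S) x x <= b ^+ 2.
Proof.
move=> pS b0 wb [t t1 xE]; set q := quad (invmx S) x x.
have q0 : 0 <= q by exact/quad_posdef_ge0/posdef_invmx.
pose v := x *m invmx S.
have qv : q = dot x v.
  rewrite /q /quad /v mulmx1 trmx_mul trmx_inv (proj1 pS) mulmxA //.
have : q <= b * Num.sqrt q.
  have {2}-> : q = quad S v v by rewrite quad_invmx.
  apply: le_trans (wb v); rewrite qv xE quad_suml ler_sum// => j _.
  rewrite quadZl (le_trans (ler_norm _))// normrM ler_piMl//.
have [->|qn0] := eqVneq q 0; first by rewrite exprn_ge0.
have sq0 : 0 < Num.sqrt q by rewrite sqrtr_gt0 lt_def qn0.
rewrite -{1}(sqr_sqrtr q0) expr2 ler_pM2r// => sqb.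
by rewrite -(sqr_sqrtr q0) ler_sqr ?nnegrE ?sqrtr_ge0.
Qed.

(** Cauchy-Schwarz for [invmx S] bounds the support function of the dilated ellipsoid at [u] by
    [a * sqrt (quad S u u)], and [szono_support] concludes. *)
Lemma ellipsoid_sub_szono (J : finType) n (w : J -> 'rV[R]_n) S a x :
  posdef S -> 0 <= a ->
  (forall u, a * Num.sqrt (quad S u u) <= \sum_j `|dot (w j) u|) ->
  quad (invmx S) x x <= a ^+ 2 -> szono w x.
Proof.
move=> pS a0 aw xa; apply: szono_support => u; apply: le_trans (aw u).
have -> : dot x u = quad (invmx S) x (u *m S).
  by rewrite /quad mulmx1 trmx_mul (proj1 pS) mulmxA mulmxKV// posdef_unitmx.
have uSu : quad (invmx S) (u *m S) (u *m S) = quad S u u.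
  by rewrite -quad_invmx// mulmxK// posdef_unitmx.
have := quad_CauchySchwarz x (u *m S) (posdef_invmx pS); rewrite uSu => h.
have qu := quad_posdef_ge0 u pS.
apply: le_trans (ler_norm _) _; rewrite -sqrtr_sqr -[a]ger0_norm// -sqrtr_sqr.
rewrite -sqrtrM ?sqr_ge0// ler_sqrt ?mulr_ge0 ?sqr_ge0//.
by apply: le_trans h _; exact: ler_wpM2r.
Qed.

Lemma compact_ellipsoid n (S : 'M[R]_n) : posdef S -> compact (ellipsoid S).
Proof.
move=> pS; apply: bounded_closed_compact.
  (* On the ellipsoid, Cauchy-Schwarz against the vector dual to the [j]-th coordinate gives
     [x 0 j ^+ 2 <= S j j], and [S j j] is at most [(S j j + 1) ^+ 2]. *)
  exists (\sum_j `|S j j| + 1); split; first exact: num_real.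
  move=> M MS x; rewrite /ellipsoid/= -/(quad _ x x) => x1.
  rewrite [leLHS]/Num.norm/= mx_normrE; apply/bigmax_leP.
  split=> [|[i j] _ /=]; apply: le_trans (ltW MS).
    by rewrite addr_ge0// sumr_ge0.
  rewrite ord1; apply: (@le_trans _ _ (`|S j j| + 1)); last first.
    by rewrite lerD2r (bigD1 j)//= lerDl sumr_ge0.
  have -> : x 0 j = quad (invmx S) x (delta_mx 0 j *m S).
    rewrite /quad trmx_mul (proj1 pS) mulmxA mulmxKV ?posdef_unitmx//.
    by rewrite trmx_delta -colE mxE.
  set q := quad _ _ _.
  have := quad_CauchySchwarz x (delta_mx 0 j *m S) (posdef_invmx pS); rewrite -/q.
  have -> : quad (invmx S) (delta_mx 0 j *m S) (delta_mx 0 j *m S) = S j j.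
    rewrite -quad_invmx// mulmxK ?posdef_unitmx// quad_delta.
    by rewrite -rowE mxE.
  move=> qS; have Sjj : 0 <= S j j.
    have := quad_posdef_ge0 (delta_mx 0 j) pS.
    by rewrite quad_delta -rowE mxE.
  have q1 := le_trans qS (ler_piMl Sjj x1).
  rewrite (ger0_norm Sjj) -ler_sqr ?nnegrE ?addr_ge0//.
  by rewrite real_normK ?num_real//; apply: le_trans q1 _; nra.
rewrite (_ : ellipsoid S = (fun z : 'rV[R]_n => quad (invmx S) z z) @^-1` [set t | t <= 1])//.
apply: preimage_closed; last exact: closed_le.
by move=> z _; exact: quad_continuous.
Qed.

End ellipsoid_zonotope.

(** * Minkowski combinations of zonotopes and squeezing of volumes *)

Section minkowski_zonotopes.
Context {R : realType} {n : nat}.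
Notation vol := (@lebesgue_rV R _).

(** These turn out to be the coefficients of the volume polynomial of the zonotopes [szono (w i)],
    hence their mixed volumes. *)
Definition zono_coef (J : finType) (w : 'I_n -> J -> 'rV[R]_n)
    (f : {ffun 'I_n -> 'I_n}) : R :=
  2 ^+ n / n`!%:R *
  \sum_(j : {ffun 'I_n -> J}) `|\det (\matrix_i w (f i) (j i))|.

Lemma zono_coef_sym (J : finType) (w : 'I_n -> J -> 'rV[R]_n) (s : {perm 'I_n})
    (f : {ffun 'I_n -> 'I_n}) :
  zono_coef w [ffun i => f (s i)] = zono_coef w f.
Proof.
congr (_ * _).
rewrite (reindex (fun j : {ffun 'I_n -> J} => [ffun i => j (s i)])); last first.
  exists (fun j : {ffun 'I_n -> J} => [ffun i => j (s^-1%g i)]) => j _;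
    by apply/ffunP => i; rewrite !ffunE ?permK ?permKV.
apply: eq_bigr => j _.
rewrite (_ : (\matrix_i _) = perm_mx s *m \matrix_i w (f i) (j i)).
  by rewrite det_mulmx det_perm normrM normrX normrN1 expr1n mul1r.
by apply/matrixP => i l; rewrite -row_permE !mxE !ffunE.
Qed.

Lemma minkowski_szono (J : finType) (w : 'I_n -> J -> 'rV[R]_n) (lam : 'I_n -> R) :
  minkowski_comb lam (fun i => szono (w i)) =
  szono (fun p : 'I_n * J => lam p.1 *: w p.1 p.2).
Proof.
apply/seteqP; split=> [x [y yw ->]|x [t t1 ->]].
  have /choice[t tP] i : exists t : J -> R,
      (forall j, `|t j| <= 1) /\ y i = \sum_j t j *: w i j.
    by have [t ? ?] := yw i; exists t.
  exists (fun p => t p.1 p.2) => [p|]; first exact: (tP p.1).1.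
  rewrite -(pair_bigA _ (fun i j => t i j *: (lam i *: w i j)))/=.
  apply: eq_bigr => i _; rewrite (tP i).2 scaler_sumr; apply: eq_bigr => j _.
  by rewrite !scalerA mulrC.
exists (fun i => \sum_j t (i, j) *: w i j) => [i|].
  by exists (fun j => t (i, j)).
rewrite [LHS](eq_bigr (fun p => t (p.1, p.2) *: (lam p.1 *: w p.1 p.2))); last by case.
rewrite -(pair_bigA _ (fun i j => t (i, j) *: (lam i *: w i j)))/=.
apply: eq_bigr => i _; rewrite scaler_sumr; apply: eq_bigr => j _.
by rewrite !scalerA mulrC.
Qed.

(** A generator of the combined zonotope is a pair of a body and a generator of it. Splitting a
    choice of [n] pairs into the bodies [f] and the indices [j] takes the factors [lam (f i)] out of
    the rows of the determinant. *)
Lemma vol_minkowski_szono (J : finType) (w : 'I_n -> J -> 'rV[R]_n) (lam : 'I_n -> R) :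
  (forall i, 0 <= lam i) ->
  vol (minkowski_comb lam (fun i => szono (w i))) = (polar (zono_coef w) lam)%:E.
Proof.
move=> lam0; rewrite minkowski_szono vol_szono /polar; congr EFin.
pose pr (g : {ffun 'I_n -> 'I_n * J}) :=
  ([ffun i => (g i).1], [ffun i => (g i).2]) : {ffun 'I_n -> 'I_n} * {ffun 'I_n -> J}.
pose pai (p : {ffun 'I_n -> 'I_n} * {ffun 'I_n -> J}) :=
  [ffun i => (p.1 i, p.2 i)] : {ffun 'I_n -> 'I_n * J}.
rewrite (reindex pai)/=; last first.
  exists pr => [p _|g _]; last by apply/ffunP => i; rewrite !ffunE; case: (g i).
  by case: p => f j; rewrite /pr /pai; congr pair; apply/ffunP => i; rewrite !ffunE.
rewrite -(pair_bigA _ (fun f j => `|\det (\matrix_i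
  (lam (pai (f, j) i).1 *: w (pai (f, j) i).1 (pai (f, j) i).2))|))/=.
rewrite mulr_sumr; apply: eq_bigr => f _; rewrite /zono_coef mulrCA; congr (_ * _).
rewrite mulr_sumr; apply: eq_bigr => j _.
rewrite (_ : (\matrix_i _) = diag_mx (\row_i lam (f i)) *m \matrix_i w (f i) (j i)).
  rewrite det_mulmx det_diag normrM; congr (_ * _).
  rewrite ger0_norm; first by apply: eq_bigr => i _; rewrite mxE.
  by apply: prodr_ge0 => i _; rewrite mxE.
apply/row_matrixP => i; rewrite rowK row_mul row_diag_mx -scalemxAl -rowE rowK.
by rewrite !ffunE mxE.
Qed.

Lemma compact_minkowski_comb (K : 'I_n -> set 'rV[R]_n) (lam : 'I_n -> R) :
  (forall i, compact (K i)) -> compact (minkowski_comb lam K).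
Proof.
move=> cK.
apply: (@compact_sum_image R 'I_n 'rV[R]_n n K (fun i x => lam i *: x)) => // i.
exact: scaler_continuous.
Qed.

Lemma minkowski_comb_scale (K K' : 'I_n -> set 'rV[R]_n) (lam : 'I_n -> R) (a : R) x :
  (forall i y, K i y -> K' i (a *: y)) ->
  minkowski_comb lam K x -> minkowski_comb lam K' (a *: x).
Proof.
move=> KK' [y Ky ->]; exists (fun i => a *: y i) => [i|]; first exact: KK'.
by rewrite scaler_sumr; apply: eq_bigr => i _; rewrite !scalerA mulrC.
Qed.

Lemma vol_le_scale (A B : set 'rV[R]_n) (a : R) : 0 < a ->
  measurable A -> measurable B -> (forall x, A x -> B (a *: x)) ->
  ((a ^+ n)%:E * vol A <= vol B)%E.
Proof.
move=> a0 mA mB AB; rewrite -lebesgue_rV_scale//.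
apply: le_measure; rewrite ?inE//; last first.
  by move=> x /AB; rewrite scalerA mulfV ?scale1r// gt_eqF.
have := measurable_mulmx (a^-1)%:M measurableT mA; rewrite setTI.
by congr measurable; apply/seteqP; split=> x /=; rewrite mul_mx_scalar.
Qed.

Lemma cvg_exprn_scale (u : nat -> R) (c : R) : u m @[m --> \oo] --> (1 : R) ->
  u m ^+ n * c @[m --> \oo] --> c.
Proof.
move=> u1; have -> : nbhs c = nbhs (1 ^+ n * c) by rewrite expr1n mul1r.
apply: cvgMr_tmp.
exact: (cvg_comp u (fun t : R => t ^+ n) u1 (@exprn_continuous R n 1)).
Qed.

(** The lower inclusion is required only where [e m < 1], so that the dilation factor is positive;
    this holds for all large [m]. *)
Lemma vol_cvg_sandwich (K : set 'rV[R]_n) (Z : nat -> set 'rV[R]_n) (e : nat -> R) :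
  measurable K -> (vol K < +oo)%E ->
  (forall m, measurable (Z m)) -> (forall m, vol (Z m) < +oo)%E ->
  (forall m, 0 <= e m) -> e m @[m --> \oo] --> 0 ->
  (forall m x, e m < 1 -> K x -> Z m ((1 - e m) *: x)) ->
  (forall m x, Z m x -> K ((1 + e m)^-1 *: x)) ->
  fine (vol (Z m)) @[m --> \oo] --> fine (vol K).
Proof.
move=> mK fK mZ fZ e0 ecv KZ ZK.
have fin_vol (A : set 'rV[R]_n) : (vol A < +oo)%E -> vol A = (fine (vol A))%:E.
  by move=> fA; rewrite fineK// ge0_fin_numE ?measure_ge0.
apply: (@squeeze_cvgr _ _ _ _ (fun m => (1 - e m) ^+ n * fine (vol K))
    (fun m => (1 + e m) ^+ n * fine (vol K))).
- near=> m; have em1 : e m < 1 by near: m; exact: (cvgr_lt 0).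
  apply/andP; split; rewrite -lee_fin EFinM -!fin_vol//.
    by apply: vol_le_scale => //; [rewrite subr_gt0|move=> x; exact: KZ].
  have e1 : 0 < 1 + e m by rewrite ltr_pwDl.
  have := @vol_le_scale (Z m) K (1 + e m)^-1; rewrite invr_gt0 => /(_ e1 (mZ m) mK (ZK m)).
  rewrite (fin_vol _ (fZ m)) (fin_vol _ fK) -!EFinM !lee_fin exprVn.
  by rewrite mulrC ler_pdivrMr ?exprn_gt0// mulrC.
- apply: cvg_exprn_scale; rewrite -[X in _ --> X]subr0.
  by apply: cvgB => //; exact: cvg_cst.
- apply: cvg_exprn_scale; rewrite -[X in _ --> X]addr0.
  by apply: cvgD => //; exact: cvg_cst.
Unshelve. all: by end_near. Qed.

End minkowski_zonotopes.

(** * Volume of the unit ball and Gaussian moments *)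

Section tonelli_set.
Local Open Scope ereal_scope.
Context d1 d2 (T1 : measurableType d1) (T2 : measurableType d2) (R : realType).
Context (m1 : {sigma_finite_measure set T1 -> \bar R})
  (m2 : {sigma_finite_measure set T2 -> \bar R}).

(** The layer-cake principle behind the volume of the ball, the second Gaussian moment and the
    expectation of a function of a normal variable. *)
Lemma tonelli_set (D : set (T1 * T2)) (phi : T2 -> \bar R) :
  measurable D -> measurable_fun setT phi -> (forall y, 0 <= phi y) ->
  \int[m1]_x \int[m2]_(y in [set y | D (x, y)]) phi y =
  \int[m2]_y (phi y * m1 [set x | D (x, y)]).
Proof.
move=> mD mphi phi0.
have mX x : measurable [set y | D (x, y)].
  by have := measurable_xsection x mD; congr measurable; apply/seteqP; split=> y;
    rewrite /xsection/= inE.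
have mY y : measurable [set x | D (x, y)].
  by have := measurable_ysection y mD; congr measurable; apply/seteqP; split=> x;
    rewrite /ysection/= inE.
pose f (p : T1 * T2) := phi p.2 * (\1_D p)%:E.
have mf : measurable_fun setT f.
  apply: emeasurable_funM; last exact/measurable_EFinP.
  by apply: measurableT_comp => //; exact: measurable_snd.
have f0 p : 0 <= f p by rewrite mule_ge0// lee_fin.
transitivity (\int[m1]_x \int[m2]_y f (x, y)).
  apply: eq_integral => x _; rewrite integral_mkcond; apply: eq_integral => y _.
  rewrite /f patchE indicE /=; have [Dxy|nDxy] := pselect (D (x, y)).
    by rewrite !mem_set// mule1.
  by rewrite !memNset// mule0.
rewrite (fubini_tonelli f)//; apply: eq_integral => y _.
transitivity (\int[m1]_x (phi y * (\1_D (x, y))%:E)) => //.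
rewrite ge0_integralZl//=; last first.
  apply/measurable_EFinP.
  rewrite (_ : (fun x => _) = \1_[set x | D (x, y)]); first exact: measurable_indic.
  by apply/funext => x; rewrite !indicE; congr (nat_of_bool _)%:R; apply/idP/idP; rewrite !inE.
congr (_ * _).
have := integral_indic m1 measurableT (mY y); rewrite setIT => <-.
by apply: eq_integral => x _; rewrite !indicE; congr ((nat_of_bool _)%:R)%:E.
Qed.

End tonelli_set.

Section tails.
Context {R : realType}.
Notation mu := (@lebesgue_measure R).

Lemma integral_tail_expR (a : R) :
  (\int[mu]_(t in `[a, +oo[) (expR (- t))%:E = (expR (- a))%:E)%E.
Proof.
have cexp : continuous (fun t : R => expR (- t)).
  move=> t; apply: continuous_comp; last exact: continuous_expR.
  by apply: (@continuousN R R^o _ id); exact: cvg_id.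
rewrite (@ge0_continuous_FTC2y _ _ (fun t => - expR (- t)) a 0)//.
- by rewrite EFinN oppeK add0e.
- exact: continuous_subspaceT.
- by rewrite -oppr0; apply: cvgN; exact: cvgr_expR.
- by apply: cvgN; apply/cvg_at_right_filter; exact: cexp.
- move=> x _; rewrite derive1E.
  have h : is_derive x (1 : R) (fun t : R => - expR (- t)) (- (expR (- x) * -1)).
    apply: is_deriveN; apply: (@is_derive1_comp R expR (fun t => - t)).
  by rewrite derive_val mulrN1 opprK.
Qed.

Lemma integral_tail_gauss (a : R) : 0 <= a ->
  (\int[mu]_(t in `[a, +oo[) (t * expR (- t ^+ 2))%:E = (expR (- a ^+ 2) / 2)%:E)%E.
Proof.
move=> a0.
have cg := @continuous_gauss_fun R.
rewrite (@ge0_continuous_FTC2y _ _ (fun t => - (gauss_fun t / 2)) a 0)//.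
- by rewrite EFinN oppeK add0e.
- by move=> x ax; rewrite mulr_ge0 ?expR_ge0// (le_trans a0).
- apply: continuous_subspaceT => t; apply: cvgM; first exact: cvg_id.
  exact: cg.
- rewrite -oppr0; apply: cvgN; rewrite -(mul0r 2^-1).
  by apply: cvgMr_tmp; exact: cvg_gauss_fun.
- by apply: cvgN; apply/cvg_at_right_filter; apply: cvgMr_tmp; exact: cg.
- move=> x _; rewrite derive1E.
  have h : is_derive x (1 : R) (fun t : R => - (gauss_fun t / 2))
      (- (2^-1 * (expR (- x ^+ 2) * - (2 * x)))).
    apply: is_deriveN.
    rewrite (_ : (fun t : R => gauss_fun t / 2) = 2^-1 \*: gauss_fun); last first.
      by apply/funext => t; rewrite /= mulrC.
    apply: is_deriveZ; apply: (@is_derive1_comp R expR (fun t => - t ^+ 2)).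
    apply: is_deriveN; apply: is_derive_eq.
    by rewrite -[x%:A]/(x * 1) mulr1 mulr_natl mulr2n.
  by rewrite derive_val; field.
Qed.

End tails.

Section ball_volume.
Context {R : realType}.
Notation mu := (@lebesgue_measure R).
Notation vol := (@lebesgue_rV R _).

Definition sqnorm n (x : 'rV[R]_n) : R := \sum_j x 0 j ^+ 2.

Lemma sqnorm_ge0 n (x : 'rV[R]_n) : 0 <= sqnorm x.
Proof. by apply: sumr_ge0 => j _; exact: sqr_ge0. Qed.

Lemma measurable_sqnorm n : measurable_fun setT (fun x : 'rV[R]_n => sqnorm x).
Proof.
apply: measurable_sum => j; apply: measurable_funX.
exact: measurable_rV_coord.
Qed.

Lemma integral_exp_sqnorm n :
  (\int[@lebesgue_rV R n]_x (expR (- sqnorm x))%:E = (Num.sqrt pi ^+ n)%:E)%E.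
Proof.
have mexp m : measurable_fun setT (fun x : 'rV[R]_m => (expR (- sqnorm x))%:E).
  apply/measurable_EFinP; apply: measurableT_comp => //.
  by apply: measurableT_comp => //; exact: measurable_sqnorm.
elim: n => [|n IH].
  transitivity (\int[\d_(0%R : 'rV[R]_0)]_x (expR (- sqnorm x))%:E)%E => //.
  rewrite integral_dirac//=; last exact: mexp.
  have -> : \d_(0%R : 'rV[R]_0) [set: 'rV[R]_0] = 1%E :> \bar R by exact: diracT.
  by rewrite mul1e /sqnorm big_ord0 oppr0 expR0.
pose p0 : {measure set 'rV[R]_n.+1 -> \bar R} :=
  pushforward (mu \x @lebesgue_rV R n)%E (@rV_cons R n).
pose p := p0 (@measurable_rV_cons R n).
transitivity (\int[p]_x (expR (- sqnorm x))%:E)%E => //.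
rewrite ge0_integral_pushforward//; last exact: mexp.
rewrite preimage_setT.
pose f (z : measurableTypeR R * 'rV[R]_n) :=
  ((expR (- z.1 ^+ 2))%:E * (expR (- sqnorm z.2))%:E)%E.
have mf : measurable_fun setT f.
  apply: emeasurable_funM; last first.
    by apply: (measurableT_comp (mexp n)); exact: measurable_snd.
  apply/measurable_EFinP; apply: (measurableT_comp (@measurable_gauss_fun R)).
  exact: measurable_fst.
transitivity (\int[mu \x @lebesgue_rV R n]_z f z)%E.
  apply: eq_integral => -[t x] _; rewrite /f/= -EFinM -expRD -opprD; congr (expR (- _))%:E.
  rewrite /sqnorm big_ord_recl rV_cons0; congr (_ + _).
  by apply: eq_bigr => j _; rewrite rV_consS.
rewrite (fubini_tonelli1 f)//; last first.
  by move=> z; rewrite mule_ge0// lee_fin expR_ge0.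
transitivity (\int[mu]_t ((expR (- t ^+ 2))%:E * (Num.sqrt pi ^+ n)%:E))%E.
  apply: eq_integral => t _; rewrite /fubini_F /f/= ge0_integralZl//; last exact: mexp.
  by rewrite IH.
rewrite ge0_integralZr//.
- by rewrite (@integralT_gauss R) -EFinM exprS.
- by apply/measurable_EFinP; exact: measurable_gauss_fun.
- exact: measurable_rV_cons.
Qed.

Lemma closed_unit_ballE n : closed_unit_ball = ellipsoid 1%:M :> set 'rV[R]_n.
Proof.
apply/seteqP; split=> x; rewrite /closed_unit_ball /ellipsoid/= invmx1;
  rewrite -[X in _ -> X <= _]/(quad 1%:M x x) || rewrite -[X in X <= _ -> _]/(quad 1%:M x x);
  by rewrite quad1E; under eq_bigr do rewrite expr2.
Qed.

Lemma compact_closed_unit_ball n : compact (closed_unit_ball : set 'rV[R]_n).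
Proof. by rewrite closed_unit_ballE; apply: compact_ellipsoid; exact: posdef1. Qed.

(* Write [exp(-|x|^2)] as the integral of [exp(-t)] over [t >= |x|^2] and exchange
   the order of integration; the sections are balls of radius [sqrt t]. *)
Lemma vol_closed_unit_ball_Gamma n :
  (vol (closed_unit_ball : set 'rV[R]_n) *
   \int[mu]_(t in `]0%R, +oo[) (t `^ (1 + n%:R / 2 - 1) * expR (- t))%:E =
   (pi `^ (n%:R / 2))%:E)%E.
Proof.
pose D : set ('rV[R]_n * measurableTypeR R) := [set p | 0 < p.2 /\ sqnorm p.1 <= p.2].
have mD : measurable D.
  rewrite (_ : D = (setT `*` `]0, +oo[) `&`
      (fun p : 'rV[R]_n * measurableTypeR R => p.2 - sqnorm p.1) @^-1` `[0, +oo[).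
    apply: measurableI; first by apply: measurableX => //; exact: measurable_itv.
    have mf : measurable_fun setT
        (fun p : 'rV[R]_n * measurableTypeR R => p.2 - sqnorm p.1).
      apply: (@measurable_funB _ _ R setT snd
        (fun p : 'rV[R]_n * measurableTypeR R => sqnorm p.1)).
        exact: measurable_snd.
      by apply: (measurableT_comp (@measurable_sqnorm n)); exact: measurable_fst.
    by rewrite -[X in measurable X]setTI; apply: mf => //; exact: measurable_itv.
  apply/seteqP; split=> -[x t]; rewrite /D/= !in_itv/= !andbT subr_ge0.
    by move=> [].
  by move=> [[]].
have mexp : measurable_fun setT (fun t : measurableTypeR R => (expR (- t))%:E).
  by apply/measurable_EFinP; exact: measurableT_comp.
have := tonelli_set (@lebesgue_rV R n) mu mD mexp.
have -> : (pi : R) `^ (n%:R / 2) = Num.sqrt pi ^+ n.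
  by rewrite mulrC powRrM powR12_sqrt ?pi_ge0// powR_mulrn.
rewrite -integral_exp_sqnorm => tonelli.
transitivity (\int[@lebesgue_rV R n]_x
    \int[mu]_(t in [set t | D (x, t)]) (expR (- t))%:E)%E; last first.
  apply: eq_integral => x _; rewrite -integral_tail_expR.
  (* [D] requires [0 < t], to match the domain of integration in [Gamma]; for [x = 0] its section
     therefore misses the endpoint of the tail, a null set. *)
  have := sqnorm_ge0 x; rewrite le_eqVlt => /predU1P[x0|x0].
    rewrite -x0 -integral_itv_obnd_cbnd; last exact: measurable_funTS.
    congr integral; apply/seteqP; split=> t; rewrite /D/= in_itv/= andbT -x0.
      by case.
    by move=> t0; split=> //; exact: ltW.
  congr integral; apply/seteqP; split=> t; rewrite /D/= in_itv/= andbT; first by case.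
  by move=> xt; split=> //; exact: lt_le_trans xt.
rewrite tonelli => [|t]; last by rewrite lee_fin expR_ge0.
rewrite -ge0_integralZl//=; last 2 first.
- apply/measurable_EFinP; apply: measurable_funTS; apply: measurable_funM.
    exact: measurable_powR.
  exact: measurableT_comp.
- by move=> t _; rewrite lee_fin mulr_ge0 ?powR_ge0 ?expR_ge0.
rewrite integral_mkcond; apply: eq_integral => t _; rewrite patchE.
rewrite (_ : (t \in _) = (0 < t)); last by rewrite mem_setE in_itv/= andbT.
case: ifPn => t0; last first.
  rewrite (_ : [set x | D (x, t)] = set0) ?measure0 ?mule0//.
  by apply/seteqP; split=> // x; rewrite /D/= (negbTE t0) => -[].
rewrite muleC [_ * expR _]mulrC EFinM -muleA; congr (_ * _)%E.
rewrite (_ : [set x | D (x, t)] = [set x | closed_unit_ball ((Num.sqrt t)^-1 *: x)]); last first.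
  apply/seteqP; split=> x; rewrite /D /closed_unit_ball/= t0;
    under eq_bigr do rewrite mxE exprMn exprVn sqr_sqrtr ?ltW//;
    rewrite -mulr_sumr mulrC ler_pdivrMr// mul1r//.
  by case.
rewrite lebesgue_rV_scale ?sqrtr_gt0//; last first.
  by apply: compact_measurable_rV; exact: compact_closed_unit_ball.
congr (_%:E * _)%E.
by rewrite addrAC subrr add0r mulrC powRrM powR12_sqrt ?ltW// powR_mulrn.
Qed.

(** [Gamma] is a real-valued integral, which would be 0 if the extended one were infinite. That [J]
    is neither 0 nor infinite follows from the identity itself: [J] times the finite volume [v] is a
    positive real. *)
Lemma vol_closed_unit_ball n :
  vol (closed_unit_ball : set 'rV[R]_n) = (kappa n)%:E /\ 0 < kappa n :> R.
Proof.
have := vol_closed_unit_ball_Gamma n.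
set v := vol _; set J := integral _ _ _ => vJ.
have p0 : 0 < (pi : R) `^ (n%:R / 2) by rewrite powR_gt0// pi_gt0.
have vfin : v = (fine v)%:E.
  rewrite fineK// ge0_fin_numE ?measure_ge0//.
  by apply: compact_lebesgue_rV_lty; exact: compact_closed_unit_ball.
have v0 : 0 <= fine v by rewrite fine_ge0// measure_ge0.
have J0 : (0 <= J)%E.
  by apply: integral_ge0 => t _; rewrite lee_fin mulr_ge0 ?powR_ge0 ?expR_ge0.
have GE : Gamma (1 + n%:R / 2) = fine J by [].
move: vJ J0 GE; rewrite {1}vfin; case: J => [j| |//].
  rewrite -EFinM => -[vj]; rewrite lee_fin => j0 /= GE.
  have jn0 : 0 < j.
    rewrite lt_def j0 andbT; apply/eqP => j0'.
    by move: p0; rewrite -vj j0' mulr0 ltxx.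
  have kE : kappa n = fine v :> R.
    by rewrite /kappa GE -vj mulfK// gt_eqF.
  split; first by rewrite kE.
  by rewrite /kappa GE divr_gt0.
move=> + _ _; move: v0; rewrite le_eqVlt => /predU1P[<-|v0].
  by rewrite mul0e => -[/eqP]; rewrite lt_eqF.
by rewrite gt0_muley// lte_fin.
Qed.

End ball_volume.

(** * Moments of the normal law *)

Section normal_moments.
Context {R : realType}.
Notation mu := (@lebesgue_measure R).

Lemma integral_abs_gauss :
  (\int[mu]_r (`|r| * expR (- r ^+ 2))%:E = 1)%E.
Proof.
rewrite ge0_symfun_integralT//.
- rewrite -set_itvcy.
  under eq_integral => r.
    rewrite inE/= in_itv/= andbT => r0; rewrite ger0_norm//; over.
  rewrite (@integral_tail_gauss R 0)// expr0n oppr0 expR0 -EFinM.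
  by rewrite mul1r mulfV.
- move=> r; apply: cvgM; first exact: norm_continuous.
  exact: continuous_gauss_fun.
- by move=> r /=; rewrite normrN sqrrN.
Qed.

(** Write [expR (- r ^+ 2) / 2] as the integral of [t * expR (- t ^+ 2)] over [t >= |r|] and
    exchange: the section at [t] is [[-t, t]], of length [2 * t], so twice the half-line integral of
    [t ^+ 2 * expR (- t ^+ 2)] appears. The maximum in [phi] keeps the weight nonnegative on the
    whole line. *)
Lemma integral_sqr_gauss :
  (\int[mu]_r (r ^+ 2 * expR (- r ^+ 2))%:E = (Num.sqrt pi / 2)%:E)%E.
Proof.
pose D : set (measurableTypeR R * measurableTypeR R) :=
  (fun p => p.2 - `|p.1|) @^-1` `[0, +oo[.
have mD : measurable D.
  have mf : measurable_fun setT
      (fun p : measurableTypeR R * measurableTypeR R => p.2 - `|p.1|).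
    apply: (@measurable_funB _ _ R setT snd
      (fun p : measurableTypeR R * measurableTypeR R => `|p.1|)).
      exact: measurable_snd.
    by apply: (measurableT_comp (@normr_measurable R setT)); exact: measurable_fst.
  by rewrite -[X in measurable X]setTI; apply: mf => //; exact: measurable_itv.
pose phi (t : R) := Num.max 0 t * expR (- t ^+ 2).
have mphi : measurable_fun setT (fun t => (phi t)%:E).
  apply/measurable_EFinP; apply: measurable_funM; first exact: measurable_maxr.
  exact: measurable_gauss_fun.
have phi0 t : (0 <= (phi t)%:E)%E by rewrite lee_fin mulr_ge0 ?expR_ge0// le_max lexx.
have <- : (\int[mu]_x \int[mu]_(y in [set y | D (x, y)]) (phi y)%:E =
    (Num.sqrt pi / 2)%:E)%E.
  rewrite EFinM -(@integralT_gauss R) -ge0_integralZr//; last 2 first.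
  - by apply/measurable_EFinP; exact: measurable_gauss_fun.
  - by move=> r _; rewrite lee_fin expR_ge0.
  apply: eq_integral => r _; have := integral_tail_gauss (normr_ge0 r).
  rewrite real_normK ?num_real// EFinM => <-.
  rewrite (_ : [set y | D (r, y)] = `[`|r|, +oo[%classic); last first.
    by apply/seteqP; split=> t; rewrite /D/= !in_itv/= !andbT subr_ge0.
  apply: eq_integral => t; rewrite inE/= in_itv/= andbT => rt.
  by rewrite /phi max_r// (le_trans _ rt).
rewrite (tonelli_set mu mu mD mphi phi0) ge0_symfun_integralT.
- rewrite -set_itvcy -ge0_integralZl//=; last 2 first.
  + apply/measurable_EFinP; apply: measurable_funTS; apply: measurable_funM => //.
    exact: measurable_gauss_fun.
  + by move=> r _; rewrite lee_fin mulr_ge0 ?expR_ge0// sqr_ge0.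
  rewrite integral_mkcond; apply: eq_integral => t _; rewrite patchE.
  rewrite (_ : (t \in _) = (0 <= t)); last by rewrite mem_setE in_itv/= andbT.
  case: ifPn => t0; last first.
    by rewrite /phi max_l ?mul0r ?mul0e// ltW// ltNge.
  rewrite (_ : [set x | D (x, t)] = `[- t, t]%classic); last first.
    by apply/seteqP; split=> r; rewrite /D/= !in_itv/= andbT subr_ge0 -ler_norml.
  rewrite lebesgue_measure_itv/= lte_fin /phi max_r//.
  have [t1|t1] := ltP (- t) t; rewrite -?EFinB -!EFinM; congr EFin; first ring.
  have -> : t = 0 by lra.
  ring.
- by move=> r; rewrite mulr_ge0 ?expR_ge0// sqr_ge0.
- move=> r; apply: cvgM; first exact: exprn_continuous.
  exact: continuous_gauss_fun.
- by move=> r /=; rewrite !sqrrN.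
Qed.

Lemma gauss_odd_part (a : R) :
  (\int[mu]_r (Num.max 0 (a * r) * expR (- r ^+ 2))%:E =
   \int[mu]_r (Num.max 0 (- (a * r)) * expR (- r ^+ 2))%:E)%E.
Proof.
pose g (b : R) (r : measurableTypeR R) := (Num.max 0 (b * r) * expR (- r ^+ 2))%:E.
rewrite -(@ge0_integral_affine _ (-1) 0 (g a)).
- rewrite normrN1 mul1e; apply: eq_integral => r _.
  by rewrite /g addr0 mulN1r mulrN sqrrN.
- by rewrite oppr_eq0 oner_eq0.
- apply/measurable_EFinP; apply: measurable_funM; last exact: measurable_gauss_fun.
  by apply: measurable_maxr => //; exact: measurable_funM.
- by move=> r; rewrite lee_fin mulr_ge0 ?expR_ge0// le_max lexx.
Qed.

End normal_moments.

Section normal_law.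
Context d (T : measurableType d) (R : realType) (P : probability T R).
Notation mu := (@lebesgue_measure R).

Variables (Y : T -> R) (m s : R).
Hypothesis mY : measurable_fun setT Y.
Hypothesis s0 : 0 <= s.
Hypothesis lawY : forall A : set (measurableTypeR R), measurable A ->
  P (Y @^-1` A) = normal_law m s A.

(** With the substitution [t = sqrt 2 * s * r + m] nothing is divided by [s], so the same formula
    covers the point mass [s = 0], for which both sides are [g m]. *)
Lemma integral_normal_law (g : R -> R) : measurable_fun setT g -> (forall t, 0 <= g t) ->
  (\int[P]_w (g (Y w))%:E = (Num.sqrt pi)^-1%:E *
   \int[mu]_r (g (Num.sqrt 2 * s * r + m) * expR (- r ^+ 2))%:E)%E.
Proof.
move=> mg g0; have pi0 : 0 < Num.sqrt (pi : R) by rewrite sqrtr_gt0 pi_gt0.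
have mgY : measurable_fun setT (g \o Y) by exact: measurableT_comp.
have [sE|sn0] := eqVneq s 0.
  transitivity (g m)%:E.
    pose p0 : {measure set (measurableTypeR R) -> \bar R} :=
      pushforward P (Y : T -> measurableTypeR R).
    pose p := p0 mY.
    transitivity (\int[p]_t (g t)%:E)%E.
      rewrite [RHS]ge0_integral_pushforward//= ?preimage_setT//.
        exact/measurable_EFinP.
      by move=> t _; rewrite lee_fin.
    transitivity (\int[\d_(m : measurableTypeR R)]_t (g t)%:E)%E.
      apply: eq_measure_integral => A mA _.
      by rewrite /p/= /pushforward lawY// /normal_law sE eqxx.
    rewrite integral_dirac//; last exact/measurable_EFinP.
    have -> : \d_(m : measurableTypeR R) [set: measurableTypeR R] = 1%E :> \bar R.
      exact: diracT.
    by rewrite mul1e.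
  have -> : (\int[mu]_r (g (Num.sqrt 2 * s * r + m) * expR (- r ^+ 2))%:E =
      \int[mu]_r ((g m)%:E * (gauss_fun r)%:E))%E.
    by apply: eq_integral => r _; rewrite sE mulr0 mul0r add0r EFinM.
  rewrite ge0_integralZl//.
  - by rewrite (@integralT_gauss R) -!EFinM mulrCA mulVf ?mulr1// gt_eqF.
  - by apply/measurable_EFinP; exact: measurable_gauss_fun.
  - by move=> r _; rewrite lee_fin expR_ge0.
  - by rewrite lee_fin.
have sgt0 : 0 < s by rewrite lt_def sn0.
pose a := Num.sqrt 2 * s.
have a0 : 0 < a by rewrite mulr_gt0// sqrtr_gt0.
pose X : {RV P >-> R} := HB.pack (g \o Y) (@isMeasurableFun.Build _ _ _ _ _ mgY).
have mpdf := @measurable_normal_pdf R m s.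
transitivity (\int[mu]_t ((normal_pdf m s t)%:E * (g t)%:E))%E.
  transitivity ('E_P[X])%E; first by rewrite expectation_def.
  (* [E g(Y)] is the integral of [P(g(Y) > r)] over [r >= 0]. *)
  rewrite ge0_expectation_ccdf => [|w]; last exact: g0.
  pose D : set (measurableTypeR R * measurableTypeR R) :=
    (`[0, +oo[ `*` setT) `&` (fun p => g p.2 - p.1) @^-1` `]0, +oo[.
  have mD : measurable D.
    apply: measurableI; first by apply: measurableX => //; exact: measurable_itv.
    have mf : measurable_fun setT
        (fun p : measurableTypeR R * measurableTypeR R => g p.2 - p.1).
      apply: (@measurable_funB _ _ R setT
        (fun p : measurableTypeR R * measurableTypeR R => g p.2) fst).
        by apply: (measurableT_comp mg); exact: measurable_snd.
      exact: measurable_fst.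
    by rewrite -[X in measurable X]setTI; apply: mf => //; exact: measurable_itv.
  have mphi : measurable_fun setT (fun t : measurableTypeR R => (normal_pdf m s t)%:E).
    exact/measurable_EFinP.
  have phi0 t : (0 <= (normal_pdf m s t)%:E)%E by rewrite lee_fin normal_pdf_ge0.
  transitivity (\int[mu]_r \int[mu]_(t in [set t | D (r, t)]) (normal_pdf m s t)%:E)%E.
    rewrite integral_mkcond; apply: eq_integral => r _; rewrite patchE.
    rewrite (_ : (r \in _) = (0 <= r)); last by rewrite mem_setE in_itv/= andbT.
    case: ifPn => r0; last first.
      rewrite (_ : [set t | D (r, t)] = set0) ?integral_set0//.
      by apply/seteqP; split=> // t; rewrite /D/= !in_itv/= (negbTE r0) => -[[]].
    have mA : measurable (g @^-1` `]r, +oo[).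
      by rewrite -[X in measurable X]setTI; apply: mg => //; exact: measurable_itv.
    rewrite /ccdf /distribution /pushforward/= (lawY mA) /normal_law (negbTE sn0) /normal_prob.
    congr integral; apply/seteqP; split=> t; rewrite /D/= !in_itv/= !andbT subr_gt0.
      by move=> rt; split; [split|].
    by case.
  rewrite tonelli_set//; apply: eq_integral => t _; congr (_ * _)%E.
  rewrite (_ : [set r | D (r, t)] = `[0, g t[%classic); last first.
    apply/seteqP; split=> r; rewrite /D/= !in_itv/= !andbT subr_gt0.
      by move=> [[-> _] ->].
    by move=> /andP[-> ->].
  rewrite -[LHS]/(mu `[0, g t[%classic) lebesgue_measure_itv/= lte_fin; case: ltP => [_|gt0].
    by rewrite oppr0 adde0.
  by congr EFin; apply/eqP; rewrite eq_le gt0 g0.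
rewrite -(@ge0_integral_affine _ a m) ?gt_eqF//; last 2 first.
- by apply: emeasurable_funM; exact/measurable_EFinP.
- by move=> t; rewrite mule_ge0// lee_fin// normal_pdf_ge0.
have maff := @measurable_affine R a m.
rewrite -[RHS]ge0_integralZl//; last 2 first.
- apply/measurable_EFinP; apply: measurable_funM; last exact: measurable_gauss_fun.
  exact: (measurableT_comp mg maff).
- by move=> r _; rewrite lee_fin mulr_ge0 ?expR_ge0.
rewrite -ge0_integralZl//; last 2 first.
- apply: emeasurable_funM; apply/measurable_EFinP.
    exact: (measurableT_comp mpdf maff).
  exact: (measurableT_comp mg maff).
- by move=> t _; rewrite mule_ge0// lee_fin// normal_pdf_ge0.
apply: eq_integral => r _; rewrite -!EFinM; congr EFin.
rewrite normal_pdfE// /normal_fun addrK gtr0_norm//.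
have a2 : a ^+ 2 = s ^+ 2 *+ 2.
  by rewrite /a exprMn sqr_sqrtr// mulrC mulr_natr.
have -> : - (a * r) ^+ 2 / (s ^+ 2 *+ 2) = - r ^+ 2.
  by rewrite exprMn a2; field; rewrite sn0.
have -> : normal_peak s = (a * Num.sqrt pi)^-1.
  rewrite /normal_peak; congr (_^-1); rewrite /a.
  rewrite -mulr_natr mulrAC sqrtrM ?mulr_ge0 ?sqr_ge0//.
  by rewrite mulrC sqrtrM ?sqr_ge0// sqrtr_sqr gtr0_norm// mulrC [s * _]mulrC.
rewrite -/a; field.
by rewrite !gt_eqF.
Qed.

Lemma normal_abs_moment : m = 0 ->
  (\int[P]_w (`|Y w|)%:E = (Num.sqrt (2 / pi) * s)%:E)%E.
Proof.
move=> m0; rewrite (integral_normal_law (g := fun t => `|t|))//.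
have -> : (\int[mu]_r (`|Num.sqrt 2 * s * r + m| * expR (- r ^+ 2))%:E =
    \int[mu]_r (`|Num.sqrt 2 * s|%:E * (`|r| * expR (- r ^+ 2))%:E))%E.
  by apply: eq_integral => r _; rewrite m0 addr0 normrM -mulrA EFinM.
rewrite ge0_integralZl//; last first.
  apply/measurable_EFinP; apply: measurable_funM; last exact: measurable_gauss_fun.
  exact: normr_measurable.
rewrite integral_abs_gauss mule1 -EFinM; congr EFin.
rewrite ger0_norm ?mulr_ge0 ?sqrtr_ge0// sqrtrM// sqrtrV ?pi_ge0//.
ring.
Qed.

Lemma normal_sqr_moment : m = 0 -> (\int[P]_w (Y w ^+ 2)%:E = (s ^+ 2)%:E)%E.
Proof.
move=> m0; rewrite (integral_normal_law (g := fun t => t ^+ 2))//; last first.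
  by move=> t; rewrite sqr_ge0.
have -> : (\int[mu]_r ((Num.sqrt 2 * s * r + m) ^+ 2 * expR (- r ^+ 2))%:E =
    \int[mu]_r (((Num.sqrt 2 * s) ^+ 2)%:E * (r ^+ 2 * expR (- r ^+ 2))%:E))%E.
  by apply: eq_integral => r _; rewrite m0 addr0 exprMn -mulrA EFinM.
rewrite ge0_integralZl//; last 3 first.
- by apply/measurable_EFinP; apply: measurable_funM => //; exact: measurable_gauss_fun.
- by move=> r _; rewrite lee_fin mulr_ge0 ?expR_ge0// sqr_ge0.
- by rewrite lee_fin sqr_ge0.
rewrite integral_sqr_gauss -!EFinM; congr EFin.
have pi0 : 0 < Num.sqrt (pi : R) by rewrite sqrtr_gt0 pi_gt0.
by rewrite exprMn sqr_sqrtr//; field; rewrite gt_eqF.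
Qed.

Lemma normal_integrable : P.-integrable setT (EFin \o Y).
Proof.
apply/integrableP; split; first exact/measurable_EFinP.
rewrite (integral_normal_law (g := fun t => `|t|))//; pose a := Num.sqrt 2 * s.
have pi0 : 0 < Num.sqrt (pi : R) by rewrite sqrtr_gt0 pi_gt0.
apply: lte_mul_pinfty => //.
have mgauss := @measurable_gauss_fun R.
have mr : measurable_fun setT (fun r : R => `|r| * expR (- r ^+ 2)).
  by apply: measurable_funM => //; exact: normr_measurable.
apply: (@le_lt_trans _ _ (\int[mu]_r
  (`|a|%:E * (`|r| * expR (- r ^+ 2))%:E + `|m|%:E * (gauss_fun r)%:E))%E).
  apply: ge0_le_integral => //.
  - apply/measurable_EFinP; apply: measurable_funM => //.
    by apply: (measurableT_comp (@normr_measurable R setT)); exact: measurable_affine.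
  - by apply: emeasurable_funD; apply: emeasurable_funM => //; exact/measurable_EFinP.
  - move=> r _; rewrite -!EFinM -EFinD lee_fin /gauss_fun mulrA -mulrDl.
    by rewrite ler_wpM2r ?expR_ge0// (le_trans (ler_normD _ _))// normrM.
rewrite ge0_integralD//; last 3 first.
- by apply: emeasurable_funM => //; exact/measurable_EFinP.
- by move=> r _; rewrite mule_ge0// lee_fin gauss_fun_ge0.
- by apply: emeasurable_funM => //; exact/measurable_EFinP.
rewrite !ge0_integralZl//; try exact/measurable_EFinP; last first.
  by move=> r _; rewrite lee_fin gauss_fun_ge0.
by rewrite integral_abs_gauss (@integralT_gauss R) -!EFinM ltry.
Qed.

(** By the reflection [r -> - r] the positive and negative parts of [Y - m] have equal, finite
    integrals. This identifies the location parameter, which [gaussian_vector] leaves existential,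
    so that [centered] can force it to be 0. *)
Lemma normal_mean : (\int[P]_w (Y w)%:E = m%:E)%E.
Proof.
have iY := normal_integrable.
have im : P.-integrable setT (cst m%:E) by exact: finite_measure_integrable_cst.
have iYm := integrableB measurableT iY im.
have mg b : measurable_fun setT (fun t : R => Num.max 0 (b * (t - m))).
  apply: measurable_maxr => //; apply: measurable_funM => //.
  exact: measurable_funB.
pose a := Num.sqrt 2 * s.
have pn b : (\int[P]_w (Num.max 0 (b * (Y w - m)))%:E = (Num.sqrt pi)^-1%:E *
    \int[mu]_r (Num.max 0 (b * a * r) * expR (- r ^+ 2))%:E)%E.
  rewrite (integral_normal_law (mg b)) => [|t]; last by rewrite le_max lexx.
  by congr (_ * _)%E; apply: eq_integral => r _; rewrite addrK mulrA.
have : (\int[P]_w ((Y w)%:E - m%:E) = 0)%E.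
  rewrite integralE.
  rewrite (_ : (\int[P]_w _^\+ w)%E = (\int[P]_w (Num.max 0 (1 * (Y w - m)))%:E)%E); last first.
    apply: eq_integral => w _; by rewrite funeposE/= mul1r EFin_max EFinB maxC.
  rewrite (_ : (\int[P]_w _^\- w)%E = (\int[P]_w (Num.max 0 (-1 * (Y w - m)))%:E)%E); last first.
    apply: eq_integral => w _; by rewrite funenegE/= mulN1r EFin_max EFinN EFinB maxC.
  have pE := pn 1; have nE := pn (-1).
  have -> : (\int[P]_w (Num.max 0 (-1 * (Y w - m)))%:E =
      \int[P]_w (Num.max 0 (1 * (Y w - m)))%:E)%E.
    rewrite pE nE; congr (_ * _)%E; rewrite mul1r [RHS]gauss_odd_part.
    by apply: eq_integral => r _; rewrite !mulN1r mulNr.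
  apply: subee; have := integrable_fin_num measurableT (integrable_funepos measurableT iYm).
  congr (_ \is a fin_num); apply: eq_integral => w _.
  by rewrite funeposE/= -EFinB -EFin_max mul1r maxC.
rewrite integralB// integral_cst//.
rewrite [X in (_ * X)%E](_ : _ = 1%E); last exact: probability_setT.
rewrite mule1 => /eqP.
rewrite sube_eq ?add0e => [/eqP//||].
  exact: integrable_fin_num.
by rewrite fin_num_adde_defl.
Qed.

End normal_law.

(** * Gaussian vectors through their one-dimensional projections *)

Section gaussian_vectors.
Context d (T : measurableType d) (R : realType) (P : probability T R) (n : nat).
Variables (X : {RV P >-> 'rV[R]_n}) (S : 'M[R]_n).
Hypothesis X_gaussian : gaussian_vector X.
Hypothesis X_centered : centered X.
Hypothesis X_cov : covariance_matrix X S.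
Hypothesis S_unit : S \in unitmx.
Notation dot := (quad 1%:M).

Lemma measurable_RV_coord j : measurable_fun setT (fun w => X w 0 j).
Proof. exact: (measurableT_comp (measurable_rV_coord j) (measurable_funPT X)). Qed.

Lemma measurable_dot u : measurable_fun setT (fun w => dot (X w) u).
Proof.
rewrite (_ : (fun w => _) = fun w => \sum_j X w 0 j * u 0 j); last first.
  by apply/funext => w; rewrite quad1E.
apply: measurable_sum => j; apply: measurable_funM => //.
exact: measurable_RV_coord.
Qed.

Lemma dot_law u : exists m s : R, 0 <= s /\
  forall A : set (measurableTypeR R), measurable A ->
    P ((fun w => dot (X w) u) @^-1` A) = normal_law m s A.
Proof.
have [m [s [s0 H]]] := X_gaussian u; exists m, s; split=> // A mA.
rewrite (_ : (fun w => dot (X w) u) = fun w => \sum_j u 0 j * X w 0 j); first exact: H.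
by apply/funext => w; rewrite quad1E; apply: eq_bigr => j _; rewrite mulrC.
Qed.

Lemma dot_delta (x : 'rV[R]_n) j : dot x (delta_mx 0 j) = x 0 j.
Proof. by rewrite quad_delta mulmx1. Qed.

Lemma gaussian_integrable j : P.-integrable setT (fun w => (X w 0 j)%:E).
Proof.
have [m [s [s0 H]]] := dot_law (delta_mx 0 j).
have := normal_integrable (measurable_dot (delta_mx 0 j)) s0 H.
apply: eq_integrable => // w _; by rewrite /= dot_delta.
Qed.

Lemma gaussian_mean0 j : (\int[P]_w (X w 0 j)%:E = 0)%E.
Proof. by have := X_centered j; rewrite unlock. Qed.

Lemma dot_mean0 u : (\int[P]_w (dot (X w) u)%:E = 0)%E.
Proof.
transitivity (\int[P]_w \sum_j ((u 0 j)%:E * (X w 0 j)%:E))%E.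
  apply: eq_integral => w _; rewrite quad1E -sumEFin; apply: eq_bigr => j _.
  by rewrite EFinM muleC.
rewrite integral_sum//; last first.
  by move=> j; apply: integrableZl => //; exact: gaussian_integrable.
rewrite big1// => j _; rewrite integralZl//; last exact: gaussian_integrable.
by rewrite gaussian_mean0 mule0.
Qed.

Lemma dot_centered_law u : exists s : R, 0 <= s /\
  forall A : set (measurableTypeR R), measurable A ->
    P ((fun w => dot (X w) u) @^-1` A) = normal_law 0 s A.
Proof.
have [m [s [s0 H]]] := dot_law u.
have := normal_mean (measurable_dot u) s0 H; rewrite dot_mean0 => -[m0].
by exists s; split=> // A mA; rewrite m0; exact: H.
Qed.

Lemma gaussian_sqr_integrable j : P.-integrable setT (fun w => (X w 0 j ^+ 2)%:E).
Proof.
have [s [s0 H]] := dot_centered_law (delta_mx 0 j).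
have := normal_sqr_moment (measurable_dot (delta_mx 0 j)) s0 H erefl.
move=> E2; apply/integrableP; split.
  by apply/measurable_EFinP; apply: measurable_funX; exact: measurable_RV_coord.
under eq_integral do rewrite gee0_abs ?lee_fin ?sqr_ge0// -dot_delta.
by rewrite E2 ltry.
Qed.

Lemma gaussian_prod_integrable i j :
  P.-integrable setT (fun w => (X w 0 i * X w 0 j)%:E).
Proof.
apply: (le_integrable measurableT _ _
  (integrableD measurableT (gaussian_sqr_integrable i) (gaussian_sqr_integrable j))).
  by apply/measurable_EFinP; apply: measurable_funM; exact: measurable_RV_coord.
move=> w _; rewrite -EFinD !abse_EFin lee_fin normrM.
rewrite [leRHS]ger0_norm ?addr_ge0 ?sqr_ge0//.
rewrite -(real_normK (num_real (X w 0 i))) -(real_normK (num_real (X w 0 j))).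
have := sqr_ge0 (`|X w 0 i| - `|X w 0 j|).
have := normr_ge0 (X w 0 i); have := normr_ge0 (X w 0 j); nra.
Qed.

Lemma gaussian_covE i j : (\int[P]_w (X w 0 i * X w 0 j)%:E = (S i j)%:E)%E.
Proof.
rewrite -X_cov covariance.unlock (X_centered i) (X_centered j) expectation.unlock.
by apply: eq_integral => w _; rewrite !fctE /= !subr0.
Qed.

Lemma dot_sqr u : (\int[P]_w (dot (X w) u ^+ 2)%:E = (quad S u u)%:E)%E.
Proof.
transitivity (\int[P]_w \sum_i \sum_j ((u 0 i * u 0 j)%:E * (X w 0 i * X w 0 j)%:E))%E.
  apply: eq_integral => w _; rewrite quad1E expr2 mulr_suml -sumEFin.
  apply: eq_bigr => i _; rewrite mulr_sumr -sumEFin; apply: eq_bigr => j _.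
  by rewrite -EFinM; congr EFin; ring.
have iij i j : P.-integrable setT (fun w => ((u 0 i * u 0 j)%:E * (X w 0 i * X w 0 j)%:E)%E).
  by apply: integrableZl => //; exact: gaussian_prod_integrable.
rewrite integral_sum//; last by move=> i; apply: integrable_sum.
transitivity (\sum_i \sum_j (u 0 i * u 0 j * S i j)%:E)%E.
  apply: eq_bigr => i _; rewrite integral_sum//; apply: eq_bigr => j _.
  by rewrite integralZl ?gaussian_covE//; exact: gaussian_prod_integrable.
rewrite /quad mxE -sumEFin exchange_big; apply: eq_bigr => j _ /=.
rewrite !mxE mulr_suml -sumEFin; apply: eq_bigr => i _; congr EFin; ring.
Qed.

(** The form is nonnegative because [quad S u u] is a second moment. A vector on which it vanishes
    is then orthogonal to everything, hence in the kernel of the invertible [S]. *)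
Lemma gaussian_posdef : posdef S.
Proof.
have Ssym : S^T = S.
  apply/matrixP => i j; rewrite mxE; apply: EFin_inj.
  by rewrite -!X_cov covarianceC.
have S0 u : 0 <= quad S u u.
  have [s [s0 H]] := dot_centered_law u.
  have := normal_sqr_moment (measurable_dot u) s0 H erefl; rewrite dot_sqr => -[->].
  exact: sqr_ge0.
split=> // u u0; rewrite lt_def S0 andbT; apply: contra_neq u0 => qu.
have q0 v : quad S u v = 0.
  (* Chosen so that the form takes the value -1 at [t *: u + v], where it equals
     [2 * t * quad S u v + quad S v v]. *)
  apply/eqP/negPn/negP => b0; pose t := - (quad S v v + 1) / (2 * quad S u v).
  have := S0 (t *: u + v).
  rewrite !(quadDl, quadDr, quadZl, quadZr) qu (quadC v u Ssym).
  have -> : t * (t * 0) + t * quad S u v + (t * quad S u v + quad S v v) = -1.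
    by rewrite /t; field.
  by rewrite oppr_ge0 ler10.
rewrite -[u](mulmxK S_unit) (_ : u *m S = 0) ?mul0mx//.
by apply/rowP => j; rewrite -quad_delta q0 mxE.
Qed.

Lemma dot_abs u :
  (\int[P]_w (`|dot (X w) u|)%:E = (Num.sqrt (2 / pi) * Num.sqrt (quad S u u))%:E)%E.
Proof.
have [s [s0 H]] := dot_centered_law u.
rewrite (normal_abs_moment (measurable_dot u) s0 H erefl).
have := normal_sqr_moment (measurable_dot u) s0 H erefl; rewrite dot_sqr => -[->].
by rewrite sqrtr_sqr ger0_norm.
Qed.

End gaussian_vectors.

(** * Discretisation of random vectors *)

Section grid.
Context {R : realType}.
Variable m : nat.
Notation M := (m.+1%:R : R).
(** The number of steps of length [M^-1] in [[-M, M]]. *)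
Notation N := (2 * (m.+1 * m.+1))%N.

(* Reals are rounded down to the mesh [M^-1] and clipped to [[-M, M]]. *)
Definition grid_trunc (t : R) : nat := minn (Num.truncn ((t + M) * M)) N.
Definition grid_idx1 (t : R) : 'I_N.+1 := inord (grid_trunc t).
Definition grid_val1 (j : 'I_N.+1) : R := j%:R / M - M.
Definition grid_round1 (t : R) : R := grid_val1 (grid_idx1 t).

Lemma grid_idx1E t : grid_idx1 t = grid_trunc t :> nat.
Proof. by rewrite inordK// ltnS geq_minr. Qed.

Lemma measurable_grid_trunc k :
  measurable ([set t | grid_trunc t = k] : set (measurableTypeR R)).
Proof.
have mge i : measurable ([set t | (i <= grid_trunc t)%N] : set (measurableTypeR R)).
  case: i => [|i]; first by rewrite (_ : mkset _ = setT)//; apply/seteqP; split.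
  have [iN|Ni] := leqP i.+1 N; last first.
    rewrite (_ : mkset _ = set0)//; apply/seteqP; split=> // t /=.
    by rewrite /grid_trunc leq_min [X in _ && X]leqNgt Ni andbF.
  have maff := @measurable_affine R M (M * M).
  rewrite (_ : mkset _ = setT `&`
      (fun t : measurableTypeR R => M * t + M * M) @^-1` `[i.+1%:R, +oo[).
    by apply: maff => //; exact: measurable_itv.
  apply/seteqP; split=> t; rewrite /= in_itv/= andbT /grid_trunc leq_min iN andbT;
    rewrite truncn_gt_nat mulrDl [t * _]mulrC//.
  by case.
rewrite (_ : mkset _ = [set t | (k <= grid_trunc t)%N] `\` [set t | (k.+1 <= grid_trunc t)%N]).
  exact: measurableD.
apply/seteqP; split=> t /=; first by move=> ->; rewrite leqnn ltnn.
by move=> [kt /negP]; rewrite -leqNgt => tk; apply/eqP; rewrite eqn_leq tk.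
Qed.

(** The first bound, valid for every [t], provides domination; the second provides pointwise
    convergence once [M] exceeds [|t|]. *)
Lemma grid_round1P t :
  `|grid_round1 t| <= `|t| + 1 /\ (`|t| < M -> `|grid_round1 t - t| <= M^-1).
Proof.
have M0 : 0 < M by [].
have M1 : 1 <= M by rewrite ler1n.
rewrite /grid_round1 /grid_val1 grid_idx1E /grid_trunc.
have NE : N%:R = 2 * (M * M) :> R by rewrite !natrM.
have [tM|tM] := ltP t (- M).
  have -> : Num.truncn ((t + M) * M) = 0%N.
    by apply/eqP; rewrite -leqn0 leqNgt truncn_gt_nat -ltNge; nra.
  rewrite min0n mul0r sub0r normrN; split; last by rewrite ltr_norml; lra.
  by rewrite (ger0_norm (ltW M0)) ler0_norm; lra.
have [Mt|Mt] := leP M t.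
  rewrite (minn_idPr _); last first.
    have x0 : 0 <= (t + M) * M by apply: mulr_ge0; lra.
    by rewrite truncn_ge_nat// NE; nra.
  rewrite NE -mulrA mulfK ?gt_eqF// (_ : 2 * M - M = M); last ring.
  split; last by rewrite ltr_norml; lra.
  by rewrite (ger0_norm (ltW M0)) ger0_norm; lra.
have x0 : 0 <= (t + M) * M by apply: mulr_ge0; lra.
rewrite (minn_idPl _); last first.
  rewrite -ltnS truncn_lt_nat//; apply: (@lt_trans _ _ N%:R); last by rewrite ltr_nat.
  by rewrite NE; nra.
have /andP[] := truncn_itv x0; rewrite -[(Num.truncn _).+1%:R]natr1.
set k := (Num.truncn _)%:R => k1 k2.
have Mn0 : M != 0 by rewrite gt_eqF.
have {}k1 : k / M <= t + M by rewrite ler_pdivrMr.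
have {}k2 : t + M < k / M + M^-1.
  by rewrite -(ltr_pM2r M0) [X in _ < X]mulrDl divfK// mulVf.
have kM : - M^-1 <= k / M - M - t <= 0.
  by move: (k / M) (M^-1) M k1 k2 => r i M' k1 k2; apply/andP; split; lra.
have -> : k / M - M = t + (k / M - M - t) by ring.
have Mi : M^-1 <= 1 by rewrite invf_le1.
move: (k / M - M - t) (M^-1) kM Mi => r i /andP[r1 r2] i1.
split; last by move=> _; rewrite addrC addKr ler_norml; apply/andP; split; lra.
apply: le_trans (ler_normD _ _) _; rewrite lerD2l ler_norml.
by apply/andP; split; lra.
Qed.

Variable n : nat.

Definition grid_idx (x : 'rV[R]_n) : {ffun 'I_n -> 'I_N.+1} :=
  [ffun c => grid_idx1 (x 0 c)].
Definition grid_val (j : {ffun 'I_n -> 'I_N.+1}) : 'rV[R]_n :=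
  \row_c grid_val1 (j c).
Definition grid_round (x : 'rV[R]_n) : 'rV[R]_n := grid_val (grid_idx x).

Lemma grid_roundE x c : grid_round x 0 c = grid_round1 (x 0 c).
Proof. by rewrite /grid_round mxE ffunE. Qed.

Lemma measurable_grid_idx j : measurable [set x : 'rV[R]_n | grid_idx x = j].
Proof.
rewrite (_ : mkset _ = box (fun c => [set t | grid_trunc t = j c])).
  by apply: measurable_box => c; exact: measurable_grid_trunc.
apply/seteqP; split=> x.
  by move=> /= <- c; rewrite /= ffunE grid_idx1E.
move=> xj; apply/ffunP => c; rewrite ffunE; apply: val_inj => /=.
by rewrite grid_idx1E; exact: xj.
Qed.

End grid.

Section l1norm.
Context {R : realType} {n : nat}.

Definition l1norm (x : 'rV[R]_n) : R := \sum_c `|x 0 c|.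

Lemma l1norm_ge0 x : 0 <= l1norm x.
Proof. exact: sumr_ge0. Qed.

Lemma l1normD x y : l1norm (x + y) <= l1norm x + l1norm y.
Proof.
by rewrite /l1norm -big_split ler_sum// => c _; rewrite mxE ler_normD.
Qed.

Lemma l1normN x : l1norm (- x) = l1norm x.
Proof. by apply: eq_bigr => c _; rewrite mxE normrN. Qed.

Lemma l1norm_grid_round m x : l1norm (grid_round m x) <= l1norm x + n%:R.
Proof.
have -> : n%:R = \sum_(c < n) 1 :> R by rewrite sumr_const card_ord.
rewrite /l1norm -big_split/=.
by rewrite ler_sum// => c _; rewrite grid_roundE; exact: (grid_round1P m _).1.
Qed.

Lemma grid_round_cvg (x : 'rV[R]_n) c : grid_round m x 0 c @[m --> \oo] --> x 0 c.
Proof.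
apply/cvgrPdist_le => e e0; near=> m.
rewrite distrC grid_roundE; apply: le_trans ((grid_round1P m (x 0 c)).2 _) _.
  apply: (@lt_le_trans _ _ m%:R); last by rewrite ler_nat.
  by near: m; exact: nbhs_infty_gtr.
have : `|(0 : R) - harmonic m| <= e.
  by near: m; move: e e0; apply/cvgrPdist_le; exact: cvg_harmonic.
by rewrite sub0r normrN ger0_norm ?harmonic_ge0.
Unshelve. all: by end_near. Qed.

End l1norm.

Section finite_valued.
Context d (T : measurableType d) (R : realType) (P : probability T R).
Variables (J : finType) (Z : T -> J).
Hypothesis mZ : forall j, measurable [set w | Z w = j].

Lemma finite_valued_sum (G : J -> R) w :
  G (Z w) = \sum_j G j * \1_[set w | Z w = j] w.
Proof.
rewrite (bigD1 (Z w))//= big1 ?addr0 => [|j jZ].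
  by rewrite indicE mem_set// mulr1.
by rewrite indicE memNset ?mulr0//= => Zj; rewrite Zj eqxx in jZ.
Qed.

Lemma measurable_finite_valued (G : J -> R) : measurable_fun setT (fun w => G (Z w)).
Proof.
rewrite (_ : (fun w => _) = fun w => \sum_j G j * \1_[set w | Z w = j] w).
  by apply: measurable_sum => j; apply: measurable_funM.
by apply/funext => w; exact: finite_valued_sum.
Qed.

Lemma integral_finite_valued (G : J -> R) :
  (\int[P]_w (G (Z w))%:E = (\sum_j fine (P [set w | Z w = j]) * G j)%:E)%E.
Proof.
transitivity (\int[P]_w \sum_j ((G j)%:E * (\1_[set w | Z w = j] w)%:E))%E.
  by apply: eq_integral => w _; rewrite finite_valued_sum -sumEFin.
rewrite integral_sum// => [|j]; last by apply: integrableZl => //; exact: integrable_indic.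
rewrite -sumEFin; apply: eq_bigr => j _.
rewrite integralZl//; last exact: integrable_indic.
rewrite integral_indic// setIT EFinM muleC; congr (_ * _)%E.
by rewrite fineK// fin_num_measure.
Qed.

End finite_valued.

Section grid_approximation.
Context d (T : measurableType d) (R : realType) (P : probability T R) (n : nat).
Variable X : T -> 'rV[R]_n.
Hypothesis mX : measurable_fun setT X.
Hypothesis X_integrable : forall j, P.-integrable setT (fun w => (X w 0 j)%:E).
Notation dot := (quad 1%:M).

Definition grid_prob m (j : {ffun 'I_n -> 'I_(2 * (m.+1 * m.+1)).+1}) : R :=
  fine (P [set w | grid_idx m (X w) = j]).

Lemma grid_prob_ge0 m j : 0 <= @grid_prob m j.
Proof. by rewrite fine_ge0. Qed.

Lemma measurable_grid_idx_fiber m j : measurable [set w | grid_idx m (X w) = j].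
Proof.
have := mX measurableT (@measurable_grid_idx R m n j); rewrite setTI; exact.
Qed.

Lemma integral_grid_round m (G : 'rV[R]_n -> R) :
  (\int[P]_w (G (grid_round m (X w)))%:E =
   (\sum_j grid_prob j * G (@grid_val R m n j))%:E)%E.
Proof.
exact: (integral_finite_valued P (@measurable_grid_idx_fiber m) (G \o @grid_val R m n)).
Qed.

Lemma measurable_grid_round_comp m (G : 'rV[R]_n -> R) :
  measurable_fun setT (fun w => G (grid_round m (X w))).
Proof.
exact: (measurable_finite_valued (@measurable_grid_idx_fiber m) (G \o @grid_val R m n)).
Qed.

Lemma integrable_l1norm : P.-integrable setT (fun w => (l1norm (X w))%:E).
Proof.
apply: (eq_integrable _ (fun w => \sum_c `|(X w 0 c)%:E|)%E) => //.
  by move=> w _; rewrite /l1norm -sumEFin.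
by apply: integrable_sum => // c _; exact: (integrable_abse (X_integrable c)).
Qed.

Definition grid_err m (w : T) : R := l1norm (grid_round m (X w) - X w).

Lemma measurable_coord c : measurable_fun setT (fun w => X w 0 c).
Proof. exact: (measurableT_comp (measurable_rV_coord c) mX). Qed.

Lemma measurable_grid_err m : measurable_fun setT (grid_err m).
Proof.
apply: measurable_sum => c; apply: measurableT_comp => //.
apply: (eq_measurable_fun (fun w => grid_round m (X w) 0 c - X w 0 c)).
  by move=> w _; rewrite !mxE.
apply: measurable_funB; last exact: measurable_coord.
exact: (measurable_grid_round_comp m (fun x => x 0 c)).
Qed.

Lemma grid_err_le m w : grid_err m w <= 2 * l1norm (X w) + n%:R.
Proof.
apply: le_trans (l1normD _ _) _; rewrite l1normN.
by have := l1norm_grid_round m (X w); lra.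
Qed.

Lemma integrable_grid_err m : P.-integrable setT (fun w => (grid_err m w)%:E).
Proof.
apply: (le_integrable measurableT _ _ (integrableD measurableT
  (integrableZl measurableT 2 integrable_l1norm)
  (finite_measure_integrable_cst P n%:R measurableT))).
  by apply/measurable_EFinP; exact: measurable_grid_err.
move=> w _; rewrite -EFinM -EFinD !abse_EFin lee_fin.
rewrite [leLHS]ger0_norm ?l1norm_ge0// (le_trans (grid_err_le _ _))//.
exact: ler_norm.
Qed.

Lemma grid_err_cvg : \int[P]_w grid_err m w @[m --> \oo] --> (0 : R).
Proof.
have ig := integrableD measurableT
  (integrableZl measurableT 2 integrable_l1norm)
  (finite_measure_integrable_cst P n%:R measurableT).
have [] := @dominated_convergence _ _ _ P setT measurableT
  (fun m w => (grid_err m w)%:E) (cst 0%E) _ _ _ _ ig _.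
- by move=> m; apply/measurable_EFinP; exact: measurable_grid_err.
- exact: measurable_cst.
- apply: aeW => w _; apply: cvg_EFin; first by near=> m.
  rewrite /comp/= (_ : 0 = \sum_(c < n) (0 : R)); last by rewrite big1.
  apply: cvg_big => [|c _]; first exact: add_continuous.
  have := @grid_round_cvg R n (X w) c.
  move=> /(cvgB (cvg_cst (X w 0 c))) /cvg_norm.
  rewrite subrr normr0; apply: cvg_trans; apply: near_eq_cvg; near=> m.
  by rewrite !fctE !mxE distrC.
- apply: aeW => w m _; rewrite -EFinM -EFinD abse_EFin lee_fin.
  by rewrite ger0_norm; [exact: grid_err_le|exact: l1norm_ge0].
move=> _ _; rewrite integral0 => /fine_cvgP[_]; exact.
Unshelve. all: by end_near. Qed.

Lemma dot_le_l1norm (x u : 'rV[R]_n) B : (forall c, `|u 0 c| <= B) ->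
  `|dot x u| <= B * l1norm x.
Proof.
move=> uB; rewrite quad1E mulr_sumr; apply: le_trans (ler_norm_sum _ _ _) _.
by apply: ler_sum => c _; rewrite normrM mulrC ler_wpM2r.
Qed.

Lemma integrable_dot (u : 'rV[R]_n) : P.-integrable setT (fun w => (dot (X w) u)%:E).
Proof.
apply: (eq_integrable _ (fun w => \sum_c ((u 0 c)%:E * (X w 0 c)%:E))%E) => //.
  by move=> w _; rewrite quad1E -sumEFin; apply: eq_bigr => c _; rewrite EFinM muleC.
by apply: integrable_sum => // c _; apply: integrableZl.
Qed.

(** The error depends on [u] only through a bound on its coordinates, which makes the comparison of
    support functions uniform in the direction. *)
Lemma grid_dot_close m (u : 'rV[R]_n) B : (forall c, `|u 0 c| <= B) ->
  `|\sum_j grid_prob j * `|dot (@grid_val R m n j) u| - \int[P]_w `|dot (X w) u| |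
  <= B * \int[P]_w grid_err m w.
Proof.
move=> uB; have close w :
    `|dot (grid_round m (X w)) u - dot (X w) u| <= B * grid_err m w.
  rewrite -[- dot _ _]mulN1r -quadZl scaleN1r -quadDl; exact: dot_le_l1norm.
have iB : P.-integrable setT (fun w => (B * grid_err m w)%:E).
  by apply: (integrableZl measurableT B (integrable_grid_err m)).
have mr : measurable_fun setT (fun w => dot (grid_round m (X w)) u).
  exact: (measurable_grid_round_comp m (fun x => dot x u)).
have iX := integrable_dot u.
have mXu : measurable_fun setT (fun w => dot (X w) u).
  by apply/measurable_EFinP; exact: measurable_int iX.
have iXm : P.-integrable setT (fun w => (dot (grid_round m (X w)) u)%:E).
  have : P.-integrable setT (fun w => (dot (grid_round m (X w)) u - dot (X w) u)%:E).
    apply: (le_integrable measurableT _ _ iB).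
      by apply/measurable_EFinP; exact: measurable_funB.
    by move=> w _; rewrite !abse_EFin lee_fin (le_trans (close w))// ler_norm.
  move=> h; have := integrableD measurableT h iX; apply: eq_integrable => // w _.
  by rewrite /= -EFinD subrK.
have -> : \sum_j grid_prob j * `|dot (@grid_val R m n j) u| =
    \int[P]_w `|dot (grid_round m (X w)) u|.
  by rewrite /Rintegral (integral_grid_round m (fun x => `|dot x u|)).
have iN (f : T -> R) : P.-integrable setT (fun w => (f w)%:E) ->
  P.-integrable setT (fun w => (`|f w|)%:E) by exact: integrable_norm.
have iD : P.-integrable setT
    (fun w => (`|dot (grid_round m (X w)) u| - `|dot (X w) u|)%:E).
  by have := integrableB measurableT (iN _ iXm) (iN _ iX); apply: eq_integrable.
rewrite -RintegralB//; [|exact: iN|exact: iN].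
apply: le_trans (le_normr_Rintegral _ _) _ => //.
rewrite -RintegralZl//; last exact: integrable_grid_err.
apply: le_Rintegral => //; first exact: iN.
move=> w _; apply: le_trans (close w); exact: ler_dist_dist.
Qed.

End grid_approximation.

(** * From closeness of support functions to inclusions *)

Section support_sandwich.
Context {R : realType}.
Notation dot := (quad 1%:M).

(* The support function of [szono w] is close to that of [ellipsoid S], in ratio. *)
Definition support_close (J : finType) n (w : J -> 'rV[R]_n) (S : 'M[R]_n) (e : R) :=
  forall u, `|\sum_j `|dot (w j) u| - Num.sqrt (quad S u u)| <=
            e * Num.sqrt (quad S u u).

Lemma support_close_le (J : finType) n (w : J -> 'rV[R]_n) S e e' :
  e <= e' -> support_close w S e -> support_close w S e'.
Proof. by move=> ee' H u; rewrite (le_trans (H u))// ler_wpM2r// sqrtr_ge0. Qed.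

Lemma support_close_sub (J : finType) n (w : J -> 'rV[R]_n) S e x :
  posdef S -> support_close w S e -> e < 1 ->
  ellipsoid S x -> szono w ((1 - e) *: x).
Proof.
move=> pS wS e1 Sx; have e1' : 0 <= 1 - e by lra.
apply: (ellipsoid_sub_szono pS e1') => [u|].
  by have := wS u; rewrite ler_norml => /andP[? ?]; lra.
rewrite quadZl quadZr mulrA -expr2 ler_piMr ?exprn_ge0//.
Qed.

Lemma support_close_sup (J : finType) n (w : J -> 'rV[R]_n) S e x :
  posdef S -> support_close w S e -> 0 <= e ->
  szono w x -> ellipsoid S ((1 + e)^-1 *: x).
Proof.
move=> pS wS e0 wx; have e1' : 0 <= 1 + e by lra.
have e1 : 0 < 1 + e by lra.
have : quad (invmx S) x x <= (1 + e) ^+ 2.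
  apply: (szono_sub_ellipsoid pS e1' _ wx) => u.
  by have := wS u; rewrite ler_norml => /andP[? ?]; lra.
rewrite /ellipsoid/= -/(quad _ _ _) quadZl quadZr mulrA -expr2 exprVn.
by rewrite mulrC ler_pdivrMr ?exprn_gt0// mul1r.
Qed.

(** Equivalence of norms, used to turn the additive error of [grid_dot_close] into one relative to
    the support function of the ellipsoid. *)
Lemma posdef_coord_le n (S : 'M[R]_n) : posdef S ->
  exists2 B, 0 <= B & forall (u : 'rV[R]_n) c, `|u 0 c| <= B * Num.sqrt (quad S u u).
Proof.
move=> pS; exists (\sum_c Num.sqrt (invmx S c c)) => [|u c].
  by apply: sumr_ge0 => c _; exact: sqrtr_ge0.
apply: (@le_trans _ _ (Num.sqrt (invmx S c c) * Num.sqrt (quad S u u))); last first.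
  by rewrite ler_wpM2r ?sqrtr_ge0// (bigD1 c)//= lerDl sumr_ge0.
have -> : u 0 c = quad S u (delta_mx 0 c *m invmx S).
  rewrite /quad trmx_mul trmx_inv (proj1 pS) mulmxA mulmxK ?posdef_unitmx//.
  by rewrite trmx_delta -colE mxE.
have := quad_CauchySchwarz u (delta_mx 0 c *m invmx S) pS.
rewrite quad_invmx// quad_delta -rowE mxE => h.
have Scc : 0 <= invmx S c c.
  have := quad_posdef_ge0 (delta_mx 0 c) (posdef_invmx pS).
  by rewrite quad_delta -rowE mxE.
rewrite -sqrtr_sqr -sqrtrM// ler_sqrt ?mulr_ge0 ?quad_posdef_ge0//.
by rewrite mulrC.
Qed.

End support_sandwich.

Section grid_zonotope.
Context d (T : measurableType d) (R : realType) (P : probability T R) (n : nat).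
Variable (X : T -> 'rV[R]_n) (S : 'M[R]_n) (c0 : R).
Hypothesis mX : measurable_fun setT X.
Hypothesis X_integrable : forall j, P.-integrable setT (fun w => (X w 0 j)%:E).
Hypothesis pS : posdef S.
Hypothesis c0_gt0 : 0 < c0.
Hypothesis X_abs : forall u,
  \int[P]_w `|quad 1%:M (X w) u| = c0 * Num.sqrt (quad S u u).

(** Weighting each grid point by its probability makes the support function of the zonotope the mean
    of [|dot|] for the rounded vector; dividing by [c0] makes the limiting body the ellipsoid
    itself. *)
Definition grid_vec m (j : {ffun 'I_n -> 'I_(2 * (m.+1 * m.+1)).+1}) : 'rV[R]_n :=
  (grid_prob P X j / c0) *: grid_val j.

Lemma grid_vec_close : exists e : nat -> R, [/\ forall m, 0 <= e m,
  e m @[m --> \oo] --> (0 : R) & forall m, support_close (@grid_vec m) S (e m)].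
Proof.
have [B B0 uB] := posdef_coord_le pS.
exists (fun m => B / c0 * \int[P]_w grid_err X m w); split => [m||m u].
- apply: mulr_ge0; first by rewrite divr_ge0// ltW.
  apply: fine_ge0; apply: integral_ge0 => w _; rewrite lee_fin; exact: l1norm_ge0.
- rewrite -[X in _ --> X](mulr0 (B / c0)); apply: cvgMl_tmp.
  exact: grid_err_cvg.
have := grid_dot_close mX X_integrable m (uB u); rewrite X_abs.
set E := \int[P]_w _; set s := Num.sqrt _.
have -> : \sum_j `|quad 1%:M (@grid_vec m j) u| =
    c0^-1 * \sum_j grid_prob P X j * `|quad 1%:M (@grid_val R m n j) u|.
  rewrite mulr_sumr; apply: eq_bigr => j _; rewrite /grid_vec quadZl normrM.
  rewrite ger0_norm ?divr_ge0 ?grid_prob_ge0 ?(ltW c0_gt0)//.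
  by rewrite mulrAC mulrC.
move: (\sum_j _) => r h.
have -> : c0^-1 * r - s = c0^-1 * (r - c0 * s).
  by rewrite mulrBr mulKf ?gt_eqF.
rewrite normrM ger0_norm ?invr_ge0 ?(ltW c0_gt0)// [leLHS]mulrC ler_pdivrMr//.
by apply: le_trans h _; rewrite le_eqVlt; apply/orP; left; apply/eqP; field;
  rewrite gt_eqF.
Qed.

End grid_zonotope.

Section mixed_volume_ellipsoids.
Context {R : realType} {n : nat}.
Variables (S : 'I_n -> 'M[R]_n) (J : nat -> finType).
Variables (w : forall m, 'I_n -> J m -> 'rV[R]_n) (e : nat -> R).
Hypothesis pS : forall i, posdef (S i).
Hypothesis e_ge0 : forall m, 0 <= e m.
Hypothesis e_cvg : e m @[m --> \oo] --> (0 : R).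
Hypothesis wS : forall m i, support_close (@w m i) (S i) (e m).
Notation vol := (@lebesgue_rV R n).

(** [polar_limit] provides at once coefficients for the ellipsoids, which rule out the default value
    of [mixed_volume], and the convergence to them. *)
Lemma zono_coef_cvg_mixed_volume :
  zono_coef (@w m) [ffun i => i] @[m --> \oo] --> mixed_volume (fun i => ellipsoid (S i)).
Proof.
have cK lam : compact (minkowski_comb lam (fun i => ellipsoid (S i))).
  by apply: compact_minkowski_comb => i; exact: compact_ellipsoid.
have volcvg lam : (forall i, 0 <= lam i) ->
    polar (zono_coef (@w m)) lam @[m --> \oo] -->
    fine (vol (minkowski_comb lam (fun i => ellipsoid (S i)))).
  move=> lam0.
  have -> : (fun m => polar (zono_coef (@w m)) lam) =
      fun m => fine (vol (minkowski_comb lam (fun i => szono (@w m i)))).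
    by apply/funext => m; rewrite vol_minkowski_szono.
  have cZ m : compact (minkowski_comb lam (fun i => szono (@w m i))).
    by apply: compact_minkowski_comb => i; exact: compact_szono.
  apply: (@vol_cvg_sandwich R n _ _ e) => //.
  - by apply: compact_measurable_rV; exact: cK.
  - by apply: compact_lebesgue_rV_lty; exact: cK.
  - by move=> m; apply: compact_measurable_rV; exact: cZ.
  - by move=> m; apply: compact_lebesgue_rV_lty; exact: cZ.
  - move=> m x em; apply: minkowski_comb_scale => i y.
    exact: support_close_sub.
  - move=> m x; apply: minkowski_comb_scale => i y.
    exact: support_close_sup.
have [V [Vsym FV Vcvg]] :=
  polar_limit (fun m s f => zono_coef_sym (@w m) s f) volcvg.
have VK : mixed_volume_coefs (fun i => ellipsoid (S i)) V.
  split=> [//|lam lam0]; rewrite -/(polar V lam) -FV// fineK// ge0_fin_numE//.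
  by apply: compact_lebesgue_rV_lty; exact: cK.
by rewrite (mixed_volumeE VK); exact: Vcvg.
Qed.

End mixed_volume_ellipsoids.

(** * Gram determinants *)

Section gram_determinant.
Context {R : realType} {k m : nat}.
Notation dot := (quad 1%:M).

Lemma orthonormal_det n (q : 'M[R]_n) : q *m q^T = 1%:M -> `|\det q| = 1.
Proof.
move=> /(congr1 determinant); rewrite det_mulmx det_tr det1 => qq.
by apply/eqP; rewrite -(@eqrXn2 _ 2)// ?expr1n ?real_normK ?num_real ?expr2 ?qq.
Qed.

(* [y] is an orthonormal basis of the orthogonal complement of the rows of [x];
   completing it to an orthogonal matrix [q], the product of [col_mx x g] with
   [q^T] is block triangular. *)
Lemma det_col_complement (x : 'M[R]_(k, k + m)) :
  exists y : 'M[R]_(m, k + m), y *m y^T = 1%:M /\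
    forall g : 'M[R]_(m, k + m),
      (`|\det (col_mx x g)| = Num.sqrt (\det (x *m x^T)) * `|\det (g *m y^T)|).
Proof.
have p1 : @posdef R (k + m) 1%:M := posdef1.
have [y []] := orthonormal_complement x p1 (leqnn (k + m)); rewrite !mulmx1 => xy yy.
(* [z] is built as a complement of [y] instead of by orthonormalising [x], whose rows may be
   dependent. *)
have [|z []] := @orthonormal_complement R _ 1%:M m y k p1; first by rewrite addnC.
rewrite !mulmx1 => yz zz; exists y; split=> // g.
have zy : z *m y^T = 0 by rewrite -[z]trmxK -trmx_mul yz trmx0.
pose q := col_mx z y.
have qq : q *m q^T = 1%:M.
  by rewrite /q tr_col_mx mul_col_row yy yz zz zy -scalar_mx_block.
have xE : x = x *m z^T *m z.
  have : x *m (q^T *m q) = x by rewrite (mulmx1C qq) mulmx1.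
  by rewrite /q tr_col_mx mul_row_col mulmxDr !mulmxA xy mul0mx addr0.
have -> : \det (x *m x^T) = \det (x *m z^T) ^+ 2.
  by rewrite {1 2}xE trmx_mul mulmxA -[_ *m z *m z^T]mulmxA zz mulmx1 det_mulmx det_tr expr2.
rewrite sqrtr_sqr -normrM -(det_lblock _ (g *m z^T)) -xy -mul_col_row -tr_col_mx.
by rewrite det_mulmx det_tr normrM (orthonormal_det qq) mulr1.
Qed.

(** The support function of a projection is the restriction of the support function to the subspace,
    so a zonotope close to the ball projects to one equally close to the smaller ball. *)
Lemma support_close_mul (J : finType) (w : J -> 'rV[R]_(k + m)) (y : 'M[R]_(m, k + m)) e :
  y *m y^T = 1%:M -> support_close w 1%:M e ->
  support_close (fun j => w j *m y^T) 1%:M e.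
Proof.
move=> yy we u; have := we (u *m y).
have -> : dot (u *m y) (u *m y) = dot u u.
  by rewrite /quad !mulmx1 trmx_mul mulmxA -[u *m _ *m _]mulmxA yy mulmx1.
congr (`|_ - _| <= _); apply: eq_bigr => j _; congr (`|_|).
by rewrite /quad !mulmx1 trmx_mul mulmxA.
Qed.

(** Once the Gram root is factored out, the remaining sum is [m]! / [2 ^+ m] times the volume of the
    projected zonotope, which lies between two dilated balls. The factors [(1 - e) ^+ m] and
    [(1 + e) ^+ m] are the same for all [x], so the bounds can be summed over [x]. *)
Lemma sum_det_col_mx (J : finType) (w : J -> 'rV[R]_(k + m)) e (x : 'M[R]_(k, k + m)) :
  support_close w 1%:M e -> 0 <= e -> e < 1 ->
  (1 - e) ^+ m * (m`!%:R / 2 ^+ m * kappa m * Num.sqrt (\det (x *m x^T))) <=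
  \sum_(g : {ffun 'I_m -> J}) `|\det (col_mx x (\matrix_i w (g i)))| <=
  (1 + e) ^+ m * (m`!%:R / 2 ^+ m * kappa m * Num.sqrt (\det (x *m x^T))).
Proof.
move=> we e0 e1; have [y [yy xy]] := det_col_complement x.
have p1 : @posdef R m 1%:M := posdef1.
have wy := support_close_mul yy we.
set s := Num.sqrt _; have s0 : 0 <= s by exact: sqrtr_ge0.
pose r := \sum_(g : {ffun 'I_m -> J}) `|\det (\matrix_i (w (g i) *m y^T))|.
have -> : \sum_(g : {ffun 'I_m -> J}) `|\det (col_mx x (\matrix_i w (g i)))| = s * r.
  rewrite mulr_sumr; apply: eq_bigr => g _; rewrite xy; congr (_ * `|\det _|).
  by apply/row_matrixP => i; rewrite row_mul !rowK.
have volr := vol_szono (fun j => w j *m y^T); rewrite -/r in volr.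
have [volB k0] := @vol_closed_unit_ball R m.
have mB : measurable (closed_unit_ball : set 'rV[R]_m).
  by apply: compact_measurable_rV; exact: compact_closed_unit_ball.
have mZ : measurable (szono (fun j => w j *m y^T)).
  by apply: compact_measurable_rV; exact: compact_szono.
have e1' : 0 < 1 - e by lra.
have e1p : 0 < 1 + e by lra.
have c0 : 0 < m`!%:R / 2 ^+ m :> R by rewrite divr_gt0 ?exprn_gt0// ltr0n fact_gt0.
have cE : (2 ^+ m / m`!%:R) = (m`!%:R / 2 ^+ m)^-1 :> R by rewrite invf_div.
move: (m`!%:R / 2 ^+ m) c0 cE volr => c c0 -> volr.
have lo : (1 - e) ^+ m * kappa m <= c^-1 * r.
  rewrite -lee_fin EFinM -volB -volr; apply: vol_le_scale => // z.
  by rewrite closed_unit_ballE; exact: support_close_sub.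
have hi : c^-1 * r <= (1 + e) ^+ m * kappa m.
  rewrite mulrC -[leLHS]mulrC -(ler_pdivrMl _ _ (exprn_gt0 m e1p)) -exprVn.
  rewrite -lee_fin EFinM -volB -volr; apply: vol_le_scale => //; rewrite ?invr_gt0// => z.
  by rewrite closed_unit_ballE; exact: support_close_sup.
rewrite ler_pdivlMl// in lo; rewrite ler_pdivrMl// in hi.
apply/andP; split.
  by have := ler_wpM2l s0 lo; apply: le_trans; rewrite le_eqVlt; apply/orP; left; apply/eqP; ring.
by apply: le_trans (ler_wpM2l s0 hi) _; rewrite le_eqVlt; apply/orP; left; apply/eqP; ring.
Qed.

End gram_determinant.

Section zono_coef_split.
Context {R : realType} {k m : nat}.
Variables (J : finType) (w : 'I_(k + m) -> J -> 'rV[R]_(k + m)).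
Variables (w1 : 'I_k -> J -> 'rV[R]_(k + m)) (wb : J -> 'rV[R]_(k + m)).
Hypothesis w_l : forall i, w (lshift m i) = w1 i.
Hypothesis w_r : forall i, w (rshift k i) = wb.

Lemma zono_coef_split :
  zono_coef w [ffun i => i] = 2 ^+ (k + m) / (k + m)`!%:R *
  \sum_(f : {ffun 'I_k -> J}) \sum_(g : {ffun 'I_m -> J})
    `|\det (col_mx (\matrix_i w1 i (f i)) (\matrix_i wb (g i)))|.
Proof.
congr (_ * _).
pose pai (p : {ffun 'I_k -> J} * {ffun 'I_m -> J}) : {ffun 'I_(k + m) -> J} :=
  [ffun i => match fintype.split i with inl a => p.1 a | inr b => p.2 b end].
rewrite (reindex pai)/=; last first.
  exists (fun g : {ffun 'I_(k + m) -> J} =>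
      ([ffun i => g (lshift m i)], [ffun i => g (rshift k i)])) => [[f g] _|g _].
    congr pair; apply/ffunP => i; rewrite !ffunE /=.
      by rewrite (unsplitK (inl i)).
    by rewrite (unsplitK (inr i)).
  apply/ffunP => i; rewrite !ffunE; case: fintype.splitP => a ia; rewrite !ffunE;
    by congr (g _); apply: val_inj.
rewrite -(pair_bigA _ (fun f g => `|\det (\matrix_i
  w ([ffun i0 => i0] i) (pai (f, g) i))|))/=.
apply: eq_bigr => f _; apply: eq_bigr => g _; congr (`|\det _|).
apply/row_matrixP => i; rewrite rowK !ffunE.
case: fintype.splitP => a ia.
  have -> : i = lshift m a by apply: val_inj.
  by rewrite rowKu rowK w_l.
have -> : i = rshift k a by apply: val_inj.
by rewrite rowKd rowK w_r.
Qed.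

(** The value [zono_coef] would take if the zonotope on [wb] were exactly the unit ball. *)
Definition gram_sum : R :=
  2 ^+ (k + m) / (k + m)`!%:R * (m`!%:R / 2 ^+ m * kappa m *
  \sum_(f : {ffun 'I_k -> J})
    Num.sqrt (\det ((\matrix_i w1 i (f i)) *m (\matrix_i w1 i (f i))^T))).

Lemma zono_coef_bounds e : support_close wb 1%:M e -> 0 <= e -> e < 1 ->
  (1 - e) ^+ m * gram_sum <= zono_coef w [ffun i => i] <= (1 + e) ^+ m * gram_sum.
Proof.
move=> we e0 e1; rewrite zono_coef_split /gram_sum.
have c0 : 0 <= 2 ^+ (k + m) / (k + m)`!%:R :> R by rewrite divr_ge0 ?exprn_ge0.
move: (2 ^+ (k + m) / _) c0 => c c0.
rewrite !(mulrCA (_ ^+ m) c) !ler_wpM2l//= !mulr_sumr !ler_sum// => f _.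
  by have /andP[] := sum_det_col_mx (\matrix_i w1 i (f i)) we e0 e1.
by have /andP[] := sum_det_col_mx (\matrix_i w1 i (f i)) we e0 e1.
Qed.

End zono_coef_split.

Section gram_bound.
Context {R : realType} {k n : nat}.

Lemma dot_le_l1norm2 (u v : 'rV[R]_n) : `|quad 1%:M u v| <= l1norm u * l1norm v.
Proof.
rewrite mulrC; apply: dot_le_l1norm => c.
by rewrite /l1norm (bigD1 c)//= lerDl sumr_ge0.
Qed.

(** A crude Hadamard bound, used for domination: in each of the [k]! terms of the Leibniz expansion
    every vector occurs once as a row and once as a column, so the term is at most the product of
    the squared norms. *)
Lemma sqrt_gram_le (x : 'I_k -> 'rV[R]_n) :
  Num.sqrt (\det ((\matrix_i x i) *m (\matrix_i x i)^T)) <=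
  Num.sqrt k`!%:R * \prod_i l1norm (x i).
Proof.
have p0 : 0 <= \prod_i l1norm (x i) by apply: prodr_ge0 => i _; exact: l1norm_ge0.
rewrite -[X in _ * X](ger0_norm p0) -sqrtr_sqr -sqrtrM// ler_sqrt; last first.
  by rewrite mulr_ge0 ?sqr_ge0.
apply: le_trans (ler_norm _) _; apply: le_trans (ler_norm_sum _ _ _) _.
rewrite -card_Sn -sum1_card natr_sum mulr_suml.
rewrite (eq_bigl predT); last by move=> s; rewrite inE.
apply: ler_sum => s _; rewrite normrM normrX normrN1 expr1n !mul1r normr_prod.
rewrite expr2 [X in _ <= _ * X](reindex_inj (@perm_inj _ s)) -big_split/=.
apply: ler_prod => i _; rewrite normr_ge0/=.
have -> : ((\matrix_i x i) *m (\matrix_i x i)^T) i (s i) = quad 1%:M (x i) (x (s i)).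
  by rewrite mxE quad1E; apply: eq_bigr => j _; rewrite !mxE.
exact: dot_le_l1norm2.
Qed.

End gram_bound.

(** * Independence of the rounded vectors and passage to the limit *)

Section independent_grids.
Context d (T : measurableType d) (R : realType) (P : probability T R) (k n : nat).
Variable xi : 'I_k -> {RV P >-> 'rV[R]_n}.
Hypothesis xi_indep : mutually_independent xi.
Hypothesis xi_integrable : forall i j, P.-integrable setT (fun w => (xi i w 0 j)%:E).

Let m_xi i : measurable_fun setT (xi i) := measurable_funPT (xi i).

Lemma grids_law m (j : {ffun 'I_k -> {ffun 'I_n -> 'I_(2 * (m.+1 * m.+1)).+1}}) :
  P [set w | [ffun i => grid_idx m (xi i w)] = j] =
  (\prod_i grid_prob P (xi i) (j i))%:E.
Proof.
have := xi_indep [set: 'I_k]%SET (fun i => @measurable_grid_idx R m n (j i)).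
rewrite (_ : \bigcap_(_ in _) _ = [set w | [ffun i => grid_idx m (xi i w)] = j]).
  move=> ->; rewrite -prodEFin; apply: eq_big => [i|i _]; first by rewrite inE.
  by rewrite /grid_prob fineK// fin_num_measure//; exact: measurable_grid_idx_fiber.
apply/seteqP; split=> w /=.
  by move=> H; apply/ffunP => i; rewrite ffunE; apply: H; rewrite /= inE.
by move=> <- i _ /=; rewrite ffunE.
Qed.

Lemma measurable_grids m (j : {ffun 'I_k -> {ffun 'I_n -> 'I_(2 * (m.+1 * m.+1)).+1}}) :
  measurable [set w | [ffun i => grid_idx m (xi i w)] = j].
Proof.
rewrite (_ : mkset _ = \bigcap_(i in [set: 'I_k]) [set w | grid_idx m (xi i w) = j i]).
  by apply: fin_bigcap_measurable => // i _; exact: measurable_grid_idx_fiber.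
apply/seteqP; split=> w /=; first by move=> <- i _ /=; rewrite ffunE.
by move=> H; apply/ffunP => i; rewrite ffunE; exact: H.
Qed.

Lemma measurable_grids_fun m (G : ('I_k -> 'rV[R]_n) -> R) :
  measurable_fun setT (fun w => G (fun i => grid_round m (xi i w))).
Proof.
have := measurable_finite_valued (@measurable_grids m)
  (fun j => G (fun i => @grid_val R m n (j i))).
apply: eq_measurable_fun => w _; congr G; apply/funext => i.
by rewrite ffunE.
Qed.

Lemma integral_grids m (G : ('I_k -> 'rV[R]_n) -> R) :
  (\int[P]_w (G (fun i => grid_round m (xi i w)))%:E =
   (\sum_(j : {ffun 'I_k -> {ffun 'I_n -> 'I_(2 * (m.+1 * m.+1)).+1}})
     (\prod_i grid_prob P (xi i) (j i)) * G (fun i => @grid_val R m n (j i)))%:E)%E.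
Proof.
have := integral_finite_valued P (@measurable_grids m)
  (fun j => G (fun i => @grid_val R m n (j i))).
have -> : (fun w => (G (fun i => @grid_val R m n
    ([ffun i0 => grid_idx m (xi i0 w)] i)))%:E) =
    fun w => (G (fun i => grid_round m (xi i w)))%:E.
  by apply/funext => w; congr ((G _)%:E); apply/funext => i; rewrite ffunE.
move=> ->; congr EFin; apply: eq_bigr => j _.
by rewrite grids_law.
Qed.

Lemma l1norm_grid_round_cvg (x : 'rV[R]_n) :
  l1norm (grid_round m x) @[m --> \oo] --> l1norm x.
Proof.
apply: cvg_big => [|c _]; first exact: add_continuous.
by apply: cvg_norm; exact: grid_round_cvg.
Qed.

(* Fatou along the finite-valued approximations, for which independence factors
   the expectation. *)
Lemma integrable_prod_l1norm :
  P.-integrable setT (fun w => (\prod_i (l1norm (xi i w) + n%:R))%:E).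
Proof.
pose h (x : 'I_k -> 'rV[R]_n) := \prod_i (l1norm (x i) + n%:R).
have h0 x : 0 <= h x.
  by apply: prodr_ge0 => i _; rewrite addr_ge0// l1norm_ge0.
have l1m i : measurable_fun setT (fun w => l1norm (xi i w)).
  by apply/measurable_EFinP; exact: measurable_int (integrable_l1norm (xi_integrable i)).
(* The [n] in the integrand makes it dominate the norms of all roundings; rounding its own argument
   adds at most another [n]. *)
pose H := \prod_i \int[P]_w (l1norm (xi i w) + (2 * n)%:R).
have hH m : (\int[P]_w (h (fun i => grid_round m (xi i w)))%:E <= H%:E)%E.
  rewrite integral_grids lee_fin /h.
  under eq_bigr do rewrite -big_split/=.
  rewrite -(bigA_distr_bigA (fun i j => grid_prob P (xi i) j *
    (l1norm (@grid_val R m n j) + n%:R))); apply: ler_prod => i _.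
  apply/andP; split.
    apply: sumr_ge0 => j _.
    by rewrite mulr_ge0 ?grid_prob_ge0 ?addr_ge0 ?l1norm_ge0.
  have iL : P.-integrable setT (fun w => (l1norm (xi i w) + (2 * n)%:R)%:E).
    have := integrableD measurableT (integrable_l1norm (xi_integrable i))
      (finite_measure_integrable_cst P (2 * n)%:R measurableT).
    exact: eq_integrable.
  rewrite -lee_fin -(integral_grid_round P (m_xi i) m (fun x => l1norm x + n%:R)).
  rewrite /Rintegral fineK; last exact: integrable_fin_num.
  apply: ge0_le_integral => //.
  - by move=> w _; rewrite lee_fin addr_ge0// l1norm_ge0.
  - apply/measurable_EFinP.
    exact: (measurable_grid_round_comp (m_xi i) m (fun x => l1norm x + n%:R)).
  - by apply/measurable_EFinP; apply: measurable_funD.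
  - move=> w _; rewrite lee_fin natrM mulr_natl mulr2n addrA lerD2r.
    exact: l1norm_grid_round.
apply/integrableP; split.
  apply/measurable_EFinP; apply: measurable_prod => i _.
  exact: measurable_funD.
have -> : (\int[P]_w `|(\prod_i (l1norm (xi i w) + n%:R))%:E| =
    \int[P]_w limn_einf (fun m => (h (fun i => grid_round m (xi i w)))%:E))%E.
  apply: eq_integral => w _; rewrite gee0_abs ?lee_fin//.
    apply/esym; apply: (cvg_limn_einf_sup _).1.
    apply: cvg_EFin; first by near=> m.
    apply: cvg_big => [|i _]; first exact: mul_continuous.
    by apply: cvgD; [exact: l1norm_grid_round_cvg|exact: cvg_cst].
  exact: (h0 (fun i => xi i w)).
apply: le_lt_trans (ltry H).
apply: le_trans (fatou P measurableT _ _) _.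
- by move=> m; apply/measurable_EFinP; exact: measurable_grids_fun.
- by move=> m w _; rewrite lee_fin.
rewrite limn_einf_lim; apply: lime_le; first exact: is_cvg_einfs.
near=> m; apply: le_trans (hH m); apply: ereal_inf_lbound; exists m => //=.
Unshelve. all: by end_near. Qed.

Notation gram x := (Num.sqrt (\det ((\matrix_i x i) *m (\matrix_i x i)^T))).

Lemma gram_grid_round_cvg (x : 'I_k -> 'rV[R]_n) :
  gram (fun i => grid_round m (x i)) @[m --> \oo] --> gram x.
Proof.
apply: (@cvg_comp _ _ _ _ (@Num.sqrt R)); last exact: sqrt_continuous.
apply: cvg_big => [|s _]; first exact: add_continuous.
apply: cvgMl_tmp; apply: cvg_big => [|i _]; first exact: mul_continuous.
have -> : ((\matrix_i x i) *m (\matrix_i x i)^T) i (s i) = \sum_c x i 0 c * x (s i) 0 c.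
  by rewrite mxE; apply: eq_bigr => c _; rewrite !mxE.
have -> : (fun m => ((\matrix_i grid_round m (x i)) *m
    (\matrix_i grid_round m (x i))^T) i (s i)) =
    fun m => \sum_c grid_round m (x i) 0 c * grid_round m (x (s i)) 0 c.
  by apply/funext => m; rewrite mxE; apply: eq_bigr => c _; rewrite !mxE.
apply: cvg_big => [|c _]; first exact: add_continuous.
by apply: cvgM; exact: grid_round_cvg.
Qed.

Lemma integral_gram_cvg :
  \sum_(j : {ffun 'I_k -> {ffun 'I_n -> 'I_(2 * (m.+1 * m.+1)).+1}})
     (\prod_i grid_prob P (xi i) (j i)) * gram (fun i => @grid_val R m n (j i))
  @[m --> \oo] --> \int[P]_w gram (fun i => xi i w) /\
  P.-integrable setT (fun w => (gram (fun i => xi i w))%:E).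
Proof.
have mG m : measurable_fun setT (fun w => gram (fun i => grid_round m (xi i w))).
  exact: (measurable_grids_fun m (fun x => gram x)).
have ig := integrableZl measurableT (Num.sqrt k`!%:R) integrable_prod_l1norm.
have [] := @dominated_convergence _ _ _ P setT measurableT
  (fun m w => (gram (fun i => grid_round m (xi i w)))%:E)
  (fun w => (gram (fun i => xi i w))%:E) _ _ _ _ ig _.
- by move=> m; apply/measurable_EFinP; exact: mG.
- apply/measurable_EFinP.
  apply: (measurable_fun_cvg mG) => w _; exact: gram_grid_round_cvg.
- apply: aeW => w _; apply: cvg_EFin; first by near=> m.
  exact: gram_grid_round_cvg.
- apply: aeW => w m _; rewrite abse_EFin lee_fin ger0_norm ?sqrtr_ge0//.
  apply: le_trans (sqrt_gram_le _) _; rewrite ler_wpM2l ?sqrtr_ge0// ler_prod// => i _.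
  by rewrite l1norm_ge0 l1norm_grid_round.
move=> ig' _ h; split=> //.
have -> : (fun m => \sum_(j : {ffun 'I_k -> {ffun 'I_n -> 'I_(2 * (m.+1 * m.+1)).+1}})
     (\prod_i grid_prob P (xi i) (j i)) * gram (fun i => @grid_val R m n (j i))) =
     fun m => fine (\int[P]_w (gram (fun i => grid_round m (xi i w)))%:E)%E.
  by apply/funext => m; rewrite (integral_grids m (fun x => gram x)).
have E : (\int[P]_w (gram (fun i => xi i w))%:E =
    (\int[P]_w gram (fun i => xi i w))%:E)%E.
  by rewrite /Rintegral fineK//; exact: integrable_fin_num.
by move: h; rewrite E => /fine_cvgP[_]; exact.
Unshelve. all: by end_near. Qed.

End independent_grids.

Section final_constants.
Context {R : realType}.

Lemma gram_scale k n (a : 'I_k -> R) (v : 'I_k -> 'rV[R]_n) : (forall i, 0 <= a i) ->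
  Num.sqrt (\det ((\matrix_i (a i *: v i)) *m (\matrix_i (a i *: v i))^T)) =
  (\prod_i a i) * Num.sqrt (\det ((\matrix_i v i) *m (\matrix_i v i)^T)).
Proof.
move=> a0; have -> : \matrix_i (a i *: v i) = diag_mx (\row_i a i) *m \matrix_i v i.
  apply/row_matrixP => i; rewrite rowK row_mul row_diag_mx -scalemxAl -rowE rowK.
  by rewrite mxE.
rewrite trmx_mul tr_diag_mx -mulmxA (mulmxA (\matrix_i v i)) !det_mulmx det_diag.
have -> : \prod_i (\row_i0 a i0) 0 i = \prod_i a i by apply: eq_bigr => i _; rewrite mxE.
have a0' : 0 <= \prod_i a i by exact: prodr_ge0.
by rewrite mulrCA -expr2 mulrC sqrtrM ?sqr_ge0// sqrtr_sqr ger0_norm.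
Qed.

(** In [2 / sqrt (2 / pi)] the 2 comes from the symmetric segments of [szono] and the square root
    from the first absolute moment of the normal law; one such factor arises for each of the [k]
    vectors. *)
Lemma powR_2pi k : (2 * pi) `^ (k%:R / 2) = (2 / Num.sqrt (2 / pi)) ^+ k :> R.
Proof.
have p0 : 0 < pi :> R := pi_gt0 R.
have -> : 2 / Num.sqrt (2 / pi) = Num.sqrt (2 * pi) :> R.
  have s0 : Num.sqrt (2 / pi) != 0 :> R by rewrite gt_eqF// sqrtr_gt0 divr_gt0.
  apply: (mulIf s0); rewrite divfK// -sqrtrM; last by rewrite mulr_ge0// ltW.
  rewrite (_ : 2 * pi * (2 / pi) = 2 ^+ 2); last first.
    by rewrite -mulrA (mulrCA pi) mulfV ?(gt_eqF p0)// mulr1 expr2.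
  by rewrite sqrtr_sqr ger0_norm.
have p2 : 0 <= 2 * pi :> R by rewrite mulr_ge0 ?(ltW p0).
by rewrite -powR12_sqrt// -powR_mulrn ?powR_ge0// -powRrM [2^-1 * _]mulrC.
Qed.

End final_constants.

(** * Identification of the two limits *)

Section discretised_bodies.
Context d (T : measurableType d) (R : realType) (P : probability T R) (k m : nat).
Variables (xi : 'I_k -> {RV P >-> 'rV[R]_(k + m)}) (Sigma : 'I_k -> 'M[R]_(k + m)).
Hypothesis k_gt0 : (0 < k)%N.
Hypothesis xi_indep : mutually_independent xi.
Hypothesis xi_gaussian : forall i, gaussian_vector (xi i).
Hypothesis xi_centered : forall i, centered (xi i).
Hypothesis xi_cov : forall i, covariance_matrix (xi i) (Sigma i).
Hypothesis Sigma_unit : forall i, Sigma i \in unitmx.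
Notation n := (k + m)%N.
Notation dot := (quad 1%:M).
Notation c0 := (Num.sqrt (2 / pi) : R).
Notation gram x := (Num.sqrt (\det ((\matrix_i x i) *m (\matrix_i x i)^T))).

(** Here [k] must be positive: the vector used to discretise the ball is made from one of the
    [xi i]. *)
Let i0 : 'I_k := Ordinal k_gt0.

Let xi_integrable i j : P.-integrable setT (fun w => (xi i w 0 j)%:E).
Proof. exact: gaussian_integrable. Qed.

Let Sigma_posdef i : posdef (Sigma i).
Proof. exact: gaussian_posdef (xi_gaussian i) (xi_centered i) (xi_cov i) (Sigma_unit i). Qed.

Let xi_abs i u : \int[P]_w `|dot (xi i w) u| = c0 * Num.sqrt (quad (Sigma i) u u).
Proof.
by rewrite /Rintegral (dot_abs (xi_gaussian i) (xi_centered i) (xi_cov i)).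
Qed.

(* A linear image of [xi i0] with identity covariance, used to discretise the ball. *)
Lemma standard_image : exists X : T -> 'rV[R]_n, [/\ measurable_fun setT X,
  forall j, P.-integrable setT (fun w => (X w 0 j)%:E) &
  forall u, \int[P]_w `|dot (X w) u| = c0 * Num.sqrt (quad 1%:M u u)].
Proof.
(* With no prescribed row, the rows of [y] form a basis orthonormal for [Sigma i0]; the covariance
   [y *m Sigma i0 *m y^T] of the image is then the identity. *)
have [y [_ yy]] := @orthonormal_complement R n (Sigma i0) 0 0 n (Sigma_posdef i0) (leqnn n).
have dotE x u : dot (x *m y^T) u = dot x (u *m y).
  by rewrite /quad !mulmx1 trmx_mul mulmxA.
exists (fun w => xi i0 w *m y^T); split.
- apply: (measurableT_comp (measurable_mulmx y^T) (measurable_funPT (xi i0))).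
- move=> j; have := integrable_dot (xi_integrable i0) (delta_mx 0 j *m y).
  by apply: eq_integrable => // w _; rewrite -dotE dot_delta.
- move=> u; have := xi_abs i0 (u *m y).
  have -> : quad (Sigma i0) (u *m y) (u *m y) = dot u u.
    rewrite /quad trmx_mul !mulmxA -2!(mulmxA u) yy //.
  by under eq_Rintegral do rewrite -dotE.
Qed.

(** Both sides are limits of the same sequence [zono_coef]: one by convergence of the zonotopes to
    the ellipsoids, the other by squeezing between multiples of [gram_sum]. *)
Lemma gram_mean_mixed_volume :
  mixed_volume (fun i => ellipsoid
    (match fintype.split i with inl a => Sigma a | inr _ => 1%:M end)) =
  2 ^+ n / n`!%:R * (m`!%:R / 2 ^+ m * kappa m *
    (c0^-1 ^+ k * \int[P]_w gram (fun i => xi i w))).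
Proof.
have c0_gt0 : 0 < c0 by rewrite sqrtr_gt0 divr_gt0// pi_gt0.
have [X [mX iX absX]] := standard_image.
have [eb [eb0 ebcvg ebP]] := grid_vec_close mX iX posdef1 c0_gt0 absX.
have /choice[ex exP] i := grid_vec_close (measurable_funPT (xi i)) (xi_integrable i)
  (Sigma_posdef i) c0_gt0 (xi_abs i).
have [e [e0 ecvg ebe exe]] : exists e : nat -> R, [/\ forall N, 0 <= e N,
    e N @[N --> \oo] --> (0 : R), forall N, eb N <= e N & forall i N, ex i N <= e N].
  (* The sum of the individual errors is a common error for all the bodies. *)
  exists (fun N => eb N + \sum_i ex i N); split=> [N||N|i N].
  - by rewrite addr_ge0// sumr_ge0// => i _; have [] := exP i.
  - rewrite -[X in _ --> X](addr0 (0 : R)); apply: cvgD => //.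
    rewrite [X in _ --> X](_ : 0 = \sum_(i < k) (0 : R)); last by rewrite big1.
    apply: cvg_big => [|i _]; first exact: add_continuous.
    by have [] := exP i.
  - by rewrite lerDl sumr_ge0// => i _; have [] := exP i.
  - rewrite (bigD1 i)//= addrCA lerDl addr_ge0// sumr_ge0// => j _.
    by have [] := exP j.
pose J N : finType := {ffun 'I_n -> 'I_(2 * (N.+1 * N.+1)).+1}.
pose wx N i : J N -> 'rV[R]_n := @grid_vec _ T R P n (xi i) c0 N.
pose wb N : J N -> 'rV[R]_n := @grid_vec _ T R P n X c0 N.
pose w N (i : 'I_n) : J N -> 'rV[R]_n :=
  match fintype.split i with inl a => wx N a | inr _ => wb N end.
have w_l N i : w N (lshift m i) = wx N i by rewrite /w (unsplitK (inl i)).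
have w_r N i : w N (rshift k i) = wb N by rewrite /w (unsplitK (inr i)).
have wbe N : support_close (wb N) 1%:M (e N) by exact: support_close_le (ebe N) (ebP N).
pose S (i : 'I_n) : 'M[R]_n :=
  match fintype.split i with inl a => Sigma a | inr _ => 1%:M end.
have pS i : posdef (S i) by rewrite /S; case: fintype.split => // _; exact: posdef1.
have wS N i : support_close (w N i) (S i) (e N).
  rewrite /w /S; case: fintype.split => [a|_]; last exact: wbe.
  by apply: (support_close_le (exe a N)); have [_ _ ] := exP a; exact.
have := zono_coef_cvg_mixed_volume pS e0 ecvg wS.
move=> /cvg_unique; apply=> //.
(* The nonnegative lengths [grid_prob / c0] leave the Gram root as a product, and become the joint
   weights of the independent rounded vectors. *)
have gram_sumE N : @gram_sum R k m (J N) (wx N) = 2 ^+ n / n`!%:R * (m`!%:R / 2 ^+ m * kappa m *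
    (c0^-1 ^+ k * \sum_(j : {ffun 'I_k -> J N})
     (\prod_i grid_prob P (xi i) (j i)) * gram (fun i => @grid_val R N n (j i)))).
  congr (_ * (_ * _)); rewrite mulr_sumr; apply: eq_bigr => f _.
  rewrite gram_scale => [|i]; last by rewrite divr_ge0 ?grid_prob_ge0// ltW.
  by rewrite big_split/= prodr_const card_ord mulrA [_ ^+ k * _]mulrC.
have gcvg : @gram_sum R k m (J N) (wx N) @[N --> \oo] --> 2 ^+ n / n`!%:R *
    (m`!%:R / 2 ^+ m * kappa m * (c0^-1 ^+ k * \int[P]_w gram (fun i => xi i w))).
  under eq_fun do rewrite gram_sumE.
  do 3 apply: cvgMl_tmp.
  exact: (integral_gram_cvg xi_indep xi_integrable).1.
move: (2 ^+ n / n`!%:R * _) gcvg => L gcvg.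
have cvg1 (u : nat -> R) : u N @[N --> \oo] --> (1 : R) ->
    u N ^+ m * @gram_sum R k m (J N) (wx N) @[N --> \oo] --> L.
  move=> u1; have -> : nbhs L = nbhs (1 ^+ m * L) by rewrite expr1n mul1r.
  apply: cvgM gcvg.
  exact: (cvg_comp u (fun t : R => t ^+ m) u1 (@exprn_continuous R m 1)).
apply: (@squeeze_cvgr _ _ _ _ (fun N => (1 - e N) ^+ m * @gram_sum R k m (J N) (wx N))
    (fun N => (1 + e N) ^+ m * @gram_sum R k m (J N) (wx N))).
- near=> N; apply: (zono_coef_bounds (w_l N) (w_r N)) => //.
  by near: N; exact: (cvgr_lt 0).
- apply: cvg1; rewrite -[X in _ --> X]subr0.
  by apply: cvgB => //; exact: cvg_cst.
- apply: cvg1; rewrite -[X in _ --> X]addr0.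
  by apply: cvgD => //; exact: cvg_cst.
Unshelve. all: by end_near. Qed.

End discretised_bodies.

Theorem theorem1p1 (R : realType) (disp : measure_display)
    (T : measurableType disp) (P : probability T R) (k d : nat)
    (k_ge1 : (1 <= k)%N) (k_le_d : (k <= d)%N)
    (xi : 'I_k -> {RV P >-> 'rV[R]_d}) (Sigma : 'I_k -> 'M[R]_d)
    (xi_indep : mutually_independent xi)
    (xi_gaussian : forall i, gaussian_vector (xi i))
    (xi_centered : forall i, centered (xi i))
    (xi_cov : forall i, covariance_matrix (xi i) (Sigma i))
    (xi_nondegenerate : forall i, Sigma i \in unitmx) :
  let M (w : T) : 'M[R]_(k, d) := \matrix_(i < k) xi i w in
  'E_P[fun w => (Num.sqrt (\det (M w *m (M w)^T)))%R]%E =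
  ((d ^_ k)%:R / ((2 * pi) `^ (k%:R / 2) * kappa (d - k)) *
   mixed_volume (pad_with_ball (fun i => ellipsoid (Sigma i))))%:E.
Proof.
have dE : d = (k + (d - k))%N by rewrite subnKC.
(* The dimension becomes a sum so that the [k] random rows and the [m] rows from the ball can be
   stacked as blocks. *)
move: (d - k)%N dE => m dE; subst d => M.
have E := gram_mean_mixed_volume k_ge1 xi_indep xi_gaussian xi_centered xi_cov xi_nondegenerate.
have -> : pad_with_ball (fun i => ellipsoid (Sigma i)) = fun i => ellipsoid
    (match fintype.split i with inl a => Sigma a | inr _ => 1%:M end).
  apply/funext => i; rewrite /pad_with_ball.
  case: fintype.splitP => a ia.
    have ak : (val i < k)%N by rewrite /= ia.
    by rewrite (insubT (fun j => j < k)%N ak) /=; congr (ellipsoid (Sigma _)); exact: val_inj.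
  rewrite insubF; first by rewrite closed_unit_ballE.
  by rewrite /= ia ltnNge leq_addr.
have [_ iG] := integral_gram_cvg xi_indep
  (fun i => gaussian_integrable (xi_gaussian i)).
rewrite E expectation.unlock.
transitivity ((\int[P]_w Num.sqrt (\det (M w *m (M w)^T)))%:E).
  by rewrite /Rintegral fineK//; exact: integrable_fin_num.
congr EFin; rewrite powR_2pi.
set G := \int[P]_w _; have c0_gt0 : 0 < (Num.sqrt (2 / pi) : R).
  by rewrite sqrtr_gt0 divr_gt0// pi_gt0.
have k0 : 0 < kappa m :> R by have [] := @vol_closed_unit_ball R m.
have fm : (k + m)`!%:R = ((k + m) ^_ k)%:R * m`!%:R :> R.
  by rewrite -natrM -[in m`!](addKn k m) ffact_fact// leq_addr.
have ff0 : ((k + m) ^_ k)%:R != 0 :> R by rewrite pnatr_eq0 -lt0n ffact_gt0 leq_addr.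
have mf0 : m`!%:R != 0 :> R by rewrite pnatr_eq0 -lt0n fact_gt0.
rewrite fm exprD !expr_div_n exprVn.
have c0n := lt0r_neq0 c0_gt0.
by field; rewrite !expf_neq0// mf0 ff0 (gt_eqF k0).
Qed.
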